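(* Let $(x_0,u_0)$ be a Pareto optimal solution of the multiobjective Mayer problem $(\mathcal M)$. Assume: (a) $f$ is continuous on $[0,T]\times\Omega\times U$; $D_{G,2}f(t,\xi,\zeta)$ exists for all $(t,\xi,\zeta)\in[0,T]\times\Omega\times U$; $D_{F,2}f(t,x_0(t),\zeta)$ exists for all $(t,\zeta)\in[0,T]\times U$; and $(t,\zeta)\mapsto D_{F,2}f(t,x_0(t),\zeta)$ is continuous from $[0,T]\times U$ to $\mathcal L(E,E)$; (b) for all non-empty compact $K\subset\Omega$ and all non-empty compact $M\subset U$, $\sup_{(t,\xi,\zeta)\in[0,T]\times K\times M}\|D_{G,2}f(t,\xi,\zeta)\|_{\mathcal L}<+\infty$; (c) $g_i^0$ ($1\le i\le l$) and $g^\alpha$ ($1\le\alpha\le m$) are Hadamard differentiable at $x_0(T)$; (d) each $h^\beta$ ($1\le\beta\le q$) is continuous on a neighborhood of $x_0(T)$ and Hadamard differentiable at $x_0(T)$. Then there exist $(\theta_i)_{1\le i\le l}\in\mathbb R^l$, $(\lambda_\alpha)_{1\le\alpha\le m}\in\mathbb R^m$, $(\mu_\beta)_{1\le\beta\le q}\in\mathbb R^q$ and $p\in PC^1([0,T],E^* )$ such that: (NN) $((\theta_i)_i,(\lambda_\alpha)_\alpha,(\mu_\beta)_\beta)\ne 0$; (Si) $\theta_i\ge0$ for all $i$ and $\lambda_\alpha\ge 0$ for all $\alpha$; (S$\ell$) $\lambda_\alpha g^\alpha(x_0(T))=0$ for all $\alpha$; (TC) $\sum_{i=1}^l\theta_iD_Hg_i^0(x_0(T))+\sum_{\alpha=1}^m\lambda_\alpha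 D_Hg^\alpha(x_0(T))+\sum_{\beta=1}^q\mu_\beta D_Hh^\beta(x_0(T))=p(T)$; (AE.M) $\underline{d}p(t)=-D_{F,2}H_M(t,x_0(t),u_0(t),p(t))$ for all $t\in[0,T]$; (MP.M) for all $t\in[0,T]$ and all $\zeta\in U$, $H_M(t,x_0(t),u_0(t),p(t))\ge H_M(t,x_0(t),\zeta,p(t))$; (CH.M) $t\mapsto H_M(t,x_0(t),u_0(t),p(t))$ is continuous on $[0,T]$.
   Context: Function spaces. Fix $T\in(0,+\infty)$. Let $Y$ be a Hausdorff space. A function $u:[0,T]\to Y$ is piecewise continuous if there is a subdivision $0=\tau_0<\tau_1<\dots<\tau_{k+1}=T$ such that $u$ is continuous on each $(\tau_i,\tau_{i+1})$, the right limits $u(\tau_i+)$ exist in $Y$ for $0\le i\le k$ and the left limits $u(\tau_i-)$ exist in $Y$ for $1\le i\le k+1$. $NPC^0([0,T],Y)$ is the set of piecewise continuous $u$ that are right continuous on $[0,T)$ and satisfy $u(T-)=u(T)$. If $Y$ is a real Banach space, $PC^1([0,T],Y)$ is the set of continuous $x:[0,T]\to Y$ for which there is a subdivision as before such that $x$ is continuously differentiable on each $(\tau_i,\tau_{i+1})$ and the one-sided limits $x'(\tau_i+)$ ($0\le i\le k$), $x'(\tau_i-)$ ($1\le i\le k+1$) exist in $Y$; for open $G\subset Y$, $PC^1([0,T],G)=\{x\in PC^1([0,T],Y): x([0,T])\subset G\}$. The extended derivative $\underline{d}x:[0,T]\to Y$ of such $x$ is $\underline{d}x(t)=x'(t)$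 if $t\notin\{\tau_0,\dots,\tau_{k+1}\}$, $\underline{d}x(\tau_i)=x'(\tau_i+)$ for $0\le i\le k$, $\underline{d}x(T)=x'(T-)$. Differentials. For real normed spaces $X,Y$, $\mathcal L(X,Y)$ is the space of bounded linear maps with operator norm $\|\cdot\|_{\mathcal L}$ and $X^*=\mathcal L(X,\mathbb R)$. Let $G\subset X$ be non-empty open, $\mathfrak f:G\to Y$, $x\in G$. $\mathfrak f$ is Gâteaux differentiable at $x$ if there is $D_G\mathfrak f(x)\in\mathcal L(X,Y)$ with $\lim_{t\to0+}\frac{\mathfrak f(x+th)-\mathfrak f(x)}{t}=D_G\mathfrak f(x)\cdot h$ for all $h\in X$; it is Hadamard differentiable at $x$ if there is $D_H\mathfrak f(x)\in\mathcal L(X,Y)$ such that for each compact $K\subset X$, $\lim_{t\to0+}\sup_{h\in K}\|\frac{\mathfrak f(x+th)-\mathfrak f(x)}{t}-D_H\mathfrak f(x)\cdot h\|=0$. $D_F\mathfrak f(x)$ is the Fréchet differential. $D_{G,k}$, $D_{F,k}$ denote partial Gâteaux/Fréchet differentials with respect to the $k$-th variable (e.g. $D_{G,2}f(t,\xi,\zeta)$ is the Gâteaux differential at $\xi$ of $f(t,\cdot,\zeta)$). Problem. $E$ is a real Banach space, $\Omega\subset E$ a non-empty open subset, $U$ a Hausdorff topological space, $\xi_0\in\Omega$, $l,m,q$ positive integers, $f:[0,T]\times\Omega\times U\to E$, and $g_i^0,g^\alpha,h^\beta:\Omega\to\mathbb R$ ($1\le i\le l$, $1\le\alpha\le m$,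 $1\le\beta\le q$). The multiobjective Mayer problem $(\mathcal M)$ is: maximize $(J_1(x,u),\dots,J_l(x,u))$, $J_i(x,u)=g_i^0(x(T))$, over $x\in PC^1([0,T],\Omega)$, $u\in NPC^0([0,T],U)$ subject to $\underline{d}x(t)=f(t,x(t),u(t))$ for all $t\in[0,T]$, $x(0)=\xi_0$, $g^\alpha(x(T))\ge0$ for all $\alpha$, $h^\beta(x(T))=0$ for all $\beta$. Pairs $(x,u)$ satisfying these constraints are admissible. An admissible $(\overline x,\overline u)$ is a Pareto optimal solution if there is no admissible $(x,u)$ with $J_i(x,u)\ge J_i(\overline x,\overline u)$ for all $i$ and $J_{i_0}(x,u)>J_{i_0}(\overline x,\overline u)$ for some $i_0$. Hamiltonian: $H_M:[0,T]\times\Omega\times U\times E^*\to\mathbb R$, $H_M(t,x,u,p)=p\cdot f(t,x,u)$. *)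

(* Defs.v *)
From HB Require Import structures.
From mathcomp Require Import all_boot all_order all_algebra.
From mathcomp Require Import all_classical all_reals all_analysis.

Set Implicit Arguments.
Unset Strict Implicit.
Unset Printing Implicit Defensive.

Import Order.TTheory GRing.Theory Num.Theory.
Import numFieldNormedType.Exports.

Local Open Scope ring_scope.
Local Open Scope classical_set_scope.

(* The normed space L(X, Y) of bounded linear maps.  It is built as a linear
   subspace of the function space X -> Y and normed by the operator norm. *)
Section BoundedLinear.
Context {R : realType} {X Y : normedModType R}.

Definition bounded_linear : {pred X -> Y} := fun A =>
  `[< linear A /\ exists M : R, forall h, `|A h| <= M * `|h| >].

Lemma bounded_linear_submod_closed : submod_closed bounded_linear.
Proof.
split.
  apply/asboolP; split=> [a u v|]; first by rewrite scaler0 addr0.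
  by exists 0 => h; rewrite normr0 mul0r.
move=> a A B /asboolP[Al [M AM]] /asboolP[Bl [N BN]]; apply/asboolP; split.
  move=> c u v; rewrite !fctE Al Bl !scalerDr !scalerA [a * c]mulrC.
  by rewrite addrACA.
exists (`|a| * M + N) => h; rewrite !fctE (le_trans (ler_normD _ _))//.
by rewrite normrZ mulrDl -mulrA lerD// ler_wpM2l.
Qed.

HB.instance Definition _ := GRing.isSubmodClosed.Build _ _ bounded_linear
  bounded_linear_submod_closed.

Record blin := Blin { blin_fun : X -> Y; _ : blin_fun \in bounded_linear }.

HB.instance Definition _ := [isSub for blin_fun].
HB.instance Definition _ := [Choice of blin by <:].
HB.instance Definition _ := [SubChoice_isSubLmodule of blin by <:].

Coercion blin_fun : blin >-> Funclass.

Definition opnorm (A : blin) : R := sup [set `|A h| | h in [set h | `|h| <= 1]].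

Lemma blin_linear (A : blin) : linear A.
Proof. by have /asboolP[] := valP A. Qed.

Lemma blinZ (A : blin) c h : A (c *: h) = c *: A h.
Proof.
have A0 : A 0 = 0.
  by apply: (addrI (A 0)); have := blin_linear A 1 0 0; rewrite !scale1r !addr0.
by have := blin_linear A c h 0; rewrite A0 !addr0.
Qed.

Lemma has_sup_opnorm (A : blin) : has_sup [set `|A h| | h in [set h | `|h| <= 1]].
Proof.
split; first by exists `|A 0|, 0 => //=; rewrite normr0.
have /asboolP[_ [M AM]] := valP A.
exists `|M| => _ [h /= h1 <-]; apply: (le_trans (AM h)).
by rewrite (le_trans (ler_norm _))// normrM normr_id ler_piMr.
Qed.

Lemma opnorm_ge (A : blin) h : `|h| <= 1 -> `|A h| <= opnorm A.
Proof. by move=> h1; apply: ub_le_sup; [case: (has_sup_opnorm A)|exists h]. Qed.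

Lemma opnorm_le (A : blin) (M : R) :
  (forall h, `|h| <= 1 -> `|A h| <= M) -> opnorm A <= M.
Proof.
move=> AM; apply: ge_sup; first by case: (has_sup_opnorm A).
by move=> _ [h /= h1 <-]; exact: AM.
Qed.

Lemma opnorm_bound (A : blin) h : `|A h| <= opnorm A * `|h|.
Proof.
have [->|h0] := eqVneq h 0.
  by rewrite -(scale0r 0) blinZ !scale0r !normr0 mulr0.
have -> : `|A h| = `|A (`|h|^-1 *: h)| * `|h|.
  by rewrite blinZ normrZ normfV normr_id mulrAC mulVf ?normr_eq0// mul1r.
rewrite ler_wpM2r// opnorm_ge//.
by rewrite normrZ normfV normr_id mulVf// normr_eq0.
Qed.

Lemma opnormD A B : opnorm (A + B) <= opnorm A + opnorm B.
Proof.
apply: opnorm_le => h h1; rewrite (le_trans (ler_normD _ _))//.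
by rewrite lerD// opnorm_ge.
Qed.

Lemma opnormZ c A : opnorm (c *: A) = `|c| * opnorm A.
Proof.
have le_opnormZ d B : opnorm (d *: B) <= `|d| * opnorm B.
  by apply: opnorm_le => h h1; rewrite [X in `|X|]/= normrZ ler_wpM2l// opnorm_ge.
apply/eqP; rewrite eq_le le_opnormZ/=.
have [->|c0] := eqVneq c 0.
  by rewrite normr0 mul0r (le_trans _ (opnorm_ge _ (_ : `|0| <= 1)))// normr0.
rewrite -ler_pdivlMl ?normr_gt0// -normfV.
by rewrite (le_trans _ (le_opnormZ _ _))// scalerA mulVf// scale1r.
Qed.

Lemma opnorm_eq0 A : opnorm A = 0 -> A = 0.
Proof.
move=> A0; apply/val_inj/funext => h; apply/eqP; rewrite -normr_le0.
by rewrite (le_trans (opnorm_bound A h))// A0 mul0r.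
Qed.

HB.instance Definition _ :=
  Lmodule_isNormed.Build R blin opnormD opnormZ opnorm_eq0.

Lemma blin_normE (A : blin) : `|A| = opnorm A. Proof. by []. Qed.

End BoundedLinear.
Arguments blin {R} X Y.

Section Differentials.
Context {R : realType} {X Y : normedModType R}.
Implicit Types (f : X -> Y) (x : X) (D : blin X Y).

Definition is_gateaux f x D :=
  forall h, t^-1 *: (f (x + t *: h) - f x) @[t --> 0^'+] --> D h.

Definition gateaux_differentiable f x := exists D, is_gateaux f x D.

Definition DG f x : blin X Y := xget 0 [set D | is_gateaux f x D].

(* The supremum is taken in \bar R, where it is meaningful even when it is
   infinite; K is non-empty because ereal_sup set0 = -oo. *)
Definition is_hadamard f x D := forall K : set X, compact K -> K !=set0 ->
  ereal_sup [set (`|t^-1 *: (f (x + t *: h) - f x) - D h|)%:E | h in K]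
    @[t --> 0^'+] --> 0%E.

Definition hadamard_differentiable f x := exists D, is_hadamard f x D.

Definition DH f x : blin X Y := xget 0 [set D | is_hadamard f x D].

(* The library's Fréchet differential as an element of L(X, Y); the default
   value 0 is only used where f is not differentiable. *)
Definition DF f x : blin X Y := insubd 0 ('d f x : X -> Y).

Lemma is_gateaux_unique f x D D' : is_gateaux f x D -> is_gateaux f x D' -> D = D'.
Proof.
move=> fD fD'; apply/val_inj/funext => h.
exact: (cvg_unique _ (fD h) (fD' h)).
Qed.

Lemma is_hadamard_gateaux f x D : is_hadamard f x D -> is_gateaux f x D.
Proof.
move=> fD h; have := fD [set h] (@compact_set1 _ h) (ex_intro _ h erefl).
under eq_fun do rewrite image_set1 ereal_sup1.
move=> /fine_cvgP[_] /= fh; apply: cvg_zero; apply/norm_cvg0P.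
exact: fh.
Qed.

Lemma DF_diff f x : differentiable f x -> DF f x = 'd f x :> (X -> Y).
Proof.
move=> dfx; rewrite /DF val_insubd ifT//; apply/asboolP; split.
  exact: linearP.
have /linear_bounded_continuous/linear_boundedP := diff_continuous dfx.
move=> [M [Mreal Mle]]; exists (M + 1) => h.
by apply: Mle; rewrite ltrDl.
Qed.

End Differentials.

Section PiecewiseFunctions.
Context {R : realType}.
Implicit Type T : R.

(* 0 :: s is the subdivision 0 = tau_0 < tau_1 < ... < tau_(size s) = T *)
Definition pc_subdivision (Y : topologicalType) T (s : seq R) (u : R -> Y) :=
  itv_partition 0 T s /\
  forall i, (i < size s)%N ->
    let a := nth T (0 :: s) i in let b := nth T (0 :: s) i.+1 in
    [/\ {in `]a, b[, continuous u},
        (exists y : Y, u @ a^'+ --> y) & (exists y : Y, u @ b^'- --> y)].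

Definition piecewise_continuous (Y : topologicalType) T (u : R -> Y) :=
  exists s, pc_subdivision T s u.

Definition NPC0 (Y : topologicalType) T (u : R -> Y) :=
  [/\ piecewise_continuous T u,
      forall t, 0 <= t < T -> u @ t^'+ --> u t & u @ T^'- --> u T].

Definition C1_subdivision (Y : normedModType R) T (s : seq R) (x : R -> Y) :=
  (forall i, (i < size s)%N ->
    {in `]nth T (0 :: s) i, nth T (0 :: s) i.+1[, forall t, derivable x t 1}) /\
  pc_subdivision T s x^`().

Definition PC1 (Y : normedModType R) T (x : R -> Y) :=
  {within `[0, T], continuous x} /\ exists s, C1_subdivision T s x.

Definition PC1_in (Y : normedModType R) T (G : set Y) (x : R -> Y) :=
  PC1 T x /\ x @` `[0, T] `<=` G.

Definition ext_derive_on (Y : normedModType R) T (s : seq R) (x : R -> Y) (t : R) : Y :=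
  if t == T then lim (x^`() @ T^'-)
  else if t \in 0 :: s then lim (x^`() @ t^'+)
  else x^`() t.

(* By ext_derive_onE below, the choice of the subdivision is immaterial. *)
Definition ext_derive (Y : normedModType R) T (x : R -> Y) : R -> Y :=
  ext_derive_on T (xget [::] [set s | C1_subdivision T s x]) x.

Lemma pc_subdivision_continuous (Y : topologicalType) T s (u : R -> Y) (t : R) :
  pc_subdivision T s u -> 0 <= t < T -> t \notin 0 :: s -> {for t, continuous u}.
Proof.
move=> [[_ /eqP lastT] us] /andP[t0 tT] ts.
set P := fun y : R => t < y.
have hasT : has P (0 :: s).
  by apply/hasP; exists T => //; rewrite -lastT mem_last.
have := @before_find _ T P (0 :: s).
have := nth_find T hasT; move: hasT; rewrite has_find.
case: (find P (0 :: s)) => [|i]; first by rewrite /P/= ltNge t0.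
rewrite /= ltnS => si ti /(_ i (leqnn _))/negbT; rewrite -leNgt => it.
have [+ _ _] := us i si; move=> /(_ t) ut; apply: ut.
rewrite inE/= in_itv/=; apply/andP; split => //.
rewrite lt_neqAle it andbT; apply: contra ts => /eqP <-.
by rewrite mem_nth//= ltnS ltnW.
Qed.

Lemma ext_derive_on_lim (Y : normedModType R) T s (x : R -> Y) (t : R) :
  C1_subdivision T s x -> 0 <= t <= T ->
  ext_derive_on T s x t =
    if t == T then lim (x^`() @ T^'-) else lim (x^`() @ t^'+).
Proof.
move=> [_ xs] /andP[t0 tT]; rewrite /ext_derive_on; case: ifPn => // tneqT.
case: ifPn => // ts; apply/esym/cvg_lim => //.
apply: cvg_at_right_filter.
by apply: (pc_subdivision_continuous xs) => //; rewrite t0 lt_neqAle tneqT.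
Qed.

Lemma ext_derive_onE (Y : normedModType R) T s (x : R -> Y) (t : R) :
  C1_subdivision T s x -> 0 <= t <= T ->
  ext_derive T x t = ext_derive_on T s x t.
Proof.
move=> xs tT; rewrite /ext_derive (ext_derive_on_lim xs)//.
rewrite ext_derive_on_lim//.
exact: (@xgetPex _ [::] [set s | C1_subdivision T s x] (ex_intro _ s xs)).
Qed.

End PiecewiseFunctions.

(* Functions on [0, T] or Omega are encoded as total functions whose values
   outside the domain are irrelevant: functions of time are only constrained
   on [0, T], and Omega is meant to be open, so that limits and differentials
   at a point of Omega only depend on the values near that point. *)
Section Mayer.
Context {R : realType} {E : completeNormedModType R} {U : topologicalType}.
Context (T : R) (Omega : set E) (xi0 : E) (l m q : nat).
Context (f : R -> E -> U -> E).
Context (g0 : 'I_l -> E -> R) (g : 'I_m -> E -> R) (h : 'I_q -> E -> R).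

Definition mayer_admissible (x : R -> E) (u : R -> U) :=
  [/\ PC1_in T Omega x /\ NPC0 T u,
      forall t, 0 <= t <= T -> ext_derive T x t = f t (x t) (u t),
      x 0 = xi0,
      forall a, 0 <= g a (x T) &
      forall b, h b (x T) = 0].

Definition mayer_objective (i : 'I_l) (x : R -> E) (u : R -> U) : R :=
  g0 i (x T).

Definition mayer_pareto (x : R -> E) (u : R -> U) :=
  mayer_admissible x u /\
  ~ exists y v, [/\ mayer_admissible y v,
      forall i, mayer_objective i y v >= mayer_objective i x u &
      exists i0, mayer_objective i0 y v > mayer_objective i0 x u].

Definition hamiltonian (t : R) (xi : E) (z : U) (p : blin E R) : R :=
  p (f t xi z).

End Mayer.

(* Main.v *)
(* Perturb [u0] by finitely many needles: short intervals, of lengths proportional to a small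
   [w], on which the control takes other values. To first order in [w] the end point moves by the
   sum of the vectors [X T (S t (f t x0 z - f t x0 u0))], where [X] is the resolvent of the
   linearized equation and [S] its inverse. The images of these sums under the differentials of
   the objectives and constraints, decreased by arbitrary slacks in the inequality components,
   form a convex cone. If this cone were the whole space, there would be a family of needles,
   parametrized by a cube, moving the equality constraints in every direction while improving
   all objectives; as the constraints are only continuous near [x0 T], the Poincare-Miranda
   theorem replaces the implicit function theorem, and yields an admissible process that
   contradicts Pareto optimality. A linear form separating the cone from a point outside it gives
   the multipliers; transporting it back along the resolvent gives the adjoint arc, and its
   sign on a single needle is the maximum principle. *)

Require Import Defs.
From HB Require Import structures.
From mathcomp Require Import all_boot all_order all_algebra.
From mathcomp Require Import all_classical all_reals all_analysis.
From mathcomp Require Import measurable_realfun.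
From mathcomp Require Import ring lra.

Set Implicit Arguments.
Unset Strict Implicit.
Unset Printing Implicit Defensive.

Import Order.TTheory GRing.Theory Num.Theory.
Import numFieldNormedType.Exports.

Local Open Scope ring_scope.
Local Open Scope classical_set_scope.

(** * Right derivatives and bounded linear maps *)

(** Off the reference arc [f] is only Gateaux differentiable in the state, with differentials
    bounded on compact sets; this yields a Lipschitz bound, valid on a tube around the compact arc
    for controls in one fixed compact set. On the arc [f] is Frechet differentiable, but no
    uniformity in time is assumed for the remainder. The rescaled linearization error thus tends to
    0 only pointwise in [t], and dominated convergence makes its integral negligible; Lebesgue
    integration enters nowhere else. The rest rests on a mean value inequality for right
    derivatives, from which primitives, Gronwall's inequality and flows in Banach spaces are
    derived. Hadamard differentiability at the end point is used through a joint limit in step and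
    direction, made uniform over the cube of parameters by compactness. Inactive constraints enter
    the cone with slacks of both signs, which forces their multipliers to vanish. Needles sit at
    times [t < T] only; the maximum principle at [T] and the continuity of the Hamiltonian at jumps
    of the control are recovered by one-sided limits. *)

Section RightNeighborhoods.
Context {R : realType}.
Implicit Types (a b c t s x : R) (P : R -> Prop).

Lemma near_rightP t P :
  (\forall s \near t^'+, P s) <-> exists2 d : R, 0 < d & forall s, t < s < t + d -> P s.
Proof.
split.
  move=> /nbhs_right0P; rewrite /at_right near_withinE => -[e /= e0 eP].
  exists e => // s /andP[ts se].
  have -> : s = t + (s - t) by rewrite addrC subrK.
  apply: eP; rewrite ?subr_gt0//= sub0r normrN gtr0_norm ?subr_gt0//; lra.
move=> [d d0 dP]; near=> s; apply: dP; apply/andP; split => //.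
near: s; apply: nbhs_right_lt; lra.
Unshelve. all: by end_near. Qed.

Lemma near_leftP t P :
  (\forall s \near t^'-, P s) <-> exists2 d : R, 0 < d & forall s, t - d < s < t -> P s.
Proof.
split.
  move=> /nbhs_left0P; rewrite /at_right near_withinE => -[e /= e0 eP].
  exists e => // s /andP[ts se].
  have -> : s = t - (t - s) by rewrite opprB addrC subrK.
  apply: eP; rewrite ?subr_gt0//= sub0r normrN gtr0_norm ?subr_gt0//; lra.
move=> [d d0 dP]; near=> s; apply: dP; apply/andP; split => //.
near: s; apply: nbhs_left_gt; lra.
Unshelve. all: by end_near. Qed.

(** The supremum of the points up to which [P] holds satisfies [P] by the left hypothesis, and the
    right hypothesis pushes past it unless it is [b]. This principle replaces finite subdivisions
    and covering arguments on intervals. *)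
Lemma real_induction a b P : a <= b -> P a ->
  (forall c, a <= c < b -> (forall x, a <= x <= c -> P x) -> \forall x \near c^'+, P x) ->
  (forall c, a < c <= b -> (forall x, a <= x < c -> P x) -> P c) ->
  forall c, a <= c <= b -> P c.
Proof.
move=> ab Pa Pr Pl.
pose S := [set c | a <= c <= b /\ forall x, a <= x <= c -> P x].
have Sa : S a.
  split; first by rewrite lexx.
  by move=> x /le_anti <-.
have hS : has_sup S by split; [exists a|exists b => c [/andP[]]].
have aS : a <= sup S by apply: ub_le_sup => //; case: hS.
have Sb : sup S <= b by apply: ge_sup; [case: hS|move=> c [/andP[]]].
have Plt x : a <= x < sup S -> P x.
  move=> /andP[ax xS]; have [c Sc xc] := sup_gt (proj1 hS) xS.
  by case: Sc => _; apply; rewrite ax ltW.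
have PS : P (sup S).
  move: aS; rewrite le_eqVlt => /predU1P[<-//|aS].
  by apply: Pl => //; rewrite aS.
have Ple x : a <= x <= sup S -> P x.
  move=> /andP[ax]; rewrite le_eqVlt => /predU1P[->//|xS].
  by apply: Plt; rewrite ax.
have SE : sup S = b.
  apply/eqP; rewrite eq_le Sb/= leNgt; apply/negP => Sltb.
  have /near_rightP[d d0 dP] := Pr _ (introT andP (conj aS Sltb)) Ple.
  pose c := Num.min (sup S + d / 2) b.
  have cS : sup S < c by rewrite /c lt_min Sltb andbT; lra.
  have cd : c < sup S + d by rewrite /c gt_min; apply/orP; left; lra.
  suff Sc : S c.
    by have := ub_le_sup (proj2 hS) Sc; rewrite leNgt cS.
  split; first by rewrite (le_trans aS (ltW cS))/= /c ge_min lexx orbT.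
  move=> x /andP[ax xc]; have [xS|Sx] := leP x (sup S).
    by apply: Ple; rewrite ax.
  by apply: dP; rewrite Sx (le_lt_trans xc).
by move=> c ?; apply: Ple; rewrite SE.
Qed.

End RightNeighborhoods.

Section RightDerivative.
Context {R : realType} {X : normedModType R}.
Implicit Types (F G : R -> X) (t : R) (d : X).

(** The limit of the right difference quotient, multiplied out by [s - t] so that estimates need no
    division. *)
Definition rderiv F t d := forall e : R, 0 < e ->
  \forall s \near t^'+, `|F s - F t - (s - t) *: d| <= e * (s - t).

Lemma rderiv_eq F G t d : F t = G t -> (\forall s \near t^'+, F s = G s) ->
  rderiv F t d -> rderiv G t d.
Proof.
move=> FGt FG Fd e e0; near=> s; rewrite -FGt.
have <- : F s = G s by near: s.
by near: s; exact: Fd.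
Unshelve. all: by end_near. Qed.

Lemma rderiv_cst (x : X) t : rderiv (fun=> x) t 0.
Proof.
move=> e e0; near=> s.
by rewrite subrr scaler0 subr0 normr0 mulr_ge0 ?ltW// subr_gt0.
Unshelve. all: by end_near. Qed.

Lemma rderivD F G t d d' : rderiv F t d -> rderiv G t d' ->
  rderiv (fun s => F s + G s) t (d + d').
Proof.
move=> Fd Gd e e0; have e20 : 0 < e / 2 by rewrite divr_gt0.
near=> s.
have -> : F s + G s - (F t + G t) - (s - t) *: (d + d') =
  (F s - F t - (s - t) *: d) + (G s - G t - (s - t) *: d').
  rewrite scalerDr !opprD; set x := (s - t) *: d; set y := (s - t) *: d'.
  by rewrite -!addrA; congr (_ + _); rewrite addrCA; congr (_ + _);
    rewrite [RHS]addrCA; congr (_ + _); rewrite addrCA.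
rewrite (le_trans (ler_normD _ _))// (splitr (e * (s - t))) lerD//.
  by rewrite mulrAC; near: s; exact: Fd.
by rewrite mulrAC; near: s; exact: Gd.
Unshelve. all: by end_near. Qed.

Lemma rderiv_line (v : X) c t : rderiv (fun s => (s - c) *: v) t v.
Proof.
move=> e e0; near=> s.
rewrite -scalerBl -scalerBl (_ : _ - _ = 0); last by ring.
by rewrite scale0r normr0 mulr_ge0 ?ltW// subr_gt0.
Unshelve. all: by end_near. Qed.

Lemma rderiv_cvg F t d : rderiv F t d -> F @ t^'+ --> F t.
Proof.
move=> Fd; apply/cvgrPdist_le => e e0.
have /near_rightP[r r0 rP] := Fd 1 ltr01.
have D0 : 0 < 1 + `|d| by rewrite ltr_wpDr.
apply/near_rightP; exists (Num.min r (e / (1 + `|d|))).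
  by rewrite lt_min r0/= divr_gt0.
move=> s /andP[ts sr].
have st0 : 0 < s - t by rewrite subr_gt0.
have sr1 : s < t + r by rewrite (lt_le_trans sr)// lerD2l ge_min lexx.
have sr2 : s - t <= e / (1 + `|d|).
  by rewrite lerBlDl (le_trans (ltW sr))// lerD2l ge_min lexx orbT.
rewrite distrC -(subrK ((s - t) *: d) (F s - F t)).
rewrite (le_trans (ler_normD _ _))//.
rewrite (le_trans (lerD (rP s _) (lexx _))) ?ts ?sr1//.
rewrite normrZ gtr0_norm// mul1r -{1}(mulr1 (s - t)) -mulrDr.
by rewrite -ler_pdivlMr.
Qed.

End RightDerivative.

Section BlinTheory.
Context {R : realType} {X Y : normedModType R}.
Implicit Types A B : blin X Y.

Lemma blinD A x y : A (x + y) = A x + A y.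
Proof. by have := blin_linear A 1 x y; rewrite !scale1r. Qed.

Lemma blin0 A : A 0 = 0.
Proof. by have := blinZ A 0 0; rewrite !scale0r. Qed.

Lemma blinN A x : A (- x) = - A x.
Proof. by rewrite -scaleN1r blinZ scaleN1r. Qed.

Lemma blinB A x y : A (x - y) = A x - A y.
Proof. by rewrite blinD blinN. Qed.

Lemma blin_sum A I (r : seq I) (P : pred I) (F : I -> X) :
  A (\sum_(i <- r | P i) F i) = \sum_(i <- r | P i) A (F i).
Proof. exact: (big_morph A (blinD A) (blin0 A)). Qed.

Lemma blin_addE A B x : (A + B) x = A x + B x. Proof. by []. Qed.
Lemma blin_oppE A x : (- A) x = - A x. Proof. by []. Qed.
Lemma blin_scaleE c A x : (c *: A) x = c *: A x. Proof. by []. Qed.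
Lemma blin_zeroE x : (0 : blin X Y) x = 0. Proof. by []. Qed.
Lemma blin_sumE I (r : seq I) (P : pred I) (F : I -> blin X Y) x :
  (\sum_(i <- r | P i) F i) x = \sum_(i <- r | P i) F i x.
Proof. exact: (big_morph (fun A : blin X Y => A x)). Qed.

Lemma blin_norm_le A x : `|A x| <= `|A| * `|x|.
Proof. exact: opnorm_bound. Qed.

Lemma blin_le_norm A M : 0 <= M -> (forall x, `|A x| <= M * `|x|) -> `|A| <= M.
Proof.
move=> M0 AM; apply: opnorm_le => h h1.
by rewrite (le_trans (AM h))// ler_piMr.
Qed.

Lemma blin_ext A B : (forall x, A x = B x) -> A = B.
Proof. by move=> AB; apply/val_inj/funext. Qed.

Lemma mk_blin_subproof (f : X -> Y) (M : R) : linear f ->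
  (forall x, `|f x| <= M * `|x|) -> f \in bounded_linear.
Proof. by move=> lf fM; apply/asboolP; split => //; exists M. Qed.

Definition mk_blin (f : X -> Y) M (lf : linear f)
  (fM : forall x, `|f x| <= M * `|x|) : blin X Y := Blin (mk_blin_subproof lf fM).

End BlinTheory.

Section BlinComposition.
Context {R : realType} {X Y Z : normedModType R}.

Lemma blin_comp_linear (B : blin Y Z) (A : blin X Y) : linear (B \o A).
Proof. by move=> c x y; rewrite /= !(blinD, blinZ). Qed.

Lemma blin_comp_bound (B : blin Y Z) (A : blin X Y) x :
  `|(B \o A) x| <= `|B| * `|A| * `|x|.
Proof.
by rewrite (le_trans (blin_norm_le _ _))// -mulrA ler_wpM2l// blin_norm_le.
Qed.

Definition blin_comp (B : blin Y Z) (A : blin X Y) : blin X Z :=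
  mk_blin (@blin_comp_linear B A) (blin_comp_bound B A).

Lemma blin_compE B A x : blin_comp B A x = B (A x). Proof. by []. Qed.

Lemma blin_comp_norm B A : `|blin_comp B A| <= `|B| * `|A|.
Proof. by apply: blin_le_norm; [rewrite mulr_ge0|exact: blin_comp_bound]. Qed.

End BlinComposition.

Lemma blin_id_subproof {R : realType} {X : normedModType R} : linear (@idfun X).
Proof. by []. Qed.

Lemma blin_id_bound {R : realType} {X : normedModType R} (x : X) :
  `|idfun x| <= 1 * `|x|.
Proof. by rewrite mul1r. Qed.

Definition blin_id {R : realType} {X : normedModType R} : blin X X :=
  mk_blin (@blin_id_subproof R X) blin_id_bound.

Section RightDerivativeLinear.
Context {R : realType} {X Y : normedModType R}.

Lemma rderivB (F G : R -> X) t d d' : rderiv F t d -> rderiv G t d' ->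
  rderiv (fun s => F s - G s) t (d - d').
Proof.
move=> Fd Gd; apply: rderivD => // e /Gd; apply: filterS => s.
by rewrite -normrN !opprD !opprK scalerN opprK.
Qed.

Lemma rderiv_sum (I : Type) (r : seq I) (P : pred I) (F : I -> R -> X) t d :
  (forall i, P i -> rderiv (F i) t (d i)) ->
  rderiv (fun s => \sum_(i <- r | P i) F i s) t (\sum_(i <- r | P i) d i).
Proof.
move=> Fd; elim: r => [|i r IHr].
  rewrite big_nil; under eq_fun do rewrite big_nil; exact: rderiv_cst.
rewrite big_cons; under eq_fun do rewrite big_cons.
by case: ifPn => // Pi; apply: rderivD => //; exact: Fd.
Qed.

End RightDerivativeLinear.

Section BoundedBilinear.
Context {R : realType} {X Y Z : normedModType R}.

(** The constant 1 in the norm bound suffices for every product met below: composition and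
    application of operators, scaling, multiplication of reals. One product rule then covers them
    all. *)
Definition bounded_bilinear (b : X -> Y -> Z) := [/\ forall x, linear (b x),
  forall y, linear (b^~ y) & forall x y, `|b x y| <= `|x| * `|y|].

Variables (b : X -> Y -> Z) (bb : bounded_bilinear b).

Lemma bilinBl x x' y : b (x - x') y = b x y - b x' y.
Proof. by have [_ bl _] := bb; rewrite addrC -scaleN1r bl scaleN1r addrC. Qed.

Lemma bilinBr x y y' : b x (y - y') = b x y - b x y'.
Proof. by have [br _ _] := bb; rewrite addrC -scaleN1r br scaleN1r addrC. Qed.

Lemma bilinBB x y x' y' :
  b x y - b x' y' = b (x - x') (y - y') + b (x - x') y' + b x' (y - y').
Proof. by rewrite (bilinBr (x - x')) subrK bilinBl bilinBr addrA subrK. Qed.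

Lemma bilin_cvg T (F : set_system T) {FF : Filter F} (f : T -> X) (g : T -> Y) x y :
  f @ F --> x -> g @ F --> y -> (fun t => b (f t) (g t)) @ F --> b x y.
Proof.
move=> fx gy; have [br bl bn] := bb.
apply: cvg_zero.
have H : `|f t - x| * `|g t - y| + `|f t - x| * `|y| + `|x| * `|g t - y| @[t --> F]
   --> (0 : R).
  have fx0 : `|f t - x| @[t --> F] --> (0 : R).
    by rewrite -(normr0 X) -(subrr x); apply: cvg_norm; exact: cvgB fx (cvg_cst x).
  have gy0 : `|g t - y| @[t --> F] --> (0 : R).
    by rewrite -(normr0 Y) -(subrr y); apply: cvg_norm; exact: cvgB gy (cvg_cst y).
  rewrite (_ : 0 = 0 * 0 + 0 * `|y| + `|x| * 0); last by rewrite !(mul0r, mulr0) !addr0.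
  apply: cvgD; last exact: cvgM (cvg_cst _) gy0.
  apply: cvgD; first exact: cvgM.
  exact: cvgM fx0 (cvg_cst _).
apply/norm_cvg0P; apply: (squeeze_cvgr _ (cvg_cst 0) H).
apply: nearW => t; rewrite normr_ge0/=.
rewrite -[X in `|X|]/(b (f t) (g t) - b x y) bilinBB.
by rewrite (le_trans (ler_normD _ _))// lerD// (le_trans (ler_normD _ _))// lerD.
Qed.

Lemma rderiv_bilin (F : R -> X) (G : R -> Y) t d d' :
  rderiv F t d -> rderiv G t d' ->
  rderiv (fun s => b (F s) (G s)) t (b d (G t) + b (F t) d').
Proof.
move=> Fd Gd e e0.
have [br bl bn] := bb.
pose M := 1 + `|F t| + `|G t| + `|d|.
have F0 := normr_ge0 (F t); have G0 := normr_ge0 (G t); have d0 := normr_ge0 d.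
have M1 : 1 <= M by rewrite /M; lra.
have FM : `|F t| <= M by rewrite /M; lra.
have GM : `|G t| <= M by rewrite /M; lra.
have dM : `|d| <= M by rewrite /M; lra.
(* The increment of the product splits into a product of increments and two linearization errors,
   which cost [2 * M * e1], [M * e1] and [M * e1] per unit of time. The cap 1 on [e1] is what bounds
   the growth of [F] by [2 * M]. *)
pose e1 := Num.min 1 (e / (4 * M)).
have e10 : 0 < e1 by rewrite lt_min ltr01 divr_gt0//; lra.
have e11 : e1 <= 1 by rewrite ge_min lexx.
have e1e : e1 * (4 * M) <= e by rewrite -ler_pdivlMr ?ge_min ?lexx ?orbT//; lra.
near=> s.
have st : 0 < s - t by rewrite subr_gt0.
have Fs : `|F s - F t - (s - t) *: d| <= e1 * (s - t) by near: s; exact: Fd.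
have Gs : `|G s - G t - (s - t) *: d'| <= e1 * (s - t) by near: s; exact: Gd.
have Gs1 : `|G s - G t| <= e1.
  near: s; exact: cvgr_distC_le (rderiv_cvg Gd) _ e10.
have Fs1 : `|F s - F t| <= 2 * M * (s - t).
  rewrite -[F s - F t](subrK ((s - t) *: d)) (le_trans (ler_normD _ _))//.
  rewrite (le_trans (lerD Fs (lexx _)))// normrZ gtr0_norm//.
  nra.
have b0l w : b 0 w = 0 by rewrite -(subrr 0) bilinBl subrr.
have b0r w : b w 0 = 0 by rewrite -(subrr 0) bilinBr subrr.
have bZl c u w : b (c *: u) w = c *: b u w by have := bl w c u 0; rewrite !addr0 b0l addr0.
have bZr c u w : b w (c *: u) = c *: b w u by have := br w c u 0; rewrite !addr0 b0r addr0.
have -> : b (F s) (G s) - b (F t) (G t) - (s - t) *: (b d (G t) + b (F t) d') =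
   b (F s - F t) (G s - G t) + b (F s - F t - (s - t) *: d) (G t)
   + b (F t) (G s - G t - (s - t) *: d').
  rewrite bilinBB scalerDr -(bZl _ d) -(bZr _ d') (bilinBl (F s - F t)) (bilinBr _ (G s - G t)).
  by rewrite opprD addrACA !addrA.
rewrite (le_trans (ler_normD _ _))//.
apply: (@le_trans _ _ (2 * M * (s - t) * e1 + e1 * (s - t) * M + M * (e1 * (s - t)))).
  apply: lerD; last by rewrite (le_trans (bn _ _))// ler_pM.
  rewrite (le_trans (ler_normD _ _))//; apply: lerD.
    by rewrite (le_trans (bn _ _))// ler_pM.
  by rewrite (le_trans (bn _ _))// ler_pM.
have -> : 2 * M * (s - t) * e1 + e1 * (s - t) * M + M * (e1 * (s - t)) =
  e1 * (4 * M) * (s - t) by ring.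
by rewrite ler_wpM2r// ltW.
Unshelve. all: by end_near. Qed.

End BoundedBilinear.

Lemma bounded_bilinear_comp {R : realType} {X Y Z : normedModType R} :
  bounded_bilinear (fun (B : blin Y Z) (A : blin X Y) => blin_comp B A).
Proof.
split=> [B c A A'|A c B B'|B A]; last exact: blin_comp_norm.
  by apply: blin_ext => x; rewrite blin_compE blin_addE blin_scaleE blinD blinZ.
by apply: blin_ext => x.
Qed.

Lemma bounded_bilinear_app {R : realType} {X Y : normedModType R} :
  bounded_bilinear (fun (B : blin X Y) (x : X) => B x).
Proof.
split=> [B c x y|x c B B'|B x]; last exact: blin_norm_le.
  by rewrite blinD blinZ.
by rewrite blin_addE blin_scaleE.
Qed.

Lemma blin_compA {R : realType} {X Y Z W : normedModType R} (C : blin Z W) (B : blin Y Z) (A : blin X Y) :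
  blin_comp C (blin_comp B A) = blin_comp (blin_comp C B) A.
Proof. exact: blin_ext. Qed.

Section MeanValue.
Context {R : realType} {X : normedModType R}.

(* Only right derivatives are assumed, which spares all the exceptional points of piecewise
   smooth functions. *)
Lemma rderiv_mean_value (F : R -> X) (G : R -> R) a b : a <= b ->
  continuous F -> continuous G ->
  (forall t, a <= t < b -> exists d e, [/\ rderiv F t d,
     rderiv (G : R -> R^o) t e & `|d| <= e]) ->
  `|F b - F a| <= G b - G a.
Proof.
move=> ab cF cG FG; apply/ler_addgt0Pr => e e0.
have [->|abne] := eqVneq a b; first by rewrite !subrr normr0 add0r ltW.
have ab0 : 0 < b - a by rewrite subr_gt0 lt_neqAle abne.
(* The relaxed slope [k] adds exactly [e] over the whole interval. At each point its two halves
   absorb the errors in the right derivatives of [F] and of [G]. *)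
pose k := e / (b - a); have k0 : 0 < k by rewrite divr_gt0.
suff H : forall c, a <= c <= b -> `|F c - F a| <= G c - G a + k * (c - a).
  have /H : a <= b <= b by rewrite ab lexx.
  by rewrite /k divfK// gt_eqF.
apply: real_induction => //.
- by rewrite !subrr normr0 mulr0 addr0.
- move=> c acb Pc; have [d [d' [Fd Gd' dd']]] := FG _ acb.
  have {}Pc : `|F c - F a| <= G c - G a + k * (c - a).
    by apply: Pc; move: acb => /andP[-> _]; rewrite lexx.
  have k20 : 0 < k / 2 by rewrite divr_gt0.
  near=> s.
  have sc : 0 < s - c by rewrite subr_gt0.
  have Fs : `|F s - F c - (s - c) *: d| <= k / 2 * (s - c) by near: s; exact: Fd.
  have : `|G s - G c - (s - c) * d'| <= k / 2 * (s - c) by near: s; exact: Gd'.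
  rewrite ler_norml => /andP[Gs _].
  have Fs1 : `|F s - F c| <= (s - c) * d' + k / 2 * (s - c).
    rewrite -[F s - F c](subrK ((s - c) *: d)) (le_trans (ler_normD _ _))//.
    by rewrite addrC lerD// normrZ gtr0_norm// ler_wpM2l// ltW.
  rewrite -(subrKA (F c)) (le_trans (ler_normD _ _))//.
  rewrite (le_trans (lerD Fs1 Pc))//; nra.
- move=> c /andP[ac cb] Pc; rewrite -subr_ge0.
  pose Q x := G x - G a + k * (x - a) - `|F x - F a|.
  have Qc : Q x @[x --> c^'-] --> Q c.
    apply: cvg_at_left_filter; apply: cvgB.
      apply: cvgD; first by apply: cvgB; [exact: cG|exact: cvg_cst].
      by apply: cvgMr; apply: cvgB; [exact: cvg_id|exact: cvg_cst].
    by apply: cvg_norm; apply: cvgB; [exact: cF|exact: cvg_cst].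
  apply: (cvgr_to_ge Qc); near=> x; rewrite /Q subr_ge0; apply: Pc.
  by apply/andP; split => //; near: x; exact: nbhs_left_ge.
Unshelve. all: by end_near. Qed.

Lemma rderiv_eq0_cst (F : R -> X) a b : a <= b -> continuous F ->
  (forall t, a <= t < b -> rderiv F t 0) -> F b = F a.
Proof.
move=> ab cF F0; apply/eqP; rewrite -subr_eq0 -normr_le0.
have := @rderiv_mean_value F (fun=> 0) a b ab cF (fun=> cvg_cst _).
rewrite subrr; apply => t atb; exists 0, 0; split; first exact: F0.
  exact: rderiv_cst.
by rewrite normr0.
Qed.

End MeanValue.

Section Clamp.
Context {R : realType}.
Implicit Types a b t : R.

(** Precomposition with this retraction extends a function on [[a, b]] to the line by its end
    values, so that continuity can be stated globally. *)
Definition clamp a b t := Num.max a (Num.min t b).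

Lemma clamp_itv a b t : a <= b -> a <= clamp a b t <= b.
Proof. by move=> ab; rewrite /clamp le_max lexx/= ge_max ab ge_min lexx orbT. Qed.

Lemma clamp_id a b t : a <= t <= b -> clamp a b t = t.
Proof. by move=> /andP[at_ tb]; rewrite /clamp min_l// max_r. Qed.

Lemma clamp_le a b t : t <= a -> a <= b -> clamp a b t = a.
Proof. by move=> ta ab; rewrite /clamp max_l// ge_min ta. Qed.

Lemma clamp_ge a b t : b <= t -> a <= b -> clamp a b t = b.
Proof. by move=> bt ab; rewrite /clamp min_r// max_r. Qed.

Lemma continuous_clamp a b : continuous (clamp a b).
Proof.
move=> t; apply: (@continuous_max R R (fun=> a) (fun t => Num.min t b) t).
  exact: cvg_cst.
by apply: (@continuous_min R R id (fun=> b) t); [exact: cvg_id|exact: cvg_cst].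
Qed.

End Clamp.

Section UniformLimits.
Context {R : realType} {X : completeNormedModType R}.

Lemma unif_cauchy_lim (S : Type) (A : set S) (u : nat -> S -> X) (r : nat -> R) :
  (forall n m t, (n <= m)%N -> A t -> `|u n t - u m t| <= r n) -> r @ \oo --> 0 ->
  exists v, forall n t, A t -> `|u n t - v t| <= r n.
Proof.
move=> ur r0; exists (fun t => lim (u n t @[n --> \oo])) => n t At.
have ut : cvg (u n t @[n --> \oo]).
  apply/cauchy_cvgP/cauchy_exP => e e0.
  have := cvgr0_norm_lt _ r0 _ e0; move=> [N _ /(_ N (leqnn N)) rN].
  exists (u N t); exists N => // m /= Nm; rewrite -ball_normE/=.
  by rewrite (le_lt_trans (ur _ _ _ Nm At))// (le_lt_trans _ rN)// ler_norm.
have : `|u n t - u m t| @[m --> \oo] --> `|u n t - lim (u n t @[n --> \oo])|.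
  by apply: cvg_norm; apply: cvgB; [exact: cvg_cst|exact: ut].
move=> /cvgr_to_le; apply; exists n => // m /= nm; exact: ur.
Qed.

Lemma unif_lim_continuous (T : topologicalType) (F : T -> X) :
  (forall e : R, 0 < e -> exists2 G : T -> X, continuous G & forall t, `|F t - G t| <= e) ->
  continuous F.
Proof.
move=> FG t; apply/cvgrPdist_le => e e0.
have e30 : 0 < e / 3 by rewrite divr_gt0.
have [G cG GF] := FG _ e30.
near=> s.
have Gs : `|G t - G s| <= e / 3 by near: s; apply: cvgr_dist_le => //; exact: cG.
have -> : F t - F s = (F t - G t) + (G t - G s) - (F s - G s).
  by rewrite subrKA opprB subrKA.
rewrite (le_trans (ler_normB _ _))//.
rewrite (le_trans (lerD (ler_normD _ _) (lexx _)))//.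
have := GF t; have := GF s; lra.
Unshelve. all: by end_near. Qed.

End UniformLimits.

Section RightDerivativeOfDerivable.
Context {R : realType} {X : normedModType R}.

Lemma derivable_rderiv (F : R -> X) t : derivable F t 1 -> rderiv F t (F^`() t).
Proof.
move=> dF e e0; have dF' := dF; rewrite derive1E.
have : h^-1 *: (F (h *: 1 + t) - F t) @[h --> 0^'] --> 'D_1 F t by exact: dF'.
move=> /cvgr_distC_le/(_ _ e0); rewrite near_withinE => -[r /= r0 rP].
apply/near_rightP; exists r => // s /andP[ts sr].
have st : 0 < s - t by rewrite subr_gt0.
have := rP (s - t); rewrite /= sub0r normrN gtr0_norm// ltrBlDl gt_eqF//.
move=> /(_ sr isT); rewrite [_ *: 1]mulr1 subrK => H.
have -> : F s - F t - (s - t) *: 'D_1 F t =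
    (s - t) *: ((s - t)^-1 *: (F s - F t) - 'D_1 F t).
  by rewrite scalerBr scalerA divff ?gt_eqF// scale1r.
by rewrite normrZ gtr0_norm// mulrC ler_wpM2r// ltW.
Qed.

End RightDerivativeOfDerivable.

Section RealRightDerivatives.
Context {R : realType}.
Implicit Types (F G : R -> R).

Lemma bounded_bilinear_mul : bounded_bilinear (fun x y : R^o => (x * y : R^o)).
Proof.
split => [x c u v|y c u v|x y]; last by rewrite normrM.
  by rewrite mulrDr scalerAr.
by rewrite mulrDl -scalerAl.
Qed.

Lemma rderivM F G t d d' : rderiv (F : R -> R^o) t d -> rderiv (G : R -> R^o) t d' ->
  rderiv (fun s => F s * G s : R^o) t (d * G t + F t * d').
Proof. exact: (@rderiv_bilin R R^o R^o R^o _ bounded_bilinear_mul F G). Qed.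

Lemma rderiv_mulr c t : rderiv (fun s => c * s : R^o) t c.
Proof.
move=> e e0; near=> s.
rewrite (_ : _ - _ = 0) ?normr0 ?mulr_ge0 ?ltW ?subr_gt0//.
by rewrite [_ *: _]mulrC; ring.
Unshelve. all: by end_near. Qed.

Lemma rderiv_expR c t : rderiv (fun s => expR (c * s) : R^o) t (c * expR (c * t)).
Proof.
have H : is_derive t 1 (fun s : R => expR (c * s)) (c * expR (c * t)).
  by apply: is_derive_eq; rewrite [c%:A]mulr1 mulrC.
have [dH <-] := H; rewrite -derive1E; exact: derivable_rderiv.
Qed.

Lemma continuous_expRM c : continuous (fun s : R => expR (c * s)).
Proof.
by move=> s; apply: continuous_comp; [exact: mulrl_continuous|exact: continuous_expR].
Qed.

End RealRightDerivatives.

Section Gronwall.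
Context {R : realType} {X : normedModType R}.

(** The primitive [B] stands for the integral of the forcing term [b]. A strict barrier above [z]
    cannot be crossed, and the barriers decrease to the claimed bound as [e] tends to 0. *)
Lemma gronwall (z : R -> X) (B : R -> R) K T : 0 <= K -> 0 <= T ->
  continuous z -> z 0 = 0 -> continuous B -> B 0 = 0 ->
  (forall t, 0 <= t < T -> exists d b, [/\ rderiv z t d,
     rderiv (B : R -> R^o) t b, 0 <= b & `|d| <= K * `|z t| + b]) ->
  forall t, 0 <= t <= T -> `|z t| <= expR (K * t) * B t.
Proof.
move=> K0 T0 cz z0 cB B0 zB t tT.
suff H e : 0 < e -> `|z t| < expR (K * t) * (B t + e * (1 + t)).
  apply/ler_addgt0Pr => e e0.
  have c0 : 0 < expR (K * t) * (1 + t).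
    by rewrite mulr_gt0 ?expR_gt0//; case/andP: tT => ? _; lra.
  rewrite (le_trans (ltW (H _ (divr_gt0 e0 c0))))// mulrDr mulrCA divfK//.
  by rewrite gt_eqF.
move=> e0; move: t tT.
(* The right derivative of [psi] is at least [K * psi + b]. As long as [z] lies below [psi], it
   therefore grows no faster than [psi], and the initial gap [psi 0 = e] keeps the inequality
   strict. *)
pose psi t := expR (K * t) * (B t + e * (1 + t)).
have cpsi : continuous psi.
  move=> t; apply: cvgM; first exact: continuous_expRM.
  apply: cvgD; first exact: cB.
  by apply: cvgMr; apply: cvgD; [exact: cvg_cst|exact: cvg_id].
rewrite -/(forall t, 0 <= t <= T -> `|z t| < psi t).
apply: real_induction => //.
- by rewrite z0 normr0 /psi mulr0 expR0 B0 mul1r add0r addr0 mulr1.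
- move=> c /andP[c0 _] /(_ c); rewrite c0 lexx => /(_ isT); rewrite -subr_gt0 => zc.
  have Qc : psi x - `|z x| @[x --> c^'+] --> psi c - `|z c|.
    apply: cvg_at_right_filter; apply: cvgB; first exact: cpsi.
    by apply: cvg_norm; exact: cz.
  by near=> x; rewrite -subr_gt0; near: x; exact: (cvgr_gt _ Qc).
- move=> c /andP[c0 cT] Pc.
  have psi0 : psi 0 = e by rewrite /psi mulr0 expR0 B0 mul1r add0r addr0 mulr1.
  have : `|z c - z 0| <= psi c - psi 0.
    apply: (rderiv_mean_value (ltW c0) cz cpsi) => t /andP[t0 tc].
    have [|d [b [zd Bb b0 db]]] := zB t; first by rewrite t0 (lt_le_trans tc).
    exists d, (K * expR (K * t) * (B t + e * (1 + t)) + expR (K * t) * (b + e)).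
    split => //.
      apply: rderivM; first exact: rderiv_expR.
      apply: rderivD => //.
      have := rderiv_line (e : R^o) (-1) t; apply: rderiv_eq; last near=> s;
        by rewrite opprK [_ *: _]mulrC [X in _ * X]addrC.
    have E1 : 1 <= expR (K * t) by rewrite (le_trans _ (expR_ge1Dx _))// lerDl mulr_ge0.
    rewrite (le_trans db)// -mulrA lerD//.
      by rewrite ler_wpM2l// ltW// -/(psi t) Pc// t0.
    have be : 0 <= b + e by lra.
    by apply: (@le_trans _ _ (b + e)); [lra|rewrite ler_peMl].
  rewrite z0 subr0 psi0; lra.
Unshelve. all: by end_near. Qed.

End Gronwall.

(** * Cadlag functions and differential equations *)

Section Cadlag.
Context {R : realType}.

(** Regularity is required at every real and carries no subdivision, which makes the class stable
    under the operations below. Finiteness of the set of jumps is recorded separately by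
    [finite_disc]. *)
Definition cadlag (Y : topologicalType) (phi : R -> Y) := forall t,
  phi @ t^'+ --> phi t /\ exists y : Y, phi @ t^'- --> y.

Lemma continuous_cadlag (Y : topologicalType) (phi : R -> Y) :
  continuous phi -> cadlag phi.
Proof.
move=> cphi t; split; first exact: cvg_at_right_filter (cphi t).
by exists (phi t); exact: cvg_at_left_filter (cphi t).
Qed.

Lemma cadlag_comp (Y Z W : topologicalType) (b : Y -> Z -> W) phi psi :
  continuous phi -> cadlag psi ->
  (forall t z, b p.1 p.2 @[p --> (phi t, z)] --> b (phi t) z) ->
  cadlag (fun t => b (phi t) (psi t)).
Proof.
move=> cphi cpsi cb t; have [r [z l]] := cpsi t; split.
  exact: continuous2_cvg (cb t _) (cvg_at_right_filter (cphi t)) r.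
by exists (b (phi t) z); exact: continuous2_cvg (cb t _) (cvg_at_left_filter (cphi t)) l.
Qed.

Lemma cadlagB (X : normedModType R) (phi psi : R -> X) :
  cadlag phi -> cadlag psi -> cadlag (fun t => phi t - psi t).
Proof.
move=> cphi cpsi t; have [r1 [y l1]] := cphi t; have [r2 [z l2]] := cpsi t.
by split; [exact: cvgB|exists (y - z); exact: cvgB].
Qed.

Lemma cadlag_bounded (X : normedModType R) (phi : R -> X) a b : cadlag phi -> a <= b ->
  exists M, forall t, a <= t <= b -> `|phi t| <= M.
Proof.
move=> cphi ab.
suff : forall c, a <= c <= b -> exists M, forall t, a <= t <= c -> `|phi t| <= M.
  by apply; rewrite ab lexx.
apply: real_induction => //.
- by exists `|phi a| => t /le_anti ->.
- move=> c /andP[ac cb] /(_ c); rewrite ac lexx => /(_ isT)[M MP].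
  have [/cvgr_norm_le/(_ (`|phi c| + 1))] := cphi c; rewrite ltrDl => /(_ ltr01).
  move=> /near_rightP[d d0 dP] _; apply/near_rightP; exists d => // x /andP[cx xd].
  exists (Num.max M (`|phi c| + 1)) => t /andP[at_ tx]; rewrite le_max.
  have [tc|ct] := leP t c; first by rewrite MP// at_.
  by rewrite dP ?orbT// ct (le_lt_trans tx).
- move=> c /andP[ac cb] Pc.
  have [_ [y /cvgr_norm_le/(_ (`|y| + 1))]] := cphi c; rewrite ltrDl => /(_ ltr01).
  move=> /near_leftP[d d0 dP].
  pose x := Num.max a (c - d / 2).
  have xc : x < c by rewrite /x gt_max ac/=; lra.
  have dx : c - d < x by rewrite /x lt_max; apply/orP; right; lra.
  have [|M MP] := Pc x; first by rewrite xc /x le_max lexx.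
  exists (Num.max M (Num.max (`|y| + 1) `|phi c|)) => t /andP[at_ tc]; rewrite !le_max.
  have [tx|xt] := leP t x; first by rewrite MP// at_.
  move: tc; rewrite le_eqVlt => /predU1P[->|tc]; first by rewrite lexx !orbT.
  by rewrite dP ?orbT// (lt_trans dx).
Qed.

End Cadlag.

Section Primitive.
Context {R : realType}.

(** The minimum freezes [F] after [c], while the second term is zero before [c] and has slope [v]
    afterwards. This is the extension step in the construction of polygonal primitives. *)
Lemma splice_linear (X : normedModType R) (F : R -> X) (v : X) c : continuous F ->
  let G s := F (Num.min s c) + (Num.max s c - c) *: v in
  [/\ continuous G, forall s, s <= c -> G s = F s,
      forall t d, t < c -> rderiv F t d -> rderiv G t d &
      forall t, c <= t -> rderiv G t v].
Proof.
move=> cF G; have GF s : s <= c -> G s = F s.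
  by move=> sc; rewrite /G min_l// max_r// subrr scale0r addr0.
split=> //.
- move=> s; apply: cvgD.
    apply: continuous_comp; last exact: cF.
    by apply: (@continuous_min R R id (fun=> c) s); [exact: cvg_id|exact: cvg_cst].
  apply: cvgZr_tmp; apply: cvgB; last exact: cvg_cst.
  by apply: (@continuous_max R R id (fun=> c) s); [exact: cvg_id|exact: cvg_cst].
- move=> t d tc; apply: rderiv_eq; first by rewrite GF// ltW.
  near=> s; rewrite GF//; near: s; exact: nbhs_right_le.
- move=> t ct e e0; near=> s.
  have ts : t < s by [].
  have cs : c <= s by rewrite (le_trans ct)// ltW.
  rewrite /G (min_r ct) (min_r cs) (max_l ct) (max_l cs).
  rewrite opprD addrACA subrr add0r -scalerBl -scalerBl.
  rewrite (_ : _ - _ = 0) ?scale0r ?normr0 ?mulr_ge0 ?ltW ?subr_gt0//; by ring.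
Unshelve. all: by end_near. Qed.

(** By real induction: beyond [c] the polygon is continued with slope [phi c], by right continuity;
    just before [c] it is continued with the left limit as slope. *)
Lemma cadlag_approx_primitive (X : normedModType R) (phi : R -> X) a b e :
  cadlag phi -> a <= b -> 0 < e -> exists F : R -> X, [/\ continuous F, F a = 0 &
    forall t, a <= t < b -> exists2 d, rderiv F t d & `|d - phi t| <= e].
Proof.
move=> cphi ab e0.
suff : forall c, a <= c <= b -> exists F : R -> X, [/\ continuous F, F a = 0 &
    forall t, a <= t < c -> exists2 d, rderiv F t d & `|d - phi t| <= e].
  by apply; rewrite ab lexx.
apply: real_induction => //.
- exists (fun=> 0); split=> //; first by move=> ?; exact: cvg_cst.
  by move=> t /andP[at_ ta]; have := le_lt_trans at_ ta; rewrite ltxx.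
- move=> c /andP[ac cb] /(_ c); rewrite ac lexx => /(_ isT)[F [cF Fa FP]].
  have [/cvgr_dist_le/(_ _ e0)/near_rightP[d d0 dP] _] := cphi c.
  have [cG GF Glt Gge] := splice_linear (phi c) c cF.
  apply/near_rightP; exists d => // x /andP[cx xd].
  exists (fun s => F (Num.min s c) + (Num.max s c - c) *: phi c).
  split=> //; first by rewrite GF.
  move=> t /andP[at_ tx]; have [tc|ct] := ltP t c.
    by have [|d' Fd' d'e] := FP t; [rewrite at_|exists d' => //; exact: Glt].
  exists (phi c); first exact: Gge.
  move: ct; rewrite le_eqVlt => /predU1P[->|ct]; first by rewrite subrr normr0 ltW.
  by apply: dP; rewrite ct (lt_trans tx).
- move=> c /andP[ac cb] Pc.
  have [_ [y /cvgr_dist_le/(_ _ e0)/near_leftP[d d0 dP]]] := cphi c.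
  pose x := Num.max a (c - d / 2).
  have xc : x < c by rewrite /x gt_max ac/=; lra.
  have ax : a <= x by rewrite /x le_max lexx.
  have dx : c - d < x by rewrite /x lt_max; apply/orP; right; lra.
  have [|F [cF Fa FP]] := Pc x; first by rewrite ax.
  have [cG GF Glt Gge] := splice_linear y x cF.
  exists (fun s => F (Num.min s x) + (Num.max s x - x) *: y).
  split=> //; first by rewrite GF.
  move=> t /andP[at_ tc]; have [tx|xt] := ltP t x.
    by have [|d' Fd' d'e] := FP t; [rewrite at_|exists d' => //; exact: Glt].
  exists y; first exact: Gge.
  by apply: dP; rewrite tc (lt_le_trans dx).
Qed.

Lemma rderiv_dist (X : normedModType R) (F G : R -> X) a b e t s :
  continuous F -> continuous G ->
  (forall r, a <= r < b -> exists d d', [/\ rderiv F r d, rderiv G r d' & `|d - d'| <= e]) ->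
  a <= t -> t <= s -> s <= b ->
  `|(F s - F t) - (G s - G t)| <= e * (s - t).
Proof.
move=> cF cG FG at_ ts sb.
have -> : F s - F t - (G s - G t) = (F s - G s) - (F t - G t).
  by rewrite !opprB addrACA [RHS]addrACA [- F t + _]addrC.
rewrite mulrBr.
apply: (@rderiv_mean_value R X (fun r => F r - G r) (fun r => e * r)) => //.
    by move=> r; apply: cvgB; [exact: cF|exact: cG].
  exact: mulrl_continuous.
move=> r /andP[tr rs]; have [|d [d' [Fd Gd' dd']]] := FG r.
  by rewrite (le_trans at_)//= (lt_le_trans rs).
exists (d - d'), e; split => //; last exact: rderiv_mulr.
exact: rderivB.
Qed.

(** The mean value inequality makes the approximate primitives of precision [1 / (n + 1)] uniformly
    Cauchy. Primitives obtained this way play the part of vector-valued integrals. *)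
Lemma cadlag_primitive (X : completeNormedModType R) (phi : R -> X) a b :
  cadlag phi -> a <= b -> exists F : R -> X, [/\ continuous F, F a = 0 &
    forall t, a <= t < b -> rderiv F t (phi t)].
Proof.
move=> cphi ab.
have e0 n : 0 < n.+1%:R^-1 :> R by rewrite invr_gt0.
have /choice[F FP] := fun n => cadlag_approx_primitive cphi ab (e0 n).
have Fdist n m t s : (n <= m)%N -> a <= t -> t <= s -> s <= b ->
    `|(F n s - F n t) - (F m s - F m t)| <= 2 * n.+1%:R^-1 * (s - t).
  move=> nm at_ ts sb; have [cFn _ Fn] := FP n; have [cFm _ Fm] := FP m.
  apply: (rderiv_dist cFn cFm _ at_ ts sb) => r arb.
  have [d Fd de] := Fn _ arb; have [d' Fd' de'] := Fm _ arb.
  exists d, d'; split => //.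
  rewrite -(subrKA (phi r)) (le_trans (ler_normD _ _))// mulr2n mulrDl mul1r.
  by rewrite lerD// distrC (le_trans de')// lef_pV2 ?posrE ?ltr0n// ler_nat ltnS.
have Fa n : F n a = 0 by have [] := FP n.
have harm0 : 2 * n.+1%:R^-1 * (b - a) @[n --> \oo] --> (0 : R).
  rewrite (_ : (fun n => _) = (fun n : nat => 2 * (b - a) * n.+1%:R^-1)).
    by rewrite -(mulr0 (2 * (b - a))); apply: cvgMr; exact: cvg_harmonic.
  by apply/funext => n; rewrite mulrAC.
have [||G0 G0P] := @unif_cauchy_lim R X R `[a, b] F (fun n => 2 * n.+1%:R^-1 * (b - a)).
- move=> n m t nm; rewrite /= in_itv/= => /andP[at_ tb].
  have := Fdist n m a t nm (lexx _) at_ tb; rewrite !Fa !subr0 => H.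
  by rewrite (le_trans H)// ler_wpM2l ?lerD2r// mulr_ge0// invr_ge0.
- exact: harm0.
pose G t := G0 (clamp a b t).
have GP n t : a <= t <= b -> `|F n t - G t| <= 2 * n.+1%:R^-1 * (b - a).
  by move=> atb; rewrite /G clamp_id// G0P//= in_itv.
have Gcl t : G t = G (clamp a b t) by rewrite /G (clamp_id (clamp_itv t ab)).
have harm e : 0 < e -> exists n, 2 * n.+1%:R^-1 * (b - a) <= e.
  by move=> e1; have /cvgr_le/(_ _ e1)[n _ /(_ n (leqnn n))] := harm0; exists n.
have cG : continuous G.
  apply: unif_lim_continuous => e /harm[n ne].
  exists (fun t => F n (clamp a b t)).
    move=> t; apply: continuous_comp; first exact: continuous_clamp.
    by have [cF _ _] := FP n; exact: cF.
  by move=> t; rewrite Gcl distrC (le_trans _ ne)// GP// clamp_itv.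
exists G; split => //.
  apply/eqP; rewrite -normr_le0; apply/ler_addgt0Pr => e /harm[n ne].
  by rewrite add0r (le_trans _ ne)// -normrN -[- G a]add0r -(Fa n) GP// lexx.
move=> t /andP[at_ tb] e e1.
have [/cvgr_dist_le/(_ (e / 2))] := cphi t; rewrite divr_gt0// => /(_ isT).
move=> /near_rightP[r r0 rP] _.
apply/near_rightP; exists (Num.min r (b - t)); first by rewrite lt_min r0 subr_gt0.
move=> s /andP[ts]; rewrite -ltrBlDl lt_min => /andP[str stb].
have sb : s <= b by lra.
(* For fixed [s], the approximant [N] is chosen so close to [G] that replacing [G] by it at [s] and
   at [t] costs at most [k]. The error [e] is shared between the precision of [F N] and the right
   continuity of [phi]. *)
apply/ler_addgt0Pr => k k0.
have k40 : 0 < k / 4 by rewrite divr_gt0.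
have [N NP] : exists n, 2 * n.+1%:R^-1 * (b - a) <= k / 4 /\ n.+1%:R^-1 <= e / 2.
  have e20 : 0 < e / 2 by rewrite divr_gt0.
  have [n nP] := harm _ k40.
  have /cvgr_le/(_ _ e20)[m _ mP] := @cvg_harmonic R.
  exists (maxn n m); split; last by apply: mP => /=; exact: leq_maxr.
  rewrite (le_trans _ nP)// ler_wpM2r ?subr_ge0// ler_wpM2l//.
  by rewrite lef_pV2 ?posrE ?ltr0n// ler_nat ltnS leq_maxl.
have [N1 N2] := NP; have [cFN _ FN] := FP N.
have clin : continuous (fun r : R => (r - t) *: phi t).
  by move=> z; apply: cvgZr_tmp; apply: cvgB; [exact: cvg_id|exact: cvg_cst].
have := @rderiv_dist X (F N) (fun r => (r - t) *: phi t) t s e t s cFN clin.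
rewrite lexx subrr scale0r subr0 => /(_ _ isT (ltW ts) (lexx _)) H.
have {}H : `|F N s - F N t - (s - t) *: phi t| <= e * (s - t).
  apply: H => x /andP[tx xs].
  have [|d Fd de] := FN x; first by rewrite (le_trans at_ tx) (lt_le_trans xs).
  exists d, (phi t); split => //; first exact: rderiv_line.
  rewrite -(subrKA (phi x)) (le_trans (ler_normD _ _))// (splitr e) lerD//.
    exact: le_trans N2.
  move: tx; rewrite le_eqVlt => /predU1P[->|tx]; first by rewrite subrr normr0 divr_ge0// ltW.
  rewrite distrC rP// tx; lra.
have Gs := GP N s; have Gt := GP N t.
have {}Gs : `|F N s - G s| <= k / 4 by rewrite (le_trans (Gs _))// (le_trans at_ (ltW ts)).
have {}Gt : `|F N t - G t| <= k / 4 by rewrite (le_trans (Gt _))// at_ ltW.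
have -> : G s - G t - (s - t) *: phi t =
   (F N s - F N t - (s - t) *: phi t) - (F N s - G s) + (F N t - G t).
  set v := _ *: _; rewrite opprB [X in _ = X + _]addrC -(addrA (F N s)) -opprD subrKA.
  by rewrite opprD (addrA (G s)) [RHS]addrAC subrKA.
rewrite (le_trans (ler_normD _ _))// (le_trans (lerD (ler_normB _ _) (lexx _)))//.
lra.
Qed.

End Primitive.

Section Picard.
Context {R : realType} {X : completeNormedModType R}.

(** Continuity in time is weakened to the cadlag condition along continuous curves, which is what a
    piecewise continuous control provides. *)
Lemma picard (G : R -> X -> X) K T x : 0 <= K -> 0 <= T ->
  (forall t y z, `|G t y - G t z| <= K * `|y - z|) ->
  (forall y, continuous y -> cadlag (fun t => G t (y t))) ->
  exists y, [/\ continuous y, y 0 = x & forall t, 0 <= t < T -> rderiv y t (G t (y t))].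
Proof.
move=> K0 T0 GK Gc.
have [P PP] : exists P : (R -> X) -> (R -> X), forall y, continuous y ->
    [/\ continuous (P y), P y 0 = x & forall t, 0 <= t < T -> rderiv (P y) t (G t (y t))].
  suff /choice[P PP] : forall y : R -> X, exists z, continuous y -> [/\ continuous z,
      z 0 = x & forall t, 0 <= t < T -> rderiv z t (G t (y t))] by exists P.
  move=> y; have [cy|ncy] := pselect (continuous y); last by exists y.
  have [F [cF F0 FP]] := cadlag_primitive (Gc y cy) T0.
  exists (fun t => x + F t) => _; split; last 1 first.
  - move=> t tT; rewrite -[G _ _]add0r; apply: rderivD; first exact: rderiv_cst.
    exact: FP.
  - by move=> t; apply: cvgD; [exact: cvg_cst|exact: cF].
  - by rewrite F0 addr0.
pose Y n := iter n P (fun=> x).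
have cY n : continuous (Y n).
  by elim: n => [|n IHn]; [move=> t; exact: cvg_cst|case: (PP _ IHn)].
have Y0 n : Y n 0 = x by case: n => // n; case: (PP _ (cY n)).
have [M MP] : exists M, forall t, 0 <= t <= T -> `|Y 1%N t - Y 0%N t| <= M.
  apply: cadlag_bounded => //; apply: continuous_cadlag => t; apply: cvgB; exact: cY.
have M0 : 0 <= M by apply: le_trans (MP 0 _) => //; rewrite lexx.
(* The weight [expR (2 * K * t)] turns the integral operator into a contraction of ratio one half on
   all of [[0, T]], so the interval need not be cut into short pieces. *)
have YS n t : 0 <= t <= T ->
    `|Y n.+1 t - Y n t| <= M * 2^-1 ^+ n * expR (2 * K * t).
  elim: n t => [|n IHn] t /andP[t0 tT].
    rewrite expr0 mulr1 (le_trans (MP _ _)) ?t0//= ler_peMr//.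
    by rewrite (le_trans _ (expR_ge1Dx _))// lerDl !mulr_ge0.
  pose c := M * 2^-1 ^+ n.+1.
  have c0 : 0 <= c by rewrite mulr_ge0// exprn_ge0// invr_ge0.
  have := @rderiv_mean_value R X (fun t => Y n.+2 t - Y n.+1 t)
    (fun t => c * expR (2 * K * t)) 0 t t0.
  rewrite !Y0 subrr subr0 => H; apply: le_trans (H _ _ _) _.
  - by move=> s; apply: cvgB; exact: cY.
  - by move=> s; apply: cvgMr; exact: continuous_expRM.
  - move=> s /andP[s0 st]; have sT : s < T by rewrite (lt_le_trans st).
    have [_ _ P2] := PP _ (cY n.+1); have [_ _ P1] := PP _ (cY n).
    exists (G s (Y n.+1 s) - G s (Y n s)), (c * (2 * K * expR (2 * K * s))); split.
    + by apply: rderivB; [apply: P2|apply: P1]; rewrite s0.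
    + have := rderivM (@rderiv_cst R R^o c s) (@rderiv_expR R (2 * K) s).
      by rewrite mul0r add0r.
    + rewrite (le_trans (GK _ _ _))// (le_trans (ler_wpM2l K0 (IHn s _)))//.
        by rewrite s0 (ltW sT).
      rewrite /c exprS; set w := expR _; set v := 2^-1 ^+ n.
      by rewrite le_eqVlt; apply/orP; left; apply/eqP; field.
  - by rewrite gerBl mulr_ge0// expR_ge0.
pose C := M * expR (2 * K * T).
have C0 : 0 <= C by rewrite mulr_ge0// expR_ge0.
have YC n t : 0 <= t <= T -> `|Y n t - Y n.+1 t| <= C * 2^-1 ^+ n.
  move=> tT; rewrite distrC (le_trans (YS _ _ tT))// /C mulrAC ler_wpM2r ?exprn_ge0 ?invr_ge0//.
  by rewrite ler_wpM2l// ler_expR ler_wpM2l ?mulr_ge0//; case/andP: tT.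
have Ycauchy n m t : (n <= m)%N -> 0 <= t <= T -> `|Y n t - Y m t| <= 2 * C * 2^-1 ^+ n.
  move=> nm tT.
  suff H k : `|Y n t - Y (n + k)%N t| <= 2 * C * (2^-1 ^+ n - 2^-1 ^+ (n + k)).
    have := H (m - n)%N; rewrite subnKC// => {}H; rewrite (le_trans H)//.
    by rewrite ler_wpM2l ?mulr_ge0// gerBl exprn_ge0// invr_ge0.
  elim: k => [|k IHk]; first by rewrite addn0 !subrr normr0 mulr0.
  rewrite addnS -(subrKA (Y (n + k)%N t)) (le_trans (ler_normD _ _))//.
  rewrite (le_trans (lerD IHk (YC _ _ tT)))// exprS.
  by rewrite le_eqVlt; apply/orP; left; apply/eqP; field.
have r0 : 2 * C * 2^-1 ^+ n @[n --> \oo] --> (0 : R).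
  rewrite -(mulr0 (2 * C)); apply: cvgMr; apply: cvg_expr.
  by rewrite gtr0_norm; lra.
have [||y0 y0P] := @unif_cauchy_lim R X R [set t | 0 <= t <= T] Y (fun n => 2 * C * 2^-1 ^+ n).
- by move=> n m t nm tT; exact: Ycauchy.
- exact: r0.
pose y t := y0 (clamp 0 T t).
have yP n t : 0 <= t <= T -> `|Y n t - y t| <= 2 * C * 2^-1 ^+ n.
  by move=> tT; rewrite /y clamp_id// y0P.
have cy : continuous y.
  apply: unif_lim_continuous => e e0.
  have /cvgr_le/(_ _ e0)[n _ /(_ n (leqnn n)) ne] := r0.
  exists (fun t => Y n (clamp 0 T t)).
    by move=> t; apply: continuous_comp; [exact: continuous_clamp|exact: cY].
  move=> t; rewrite distrC (le_trans _ ne)// (_ : y t = y (clamp 0 T t)).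
    by rewrite yP// clamp_itv.
  by rewrite /y (clamp_id (clamp_itv t T0)).
have [cz z0 zP] := PP _ cy.
have zy t : 0 <= t <= T -> P y t = y t.
  move=> /andP[t0 tT]; apply/eqP; rewrite -subr_eq0 -normr_le0.
  suff : 2 * C * (K * T + 1) * 2^-1 ^+ n @[n --> \oo] --> (0 : R).
    move=> /cvgr_to_ge; apply; near=> n.
    rewrite -(subrKA (Y n.+1 t)) (le_trans (ler_normD _ _))//.
    have H1 : `|P y t - Y n.+1 t| <= K * (2 * C * 2^-1 ^+ n) * T.
      have [c1 _ d1] := PP _ (cY n).
      have := @rderiv_dist R X (P y) (Y n.+1) 0 T (K * (2 * C * 2^-1 ^+ n)) 0 t cz c1.
      rewrite lexx z0 Y0 opprB addrA addrNK subr0 => H.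
      apply: le_trans (H _ isT t0 tT) _.
        move=> r /andP[r0' rT]; exists (G r (y r)), (G r (Y n r)); split.
        - by apply: zP; rewrite r0'.
        - by apply: d1; rewrite r0'.
        - by rewrite (le_trans (GK _ _ _))// ler_wpM2l// distrC yP// r0' ltW.
      by rewrite ler_wpM2l// !mulr_ge0// exprn_ge0// invr_ge0.
    have H2 : `|Y n.+1 t - y t| <= 2 * C * 2^-1 ^+ n.
      rewrite (le_trans (yP _ _ _)) ?t0// ler_wpM2l ?mulr_ge0// exprS.
      by rewrite ler_piMl ?exprn_ge0 ?invr_ge0//; lra.
    by rewrite (le_trans (lerD H1 H2))// le_eqVlt; apply/orP; left; apply/eqP; ring.
  rewrite -(mulr0 (2 * C * (K * T + 1))); apply: cvgMr; apply: cvg_expr.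
  by rewrite gtr0_norm; lra.
(* The solution returned is [P y], whose right derivatives are known by construction; on [[0, T]] it
   coincides with the limit [y]. *)
exists (P y); split => // t /andP[t0 tT].
by rewrite zy ?t0 ?ltW//; apply: zP; rewrite t0.
Unshelve. all: by end_near. Qed.

End Picard.

Section BlinComplete.
Context {R : realType} {X : normedModType R} {Y : completeNormedModType R}.

(** Completeness of the operator space lets the Picard iteration run in it, which produces the
    resolvents. *)
Lemma blin_complete (F : set_system (blin X Y)) : ProperFilter F -> cauchy F -> cvg F.
Proof.
move=> FF /cauchy_ballP cF.
have cF' e : 0 < e -> \forall A & B \near F, `|A - B| <= e.
  by move=> e0; have := cF _ e0; apply: filterS => -[A B]; rewrite /= -ball_normE/=; exact: ltW.
have Fx x : cvg ((fun A : blin X Y => A x) @ F).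
  apply/cauchy_cvgP/cauchy_ballP => e e0.
  have x0 : 0 < `|x| + 1 by rewrite ltr_wpDl.
  have e1 : 0 < e / 2 / (`|x| + 1) by rewrite !divr_gt0.
  have [[P Q] /= [FP FQ] PQ] := cF' _ e1.
  exists ((fun A : blin X Y => A x) @` P, (fun A : blin X Y => A x) @` Q).
    by split; [apply: filterS FP|apply: filterS FQ] => A PA; exists A.
  move=> [_ _] /= [[A PA <-] [B QB <-]]; rewrite -ball_normE/=.
  have /= AB := PQ (A, B) (conj PA QB).
  have : `|A x - B x| <= e / 2 / (`|x| + 1) * `|x|.
    by rewrite (le_trans (blin_norm_le (A - B) x))// ler_wpM2r.
  move=> /le_lt_trans; apply; rewrite mulrAC ltr_pdivrMr//.
  have := normr_ge0 x; nra.
pose L x : Y := lim ((fun A : blin X Y => A x) @ F).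
have FL x : (fun A : blin X Y => A x) @ F --> L x by exact: Fx.
have AL e : 0 < e -> F [set A : blin X Y | forall x, `|A x - L x| <= e * `|x|].
  move=> e0; have [[P Q] /= [FP FQ] PQ] := cF' _ e0.
  apply: filterS FP => A PA /= x.
  have : `|A x - B x| @[B --> F] --> `|A x - L x|.
    by apply: cvg_norm; apply: cvgB; [exact: cvg_cst|exact: FL].
  move=> /cvgr_to_le; apply; apply: filterS FQ => B QB.
  have /= AB := PQ (A, B) (conj PA QB).
  by rewrite (le_trans (blin_norm_le (A - B) x))// ler_wpM2r.
have lL : linear L.
  move=> c x y; apply/esym; apply: (cvg_unique _ _ (FL (c *: x + y))) => //.
  rewrite (_ : (fun A : blin X Y => A (c *: x + y)) = (fun A : blin X Y => c *: A x + A y)).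
    by apply: cvgD; [apply: cvgZl_tmp|]; exact: FL.
  by apply/funext => A; rewrite blinD blinZ.
have [A0 A0L] := filter_ex (AL 1 ltr01).
have bL x : `|L x| <= (`|A0| + 1) * `|x|.
  rewrite -[L x](subrK (A0 x)) (le_trans (ler_normD _ _))// addrC mulrDl lerD//.
    exact: blin_norm_le.
  by rewrite distrC.
apply/cvg_ex; exists (mk_blin lL bL); apply/cvgrPdistC_le => e e0.
have := AL e e0; apply: filterS => A H.
by apply: blin_le_norm; [exact: ltW|exact: H].
Qed.

HB.instance Definition _ := Uniform_isComplete.Build (blin X Y) blin_complete.

End BlinComplete.

(** * A cubical Sperner lemma and the Poincare-Miranda theorem *)

Section CubicalCochains.
Variable n : nat.
Local Notation pt := {ffun 'I_n -> nat}.
Local Notation F2 := 'F_2.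
Implicit Types (S : {set 'I_n}) (x y : pt) (i j : 'I_n) (phi : {set 'I_n} -> pt -> F2).

Lemma F2_addxx (c : F2) : c + c = 0.
Proof. by apply/val_inj; case: c => -[|[|m]]. Qed.

Lemma F2_addxK (c d : F2) : c + (c + d) = d.
Proof. by rewrite addrA F2_addxx add0r. Qed.

(** Each unordered pair is counted twice, hence cancels modulo 2. *)
Lemma sum_sym_F2 S (g : 'I_n -> 'I_n -> F2) : (forall i j, g i j = g j i) ->
  \sum_(i in S) \sum_(j in S :\ i) g i j = 0.
Proof.
move=> gC; rewrite pair_big_dep/= (bigID (fun p : 'I_n * 'I_n => (p.1 < p.2)%N))/=.
rewrite [X in _ + X](reindex_onto (fun p : 'I_n * 'I_n => (p.2, p.1))
  (fun p => (p.2, p.1)))/=; last by case.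
set s1 := (X in X + _); set s2 := (X in _ + X); suff -> : s2 = s1 by exact: F2_addxx.
rewrite {}/s1 {}/s2; apply: eq_big => [[i j]|[i j] _ /=]; last exact: gC.
rewrite /= eqxx andbT !inE -leqNgt ltn_neqAle (eq_sym j i).
rewrite -[((i : nat) != j)]/(i != j).
by case: (i \in S); case: (j \in S); case: (i != j); case: (i <= j)%N.
Qed.

Definition shift x i : pt := [ffun j => (x j + (j == i))%N].

Lemma shiftC x i j : shift (shift x i) j = shift (shift x j) i.
Proof. by apply/ffunP => k; rewrite !ffunE addnAC. Qed.

(** The cubical coboundary modulo 2: [S] is the set of directions of a face and [x] its lowest
    vertex, and the sum runs over the two opposite facets in each direction of [S]. *)
Definition cobound phi S x : F2 :=
  \sum_(i in S) (phi (S :\ i) (shift x i) + phi (S :\ i) x).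

Lemma cobound_cobound phi S x : cobound (cobound phi) S x = 0.
Proof.
rewrite /cobound; under eq_bigr do rewrite -big_split/=.
apply: sum_sym_F2 => i j; rewrite shiftC.
have -> : S :\ i :\ j = S :\ j :\ i by rewrite !finset.setDDl finset.setUC.
by rewrite addrACA.
Qed.

Variable a : nat -> pt -> F2.

(* [cup m k] is the cup product of the coboundaries of the [m] labels [a k], ..., [a (k + m - 1)]. *)
Fixpoint cup (m k : nat) S x : F2 :=
  if m is m'.+1 then cobound (fun S x => a k x * cup m' k.+1 S x) S x
  else (S == finset.set0)%:R.

Lemma cobound_cup m k S x : cobound (cup m k) S x = 0.
Proof.
case: m => [|m]; last exact: cobound_cobound.
by rewrite /cobound big1// => i _ /=; rewrite F2_addxx.
Qed.

(** The Leibniz rule: since the remaining cup product is closed, only the terms in the coboundary of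
    [a k] survive. The value is read along an edge leaving [x], followed by the face that starts at
    its far end. *)
Lemma cupS m k S x : cup m.+1 k S x =
  \sum_(i in S) (a k (shift x i) + a k x) * cup m k.+1 (S :\ i) (shift x i).
Proof.
have := mulr0 (a k x); rewrite -{1}(cobound_cup m k.+1 S x) => H.
rewrite -[RHS]addr0 -[X in _ = _ + X]H /= /cobound mulr_sumr -big_split/=; apply: eq_bigr => i _.
by rewrite mulrDl mulrDr -addrA F2_addxK.
Qed.

(** A nonzero term of the expansion provides an edge along which the first label changes, and a
    nonzero cup product of the other labels on a smaller face of the same cell. *)
Lemma cup_neq0 m k S x : cup m k S x != 0 -> forall j : nat, (j < m)%N ->
  exists y z : pt, [/\ a (k + j)%N y != a (k + j)%N z,
    forall i, (x i <= y i <= x i + (i \in S))%N &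
    forall i, (x i <= z i <= x i + (i \in S))%N].
Proof.
elim: m k S x => [//|m IHm] k S x; rewrite cupS => nz j jm.
have [i iS inz] : exists2 i, i \in S &
    (a k (shift x i) + a k x) * cup m k.+1 (S :\ i) (shift x i) != 0.
  apply: contrapT => H; move/eqP: nz; apply; apply: big1 => i iS.
  by apply: contrapT => /eqP nzi; apply: H; exists i.
have {}inz : a k (shift x i) != a k x /\ cup m k.+1 (S :\ i) (shift x i) != 0.
  split; apply: contra inz => /eqP ->; last by rewrite mulr0.
  by rewrite F2_addxx mul0r.
have [axi cnz] := inz.
have sx t : (x t <= shift x i t <= x t + (t \in S))%N.
  rewrite ffunE leq_addr/= leq_add2l; have [->|//] := eqVneq t i; by rewrite iS.
case: j jm => [_|j jm].
  rewrite addn0; exists (shift x i), x; split => // t.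
  by rewrite leqnn leq_addr.
have [y [z [yz yP zP]]] := IHm _ _ _ cnz j jm.
have E w : (forall t, (shift x i t <= w t <= shift x i t + (t \in S :\ i))%N) ->
    forall t, (x t <= w t <= x t + (t \in S))%N.
  move=> wP t; have /andP[w1 w2] := wP t; have /andP[s1 s2] := sx t.
  rewrite (leq_trans s1 w1)/= (leq_trans w2)// ffunE !inE.
  by have [->|_] := eqVneq t i; rewrite ?iS ?addn0 ?addn1.
by exists y, z; rewrite addnS -addSn; split => //; exact: E.
Qed.

Variable p : nat.
Hypothesis p_gt0 : (0 < p)%N.
Hypothesis a0 : forall i x, x i = 0%N -> a i x = 0.
Hypothesis ap : forall i x, x i = p -> a i x = 1.

(** No move inside the face alters coordinate [i], so label [i] is constant on it by [a0] or [ap],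
    and the factor of the cup product coming from that label vanishes. *)
Lemma cup_face m k S x i : (k <= i < k + m)%N -> i \notin S -> (x i = 0%N \/ x i = p) ->
  cup m k S x = 0.
Proof.
elim: m k S x => [k S x|m IHm k S x]; first by rewrite addn0 => /andP[/leq_ltn_trans h /h]; rewrite ltnn.
move=> /andP[ki ikm] iS xi; rewrite cupS big1// => j jS.
have ij : i != j by apply: contraNneq iS => ->.
have sxi : shift x j i = x i by rewrite ffunE (negbTE ij) addn0.
move: ki; rewrite leq_eqVlt => /predU1P[->|ki].
  suff -> : a i (shift x j) = a i x by rewrite F2_addxx mul0r.
  by case: xi => xi; [rewrite !a0// sxi|rewrite !ap// sxi].
rewrite IHm ?mulr0 ?sxi//; first by rewrite ki addSnnS.
by rewrite !inE (negbTE iS) andbF.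
Qed.

Local Notation gpt := {ffun 'I_n -> 'I_p.+1}.
Definition grid_val (x : gpt) : pt := [ffun i => x i : nat].

(** Telescoping modulo 2 in direction [i]: each interior layer appears once as a top and once as a
    bottom, and only the two extreme layers remain. *)
Lemma sum_grid_shift (C : pred gpt) i (g : pt -> F2) :
  (forall x y : gpt, (forall j, j != i -> x j = y j) -> C x = C y) ->
  \sum_(x | C x && (x i < p)%N) (g (shift (grid_val x) i) + g (grid_val x)) =
  \sum_(x | C x && (x i == p :> nat)) g (grid_val x) +
  \sum_(x | C x && (x i == 0%N :> nat)) g (grid_val x).
Proof.
move=> Ci; rewrite big_split/=.
pose up (x : gpt) : gpt := [ffun j => if j == i then inord (x j).+1 else x j].
pose down (x : gpt) : gpt := [ffun j => if j == i then inord (x j).-1 else x j].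
have -> : \sum_(x | C x && (x i < p)%N) g (shift (grid_val x) i) =
    \sum_(x | C x && (0 < x i)%N) g (grid_val x).
  rewrite [RHS](reindex_onto up down)/=.
    apply: eq_big => [x|x /andP[_ xp]].
      rewrite (Ci (up x) x); last by move=> j ji; rewrite ffunE (negbTE ji).
      rewrite -andbA; congr (_ && _); rewrite ffunE eqxx.
      have := ltn_ord (x i); rewrite ltnS leq_eqVlt => /predU1P[xp|xp].
        rewrite xp ltnn; apply/esym/negbTE; rewrite negb_and -implybE.
        apply/implyP => _; apply/eqP => /ffunP/(_ i).
        rewrite !ffunE !eqxx => /(congr1 val)/=; rewrite xp => H.
        (* Out of range, [inord] takes its default value [ord0]: a point at height [p] is sent by
           [up] to height 0, and [down] cannot bring it back. *)
        have : (inord p.+1 : 'I_p.+1) = ord0.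
          by apply/val_inj; rewrite /inord /insubd insubN//= ?ltnn//.
        move=> E; move: H; rewrite E/= inordK// => p0; move: p_gt0; by rewrite -p0.
      rewrite xp inordK ?ltnS//=; apply/esym/eqP/ffunP => j; rewrite !ffunE.
      have [->|//] := eqVneq j i; rewrite inordK ?ltnS//= ; apply/val_inj => /=.
      by rewrite inordK// ltnS ltnW.
    congr g; apply/ffunP => j; rewrite !ffunE; have [->|_] := eqVneq j i.
      by rewrite inordK ?ltnS// addn1.
    by rewrite addn0.
  move=> x /andP[_ x0]; apply/ffunP => j; rewrite !ffunE.
  have [->|//] := eqVneq j i; apply/val_inj => /=.
  have xp : ((x i).-1 < p.+1)%N by rewrite (leq_ltn_trans (leq_pred _)).
  by rewrite (inordK xp) prednK// inordK.
rewrite (bigID (fun x : gpt => x i == p :> nat))/=.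
rewrite [X in _ + X](bigID (fun x : gpt => x i == 0%N :> nat))/=.
rewrite addrACA [X in _ + X = _](_ : _ = 0) ?addr0.
  congr (_ + _); apply: eq_bigl => x; rewrite -andbA; congr (_ && _).
    by have [->|] := eqVneq (x i : nat) p; rewrite ?p_gt0 ?andbF.
  by have [->|] := eqVneq (x i : nat) 0%N; rewrite ?p_gt0 ?andbF.
rewrite [X in _ + X](eq_bigl (fun x : gpt => C x && (0 < x i)%N && (x i != p :> nat))) ?F2_addxx//.
move=> x; rewrite -!andbA; congr (_ && _); rewrite lt0n andbC; congr (_ && _).
by rewrite ltn_neqAle; have := ltn_ord (x i); rewrite ltnS => ->; rewrite andbT.
Qed.

(** These are the lowest vertices of the cells of the face where the first [k] coordinates equal
    [p]; hence the strict bound on the others. *)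
Definition corner k (x : gpt) :=
  [forall i : 'I_n, if (i < k)%N then x i == p :> nat else (x i < p)%N].

(** Discrete Stokes formula on that face. In direction [k] the bottom vanishes because [a k] is 0
    there, and the top contributes with [a k = 1]; in any other direction [i] both sides vanish by
    [cup_face] applied to label [i]. *)
Lemma corner_sum k : (k < n)%N ->
  \sum_(x | corner k x) cup (n - k) k [set i : 'I_n | (k <= i)%N]%SET (grid_val x) =
  \sum_(x | corner k.+1 x) cup (n - k.+1) k.+1 [set i : 'I_n | (k < i)%N]%SET (grid_val x).
Proof.
move=> kn; rewrite -(subnSK kn) /=.
under eq_bigr do rewrite /cobound.
rewrite exchange_big/=.
set Sk := [set i : 'I_n | (k <= i)%N]%SET.
pose C i (x : gpt) := [forall j : 'I_n, (j != i) ==>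
  (if (j < k)%N then x j == p :> nat else (x j < p)%N)].
have CC i (x : gpt) : i \in Sk -> corner k x = C i x && (x i < p)%N.
  rewrite inE => ki; apply/forallP/andP => [H|[/forallP H xi] j].
    split; first by apply/forallP => j; apply/implyP => _; exact: H.
    by have := H i; rewrite ltnNge ki.
  by have := H j; have [->|_ /implyP] := eqVneq j i; [rewrite ltnNge ki|apply].
have Cind i (x y : gpt) : (forall j, j != i -> x j = y j) -> C i x = C i y.
  move=> xy; apply: eq_forallb => j; have [//|ji] := eqVneq j i; by rewrite xy.
pose ik := Ordinal kn.
have ikS : ik \in Sk by rewrite inE.
under eq_bigr => i iS.
  under eq_bigl do rewrite (CC i)//.
  rewrite (@sum_grid_shift _ i (fun y => a k y * cup (n - k.+1) k.+1 (Sk :\ i) y) (Cind i)).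
  over.
rewrite (bigD1 ik)//= [X in _ + X]big1 ?addr0 => [|i /andP[iS ik']].
  rewrite [X in _ + X]big1 ?addr0 => [|x /andP[_ /eqP x0]]; last first.
    by rewrite (a0 (i := ik)) ?mul0r// ffunE.
  apply: eq_big => [x|x /andP[_ /eqP xp]].
    apply/andP/forallP => [[/forallP H xk] j|H].
      have [->|jk] := eqVneq j ik; first by rewrite /= ltnSn.
      have := H j; rewrite jk/= ltnS [(j <= k)%N]leq_eqVlt.
      by rewrite -[(j == k :> nat)]/(j == ik) (negbTE jk).
    split; last by have := H ik; rewrite /= ltnSn.
    apply/forallP => j; apply/implyP => jk; have := H j.
    by rewrite ltnS [(j <= k)%N]leq_eqVlt -[(j == k :> nat)]/(j == ik) (negbTE jk).
  rewrite (ap (i := ik)) ?mul1r ?ffunE//; congr cup.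
  by apply/setP => j; rewrite !inE ltn_neqAle eq_sym.
have ki : (k < i)%N.
  rewrite ltn_neqAle; move: iS; rewrite inE => ->; rewrite andbT eq_sym.
  by apply: contra ik' => /eqP ik'; apply/eqP/val_inj.
have H (x : gpt) : (grid_val x i = 0%N \/ grid_val x i = p) ->
    a k (grid_val x) * cup (n - k.+1) k.+1 (Sk :\ i) (grid_val x) = 0.
  move=> xi; rewrite (@cup_face _ _ _ _ i) ?mulr0//.
    by rewrite ki/= subnKC.
  by rewrite !inE eqxx.
rewrite !big1 ?addr0// => x /andP[_ /eqP xi]; apply: H; rewrite ffunE xi; by [left|right].
Qed.

(** Repeated use of Stokes reduces the total cup product of all labels to the single vertex with all
    coordinates [p], where it is 1. Some cell thus has a nonzero cup product, so every label changes
    on it. *)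
Lemma cubical_sperner : exists2 x : pt, (forall i, (x i < p)%N) &
  forall j, exists y z : pt, [/\ a j y != a j z,
    forall i, (x i <= y i <= (x i).+1)%N & forall i, (x i <= z i <= (x i).+1)%N].
Proof.
have T k : (k <= n)%N -> \sum_(x | corner 0 x) cup n 0 [set: 'I_n]%SET (grid_val x) =
    \sum_(x | corner k x) cup (n - k) k [set i : 'I_n | (k <= i)%N]%SET (grid_val x).
  elim: k => [_|k IHk kn].
    by rewrite subn0; apply: eq_bigr => x _; congr cup; apply/setP => i; rewrite !inE.
  by rewrite IHk 1?ltnW// corner_sum.
have T1 : \sum_(x | corner 0 x) cup n 0 [set: 'I_n]%SET (grid_val x) = 1.
  rewrite (T n)// subnn (big_pred1 [ffun=> ord_max])/=.
    rewrite (_ : [set i : 'I_n | (n <= i)%N]%SET = finset.set0) ?eqxx//.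
    by apply/setP => i; rewrite !inE leqNgt ltn_ord.
  move=> x; apply/forallP/eqP => [H|-> i]; last by rewrite ltn_ord ffunE.
  by apply/ffunP => i; apply/val_inj; have := H i; rewrite ltn_ord ffunE => /eqP.
have [x cx nz] : exists2 x, corner 0 x & cup n 0 [set: 'I_n]%SET (grid_val x) != 0.
  apply: contrapT => H; move/eqP: T1; rewrite big1 ?(eq_sym 0) ?oner_eq0// => x cx.
  by apply: contrapT => /eqP xnz; apply: H; exists x.
exists (grid_val x) => [i|j]; first by have /forallP/(_ i) := cx; rewrite ffunE.
have [y [z [yz yP zP]]] := cup_neq0 nz (ltn_ord j).
by exists y, z; split => // i; [have := yP i|have := zP i]; rewrite inE addn1.
Qed.

End CubicalCochains.

Section PoincareMiranda.
Context {R : realType}.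
Variable n : nat.

Definition cube := [set z : 'rV[R]_n | forall i, -1 <= z 0 i <= 1].

Lemma compact_cube : compact cube.
Proof.
rewrite (_ : cube = [set z : 'rV[R]_n | forall i, `[(-1 : R), 1]%classic (z 0 i)]).
  by apply: (@rV_compact R n (fun=> `[-1, 1]%classic)) => i; exact: segment_compact.
by apply/seteqP; split => z zP i; have := zP i; rewrite /= in_itv.
Qed.

(** Without a zero, some [F j] keeps its sign in a box around each point of the cube, at a scale
    uniform by compactness. Labelling a finer grid by the signs of the [F j] contradicts the cell on
    which every label changes. *)
Lemma poincare_miranda (F : 'I_n -> 'rV[R]_n -> R) :
  (forall j, {within cube, continuous (F j)}) ->
  (forall j z, cube z -> z 0 j = 1 -> 0 < F j z) ->
  (forall j z, cube z -> z 0 j = -1 -> F j z < 0) ->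
  exists2 z, cube z & forall j, F j z = 0.
Proof.
move=> cF F1 FN1; apply: contrapT => H.
pose P (d : R) (z : 'rV[R]_n) := exists j,
  (forall w, cube w -> (forall i, `|z 0 i - w 0 i| < d) -> 0 < F j w) \/
  (forall w, cube w -> (forall i, `|z 0 i - w 0 i| < d) -> F j w <= 0).
have Pz z : cube z -> \forall z' \near z & d \near 0^'+, P d z'.
  move=> cz; have [j Fj] : exists j, F j z != 0.
    apply: contrapT => Hj; apply: H; exists z => // j.
    by apply: contrapT => /eqP Fj; apply: Hj; exists j.
  have := cF j; move=> /subspace_continuousP/(_ _ cz)/cvgr_dist_lt.
  have F0 : 0 < `|F j z| by rewrite normr_gt0.
  move=> /(_ _ F0); rewrite near_withinE => /nbhs_ballP[e /= e0 eP].
  exists (ball z (e / 2), [set d : R | d < e / 2]).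
    split => /=; first by apply: nbhsx_ballx; rewrite divr_gt0.
    by apply: nbhs_right_lt; rewrite divr_gt0.
  move=> [z' d] /= [zz' de]; exists j.
  have Q w : cube w -> (forall i, `|z' 0 i - w 0 i| < d) -> `|F j z - F j w| < `|F j z|.
    move=> cw z'w; apply: eP => //; split => // k i; rewrite (ord1 k).
    have [_ /(_ 0 i)] := zz'; rewrite /= -!ball_normE/= => h1; have h2 := z'w i.
    rewrite -(subrKA (z' 0 i)) (le_lt_trans (ler_normD _ _))//; lra.
  have [Fpos|Fneg] := leP 0 (F j z).
    left=> w cw /(Q w cw); rewrite (ger0_norm Fpos) ltr_norml => /andP[_]; lra.
  right=> w cw /(Q w cw); rewrite (ltr0_norm Fneg) ltr_norml => /andP[]; lra.
have /compact_near_coveringP/(_ _ (0 : R)^'+ P _ Pz) := compact_cube.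
move=> /near_rightP[d d0 dP].
have [p p0 pd] : exists2 p : nat, (0 < p)%N & 2 / p%:R < d / 2.
  exists (Num.trunc (4 / d)).+1 => //.
  have := truncnS_gt (4 / d); rewrite ltr_pdivrMr// => h.
  by rewrite ltr_pdivrMr ?ltr0n// mulrAC -ltr_pdivrMr//; lra.
have pR : 0 < p%:R :> R by rewrite ltr0n.
pose zz (x : {ffun 'I_n -> nat}) : 'rV[R]_n := \row_i (-1 + 2 * (x i)%:R / p%:R).
have zc (x : {ffun 'I_n -> nat}) : (forall i, (x i <= p)%N) -> cube (zz x).
  move=> xp i; rewrite mxE; apply/andP; split.
    by rewrite lerDl divr_ge0// mulr_ge0.
  by rewrite -lerBrDl ler_pdivrMr// (_ : 1 - -1 = 2) ?ler_wpM2l// ?ler_nat//; lra.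
(* The values at heights 0 and [p] are forced because the combinatorial lemma asks for them at all
   integer points, even off the grid. On the grid they agree with the signs of [F], as [bF]
   checks. *)
pose b k (x : {ffun 'I_n -> nat}) := if insub k is Some i then
   (x i != 0%N) && ((x i == p) || (0 < F i (zz x))) else true.
pose a k x : 'F_2 := if b k x then 1 else 0.
have ai (i : 'I_n) (x : {ffun 'I_n -> nat}) :
    a i x = if (x i != 0%N) && ((x i == p) || (0 < F i (zz x))) then 1 else 0.
  by rewrite /a /b valK.
have bF (i : 'I_n) (x : {ffun 'I_n -> nat}) : (forall j, (x j <= p)%N) -> a i x = if 0 < F i (zz x) then 1 else 0.
  move=> xp; rewrite ai; congr (if _ then _ else _).
  have [x0|x0] /= := eqVneq (x i) 0%N.
    apply/esym/negbTE; rewrite -leNgt ltW//; apply: FN1; first exact: zc.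
    by rewrite mxE x0 mulr0 mul0r addr0.
  have [xip/=|//] := eqVneq (x i) p.
  apply/esym; apply: F1; first exact: zc.
  by rewrite mxE xip -mulrA divff ?mulr1 ?gt_eqF//; lra.
have [|||x xp xP] := @cubical_sperner n a p => //.
- by move=> i x x0; rewrite ai x0.
- by move=> i x x1; rewrite ai x1 eqxx/= andbT -lt0n p0.
have cx : cube (zz x) by apply: zc => i; exact: ltnW.
have d2 : 0 < d / 2 < 0 + d by lra.
have [j jP] := dP _ d2 _ cx.
have [y [w [yw yP wP]]] := xP j.
have cellP (v : {ffun 'I_n -> nat}) : (forall i, (x i <= v i <= (x i).+1)%N) ->
    (forall i, (v i <= p)%N) /\ forall i, `|zz x 0 i - zz v 0 i| < d / 2.
  move=> vP; split=> i; have /andP[v1 v2] := vP i.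
    by rewrite (leq_trans v2).
  rewrite !mxE opprD addrACA subrr add0r distrC -mulrBl -mulrBr.
  rewrite -natrB// !normrM normfV !normr_nat (le_lt_trans _ pd)//.
  by rewrite ler_wpM2r ?invr_ge0// ler_piMr// lern1 leq_subLR addn1.
have [yp yd] := cellP y yP; have [wp wd] := cellP w wP.
move: yw; rewrite !bF//; case: jP => jP.
  by rewrite !jP ?eqxx//; exact: zc.
by rewrite !ltNge !jP ?eqxx//; exact: zc.
Qed.

End PoincareMiranda.

(** * Separation of a point from a convex cone *)

Section Sublinear.
Context {R : realType} {V : lmodType R}.
Implicit Types (phi : V -> R) (C : set V).

Definition sublinear phi := (forall u v, phi (u + v) <= phi u + phi v) /\
  (forall c u, 0 <= c -> phi (c *: u) <= c * phi u).

Lemma sublinear0 phi : sublinear phi -> phi 0 = 0.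
Proof.
move=> [phiD phiZ]; apply/eqP; rewrite eq_le; apply/andP; split.
  by have := phiZ 0 0 (lexx _); rewrite scale0r mul0r.
by have := phiD 0 0; rewrite addr0 -subr_ge0 addrK.
Qed.

Lemma sublinear_ge phi t u : sublinear phi -> t * phi u <= phi (t *: u).
Proof.
move=> sphi; have phi0 := sublinear0 sphi; have [phiD phiZ] := sphi.
have [t0|t0] := ltP 0 t.
  have := phiZ t^-1 (t *: u); rewrite invr_ge0 ltW// scalerA mulVf ?gt_eqF// scale1r.
  by rewrite ler_pdivlMl//; apply.
have := phiD (t *: u) (- t *: u); rewrite scaleNr subrr phi0 -lerBlDr sub0r => H.
rewrite (le_trans _ H)// lerNr -mulNr -scaleNr phiZ//; lra.
Qed.

(** The infimum of [phi (u + t *: e) - t * phi e] over all [t] is sublinear and becomes linear along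
    [e]; this is one step of a finite Hahn-Banach argument. *)
Lemma sublinear_reduce phi e : sublinear phi -> exists psi, [/\ sublinear psi,
  forall u, psi u <= phi u & psi e + psi (- e) <= 0].
Proof.
move=> sphi; have phi0 := sublinear0 sphi; have [phiD phiZ] := sphi.
pose A u := [set phi (u + t *: e) - t * phi e | t in [set: R]].
have A0 u : A u !=set0 by exists (phi (u + 0 *: e) - 0 * phi e), 0.
have Alb u : has_lbound (A u).
  exists (- phi (- u)) => _ [t _ <-].
  have := phiD (u + t *: e) (- u); rewrite addrAC subrr add0r => H.
  have := sublinear_ge t e sphi; lra.
pose psi u := inf (A u).
have psi_le u t : psi u <= phi (u + t *: e) - t * phi e by apply: ge_inf => //; exists t.
have psi_ge u m : (forall t, m <= phi (u + t *: e) - t * phi e) -> m <= psi u.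
  by move=> H; apply: lb_le_inf => // _ [t _ <-].
have psi_phi u : psi u <= phi u by have := psi_le u 0; rewrite scale0r mul0r addr0 subr0.
exists psi; split=> //; last first.
  have := psi_le (- e) 1; rewrite scale1r addNr phi0 mul1r; have := psi_phi e; lra.
split=> [u v|c u c0].
  rewrite -lerBlDr; apply: (psi_ge) => t; rewrite lerBlDr -lerBlDl.
  apply: (psi_ge) => s; rewrite lerBlDl.
  apply: (le_trans (psi_le _ (t + s))).
  rewrite scalerDl addrACA; have := phiD (u + t *: e) (v + s *: e); lra.
move: c0; rewrite le_eqVlt => /predU1P[<-|c0].
  by rewrite scale0r mul0r -phi0.
rewrite mulrC -ler_pdivrMr//; apply: (psi_ge) => t; rewrite ler_pdivrMr//.
apply: (le_trans (psi_le _ (c * t))); rewrite -scalerA -scalerDr.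
have := phiZ c (u + t *: e) (ltW c0); nra.
Qed.

Lemma sublinear_reduce_seq phi (s : seq V) : sublinear phi -> exists psi, [/\ sublinear psi,
  forall u, psi u <= phi u & forall e, e \in s -> psi e + psi (- e) <= 0].
Proof.
move=> sphi; elim: s => [|e s [psi [spsi psile IH]]]; first by exists phi.
have [psi' [spsi' psile' e0]] := sublinear_reduce e spsi.
exists psi'; split => // [u|v]; first exact: le_trans (psile _).
rewrite inE => /predU1P[->//|/IH]; apply: le_trans; exact: lerD.
Qed.

Definition convex_cone C := [/\ C 0, forall u v, C u -> C v -> C (u + v) &
  forall (c : R) u, 0 <= c -> C u -> C (c *: u)].

Lemma convex_cone_enlarge C x (s : seq V) : convex_cone C -> ~ C x ->
  exists C', [/\ convex_cone C', C `<=` C', ~ C' x &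
    forall e, e \in s -> C' e \/ C' (- e)].
Proof.
move=> CC Cx; elim: s => [|e s [D [DD CD Dx IH]]]; first by exists C; split.
have [D0 DA DZ] := DD.
pose D' (v : V) := [set u | exists2 t, 0 <= t & D (u - t *: v)].
have D'C v : convex_cone (D' v).
  split.
  - by exists 0 => //; rewrite scale0r subr0.
  - move=> u w [t t0 Du] [r r0 Dw]; exists (t + r); first exact: addr_ge0.
    by rewrite scalerDl opprD addrACA; exact: DA.
  - move=> c u c0 [t t0 Du]; exists (c * t); first exact: mulr_ge0.
    by rewrite -scalerA -scalerBr; exact: DZ.
have DD' v : D `<=` D' v by move=> u Du; exists 0 => //; rewrite scale0r subr0.
have D'v v : D' v v by exists 1 => //; rewrite scale1r subrr.
suff [v ve D'x] : exists2 v, v = e \/ v = - e & ~ D' v x.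
  exists (D' v); split => //; first exact: subset_trans (DD' v).
  move=> w; rewrite inE => /predU1P[->|/IH[|] /DD'-/(_ v)]; [|by left|by right].
  by case: ve => ve; [left|right]; rewrite -ve.
have [[t t0 Dt]|D'x] := pselect (D' e x); last by exists e => //; left.
exists (- e); first by right.
move=> [r r0 Dr]; apply: Dx; move: t0; rewrite le_eqVlt => /predU1P[t0|t0].
  by move: Dt; rewrite -t0 scale0r subr0.
have tr : 0 < t + r by lra.
have := DA _ _ (DZ r _ r0 Dt) (DZ t _ (ltW t0) Dr).
have -> : r *: (x - t *: e) + t *: (x - r *: - e) = (t + r) *: x.
  rewrite scalerN opprK scalerBr scalerDr !scalerA [t * r]mulrC addrACA addNr addr0.
  by rewrite -scalerDl addrC.
move=> /(DZ (t + r)^-1); rewrite invr_ge0 ltW// scalerA mulVf ?gt_eqF//.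
by rewrite scale1r => /(_ isT).
Qed.

End Sublinear.

Section ConeSeparation.
Context {R : realType} {I : finType}.
Local Notation V := {ffun I -> R}.

Definition unit_vec (i : I) : V := [ffun j => (j == i)%:R].

Lemma unit_vec_sum (u : V) : u = \sum_i u i *: unit_vec i.
Proof.
apply/ffunP => j; rewrite sum_ffunE (bigD1 j)//= !ffunE eqxx big1 ?addr0.
  by rewrite [_ *: _]mulr1.
by move=> i ij; rewrite !ffunE eq_sym (negbTE ij) [_ *: _]mulr0.
Qed.

(** Once reduced along all unit vectors, [psi] is bounded above by the linear form with coefficients
    [psi (unit_vec i)]; applying this bound to [- u] bounds [psi u] from below. *)
Lemma sublinear_minorant (phi : V -> R) : sublinear phi ->
  exists a : I -> R, forall u : V, \sum_i a i * u i <= phi u.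
Proof.
move=> sphi.
have [psi [spsi psile psi0]] := sublinear_reduce_seq [seq unit_vec i | i <- enum I] sphi.
have {}psi0 i : psi (- unit_vec i) <= - psi (unit_vec i).
  by have := psi0 (unit_vec i); rewrite map_f ?mem_enum// => /(_ isT); lra.
exists (fun i => psi (unit_vec i)) => u; apply: le_trans (psile u).
have [psiD psiZ] := spsi.
have psi_sum (v : V) : psi v <= \sum_i v i * psi (unit_vec i).
  have psi_big (r : seq I) : psi (\sum_(i <- r) v i *: unit_vec i) <=
      \sum_(i <- r) psi (v i *: unit_vec i).
    elim: r => [|i r IHr]; first by rewrite !big_nil (sublinear0 spsi).
    by rewrite !big_cons (le_trans (psiD _ _))// lerD2l.
  rewrite {1}(unit_vec_sum v) (le_trans (psi_big _))// ler_sum// => i _.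
  have [v0|v0] := leP 0 (v i); first exact: psiZ.
  have := psiZ (- v i) (- unit_vec i); rewrite scaleNr scalerN opprK => H.
  rewrite (le_trans (H _))//; first lra.
  by have := psi0 i; nra.
have := psi_sum (- u); have := psiD u (- u); rewrite subrr (sublinear0 spsi).
under [X in _ -> _ <= X -> _]eq_bigr do rewrite ffunE mulNr.
rewrite sumrN; under [X in _ -> _ -> X <= _]eq_bigr do rewrite mulrC.
lra.
Qed.

(** The cone is not assumed closed. It is enlarged until it contains a signed copy of each unit
    vector; their sum [w] is then an order unit, and the gauge relative to [w] is a finite sublinear
    function, at most 0 on the cone. *)
Lemma cone_separation (C : set V) x : convex_cone C -> ~ C x ->
  exists2 a : I -> R, (exists i, a i != 0) & forall u, C u -> \sum_i a i * u i <= 0.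
Proof.
move=> CC Cx.
have [D [DD CD Dx DP]] := convex_cone_enlarge [seq unit_vec i | i <- enum I] CC Cx.
have [D0 DA DZ] := DD.
have /choice[v vP] : forall i, exists w, D w /\ (w = unit_vec i \/ w = - unit_vec i).
  move=> i; have [|?|?] := DP (unit_vec i); first by rewrite map_f ?mem_enum.
    by exists (unit_vec i); split => //; left.
  by exists (- unit_vec i); split => //; right.
have Dsum (r : seq I) (F : I -> V) : (forall i, D (F i)) -> D (\sum_(i <- r) F i).
  by move=> DF; elim: r => [|i r IHr]; rewrite ?big_nil ?big_cons//; exact: DA.
pose w := \sum_i v i.
have Dw : D w by apply: (Dsum) => i; case: (vP i).
have unit_w u : exists s, D (u + s *: w).
  pose s := \sum_i `|u i|; exists s.
  rewrite (unit_vec_sum u) /w scaler_sumr -big_split/=; apply: (Dsum) => i.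
  have us : `|u i| <= s.
    by rewrite /s (bigD1 i)//= lerDl sumr_ge0.
  have [Dv [vE|vE]] := vP i; move: Dv; rewrite vE.
    by rewrite -scalerDl; apply: (DZ); move: us; rewrite ler_norml => /andP[]; lra.
  rewrite (_ : _ + _ = (s - u i) *: - unit_vec i).
    by apply: (DZ); move: us; rewrite ler_norml => /andP[]; lra.
  by rewrite scalerBl !scalerN opprK addrC.
have DNw : ~ D (- w).
  move=> DNw; apply: Dx; have [s Ds] := unit_w x.
  have [s0|s0] := leP 0 s.
    rewrite (_ : x = x + s *: w + s *: - w); first by apply: (DA) => //; exact: DZ.
    by rewrite scalerN addrK.
  rewrite (_ : x = x + s *: w + (- s) *: w); first by apply: (DA) => //; apply: (DZ) => //; lra.
  by rewrite scaleNr addrK.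
pose A u := [set s | D (u + s *: w)].
have A0 u : A u !=set0 by have [s Ds] := unit_w u; exists s.
have Apos s : D (s *: w) -> 0 <= s.
  move=> Ds; rewrite leNgt; apply/negP => s0; apply: DNw.
  have := DZ (- s^-1) _ _ Ds; rewrite oppr_ge0 invr_le0 ltW// scalerA mulNr mulVf ?lt_eqF//.
  by rewrite scaleN1r; apply.
have Alb u : has_lbound (A u).
  have [s Ds] := unit_w (- u); exists (- s) => r /= Dr.
  have := DA _ _ Ds Dr; rewrite addrACA addNr add0r -scalerDl => /Apos; lra.
pose phi u := inf (A u).
have phi_le u s : D (u + s *: w) -> phi u <= s by move=> H; apply: ge_inf.
have phi_ge u m : (forall s, D (u + s *: w) -> m <= s) -> m <= phi u.
  by move=> H; apply: lb_le_inf.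
have [a aphi] : exists a : I -> R, forall u : V, \sum_i a i * u i <= phi u.
  apply: sublinear_minorant; split => [u u'|c u c0].
    rewrite -lerBlDr; apply: (phi_ge) => t Dt; rewrite lerBlDr -lerBlDl.
    apply: (phi_ge) => s Ds; rewrite lerBlDl; apply: (phi_le).
    by rewrite scalerDl addrACA; apply: (DA).
  move: c0; rewrite le_eqVlt => /predU1P[<-|c0].
    by rewrite scale0r mul0r; apply: (phi_le); rewrite scale0r addr0.
  rewrite mulrC -ler_pdivrMr//; apply: (phi_ge) => t Dt; rewrite ler_pdivrMr// mulrC.
  by apply: (phi_le); rewrite -scalerA -scalerDr; apply: (DZ) => //; exact: ltW.
exists a.
  apply: contrapT => H; have a0 i : a i = 0.
    by apply: contrapT => /eqP ai; apply: H; exists i.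
  (* The gauge of [w] is at most -1, as [w - w = 0] lies in the cone; a vanishing form would give
     0. *)
  have : \sum_i a i * w i <= -1.
    by rewrite (le_trans (aphi w))//; apply: (phi_le); rewrite scaleN1r subrr.
  rewrite big1 => [|i _]; last by rewrite a0 mul0r.
  by rewrite lerNr oppr0 ler10.
move=> u Cu; rewrite (le_trans (aphi u))//; apply: (phi_le).
by rewrite scale0r addr0; exact: CD.
Qed.

End ConeSeparation.

(** * Hadamard differentials and local Lipschitz bounds *)

Section ConvergentSequences.

(** This turns assumptions about compact sets into local ones in a space that need not be locally
    compact: a failing sequence together with its limit is a compact set on which the assumption
    applies. *)
Lemma compact_cvg_seq (X : topologicalType) (u : nat -> X) (x : X) :
  u @ \oo --> x -> compact (range u `|` [set x]).
Proof.
move=> ux; apply/compact_near_coveringP => I F P FF PK.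
have [[V Q] /= [Vx FQ] VQ] := PK x (or_intror erefl).
have [N _ NV] := ux _ Vx.
have : \forall i \near F, forall n, (n < N)%N -> P i (u n).
  elim: (N) => [|n IHn]; first by apply: nearW => i n.
  have [[V' Q'] /= [Vn FQ'] VQ'] := PK (u n) (or_introl (imageT u n)).
  apply: filterS2 IHn FQ' => i IHi Q'i k; rewrite ltnS leq_eqVlt => /predU1P[->|/IHi//].
  by apply: (VQ' (u n, i)); split => //; exact: nbhs_singleton.
move=> PN; apply: filterS2 PN FQ => i Pi Qi y [[n _ <-]|->].
  have [nN|Nn] := ltnP n N; first exact: Pi.
  by apply: (VQ (u n, i)); split => //; apply: NV.
by apply: (VQ (x, i)); split => //; exact: nbhs_singleton.
Qed.

End ConvergentSequences.

Section HadamardJointLimit.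
Context {R : realType} {X Y : normedModType R}.

(** Along a failing sequence the directions converge to [k], and with [k] they form a compact set on
    which the difference quotients converge uniformly. *)
Lemma hadamard_joint (g : X -> Y) x D k e : is_hadamard g x D -> 0 < e ->
  exists2 d : R, 0 < d & forall t h, 0 < t < d -> `|h - k| < d ->
    `|g (x + t *: h) - g x - t *: D k| <= e * t.
Proof.
move=> gD e0; apply: contrapT => H.
have /choice[p pP] : forall n : nat, exists p : R * X, [/\ 0 < p.1 < n.+1%:R^-1,
    `|p.2 - k| < n.+1%:R^-1 & e * p.1 < `|g (x + p.1 *: p.2) - g x - p.1 *: D k|].
  move=> n; apply: contrapT => Hn; apply: H; exists n.+1%:R^-1; first by rewrite invr_gt0.
  move=> t h tn hn; rewrite leNgt; apply/negP => Htn; apply: Hn.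
  by exists (t, h).
have kc : (fun n => (p n).2) @ \oo --> k.
  apply/cvgrPdistC_lt => r r0; have /cvgr_lt/(_ _ r0)[N _ NP] := @cvg_harmonic R.
  exists N => // n /= Nn; have [_ + _] := pP n; move=> /lt_trans; apply; exact: NP.
have KC := compact_cvg_seq kc.
have Kn0 : (range (fun n => (p n).2) `|` [set k]) !=set0 by exists k; right.
have e20 : 0 < e / 2 by rewrite divr_gt0.
have /fine_cvgP[Dfin /cvgr_lt/(_ _ e20)] := gD _ KC Kn0.
move=> /(filterI Dfin)/near_rightP[d d0 dP].
have /cvgr_lt/(_ _ d0)[N1 _ N1P] := @cvg_harmonic R.
have e4 : 0 < e / 2 / (`|D| + 1) by rewrite !divr_gt0// ltr_wpDl.
have /cvgr_lt/(_ _ e4)[N2 _ N2P] := @cvg_harmonic R.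
pose n := maxn N1 N2.
have [/andP[t0 tn] hn gn] := pP n.
have td : 0 < (p n).1 < 0 + d.
  by rewrite t0 add0r (lt_trans tn)//; apply: N1P => /=; exact: leq_maxl.
have hd : `|(p n).2 - k| < e / 2 / (`|D| + 1).
  by rewrite (lt_trans hn)//; apply: N2P => /=; exact: leq_maxr.
have [fin] := dP _ td; move: gn.
set t := (p n).1 in t0 tn td fin *; set h := (p n).2 in hn hd *.
rewrite /= => gn supe.
have : `|t^-1 *: (g (x + t *: h) - g x) - D h| <= e / 2.
  rewrite -lee_fin; apply: (@le_trans _ _ (ereal_sup [set (`|t^-1 *: (g (x + t *: h0) - g x) - D h0|)%:E
     | h0 in range (fun n => (p n).2) `|` [set k]])).
    by apply: ereal_sup_ubound; exists h => //; left; exists n.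
  by rewrite -(fineK fin) lee_fin ltW.
move=> H1; move: gn; rewrite ltNge => /negP; apply.
have -> : g (x + t *: h) - g x - t *: D k =
    t *: (t^-1 *: (g (x + t *: h) - g x) - D h) + t *: D (h - k).
  by rewrite -scalerDr blinB subrKA scalerBr scalerA divff ?gt_eqF// scale1r.
rewrite (le_trans (ler_normD _ _))// !normrZ (gtr0_norm t0) -mulrDr mulrC ler_wpM2r ?(ltW t0)//.
rewrite (splitr e) lerD// (le_trans (blin_norm_le _ _))//.
move: hd; rewrite ltr_pdivlMr ?ltr_wpDl// => hd.
have := normr_ge0 (h - k); nra.
Qed.

End HadamardJointLimit.

Section Tube.
Context {R : realType} {E : normedModType R} {U : topologicalType}.
Variables (Omega : set E) (f : R -> E -> U -> E).
Hypothesis openOmega : open Omega.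
Hypothesis f_continuous : forall t x z, Omega x ->
  {for ((t, x), z), continuous (fun w : R * E * U => f w.1.1 w.1.2 w.2)}.
Hypothesis f_gateaux : forall t x z, Omega x -> gateaux_differentiable (fun y => f t y z) x.
Hypothesis DG_bounded : forall (K : set E) (M : set U), K `<=` Omega -> compact K -> compact M ->
  exists B, forall t x z, K x -> M z -> `|DG (fun y => f t y z) x| <= B.

Lemma f_cvg (I : Type) (F : set_system I) {FF : Filter F} (a : I -> R) (b : I -> E)
    (c : I -> U) t x z : Omega x ->
  a @ F --> t -> b @ F --> x -> c @ F --> z -> f (a i) (b i) (c i) @[i --> F] --> f t x z.
Proof.
move=> Ox at_ bx cz; have := @f_continuous t x z Ox.
move=> fc; have abc : (fun i => ((a i, b i), c i)) @ F --> ((t, x), z).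
  exact: (cvg_pair (cvg_pair at_ bx) cz).
exact: cvg_comp abc fc.
Qed.

(** A sequence tending to [x] with unbounded differentials would contradict the bound on the compact
    set it forms with [x]. One number serves as radius and, inverted, as bound, so the conclusion
    persists for smaller radii. *)
Lemma DG_locally_bounded (M : set U) x : Omega x -> compact M ->
  exists2 r : R, 0 < r & forall t y z, M z -> `|x - y| < r ->
    Omega y /\ `|DG (fun y => f t y z) y| <= r^-1.
Proof.
move=> Ox cM; have /nbhs_ballP[r /= r0 rO] := open_nbhs_nbhs (conj openOmega Ox).
have {}rO y : `|x - y| < r -> Omega y by move=> xy; apply: rO; rewrite -ball_normE.
apply: contrapT => H.
have /choice[p pP] : forall n : nat, exists p : R * E * U, [/\ M p.2,
    `|x - p.1.2| < Num.min r n.+1%:R^-1 &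
    n%:R < `|DG (fun y => f p.1.1 y p.2) p.1.2|].
  move=> n; apply: contrapT => Hn; apply: H.
  exists (Num.min r n.+1%:R^-1); first by rewrite lt_min r0 invr_gt0 ltr0n.
  move=> t y z Mz xy; split; first by apply: rO; rewrite (lt_le_trans xy)// ge_min lexx.
  rewrite leNgt; apply/negP => Htn; apply: Hn; exists ((t, y), z); split => //=.
  have d0 : 0 < Num.min r n.+1%:R^-1 by rewrite lt_min r0 invr_gt0 ltr0n.
  apply: le_lt_trans Htn; apply: (@le_trans _ _ n.+1%:R); first by rewrite ler_nat.
  by rewrite -[leLHS]invrK lef_pV2 ?posrE ?invr_gt0// ge_min lexx orbT.
have xc : (fun n => (p n).1.2) @ \oo --> x.
  apply/cvgrPdist_lt => e e0; have /cvgr_lt/(_ _ e0)[N _ NP] := @cvg_harmonic R.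
  exists N => // n /= Nn; have [_ + _] := pP n; move=> /lt_le_trans; apply.
  by rewrite ge_min; apply/orP; right; apply/ltW; exact: NP.
have [|B BP] := DG_bounded _ (compact_cvg_seq xc) cM.
  move=> _ [[n _ <-]|->//]; have [_ + _] := pP n => xy.
  by apply: rO; rewrite (lt_le_trans xy)// ge_min lexx.
pose n := (Num.trunc B).+1.
have [Mn _] := pP n; rewrite ltNge => /negP; apply.
apply: le_trans (BP _ _ _ _ Mn) (ltW (truncnS_gt B)).
by left; exists n.
Qed.

(** Along a segment the Gateaux differential gives the right derivative in the parameter, so the
    mean value inequality applies. *)
Lemma segment_lipschitz t z L (A : set E) x y :
  (forall s, 0 <= s <= 1 -> A (x + s *: (y - x))) ->
  (forall y, A y -> Omega y /\ `|DG (fun y => f t y z) y| <= L) ->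
  `|f t y z - f t x z| <= L * `|y - x|.
Proof.
move=> Asegm AL.
pose F s := f t (x + clamp 0 1 s *: (y - x)) z.
have cl01 (s : R) : 0 <= clamp 0 1 s <= 1 by apply: clamp_itv.
have cF : continuous F.
  move=> s; have [Os _] := AL _ (Asegm _ (cl01 s)).
  apply: f_cvg Os (cvg_cst t) _ (cvg_cst z); apply: cvgD; first exact: cvg_cst.
  by apply: cvgZr_tmp; exact: continuous_clamp.
have L0 : 0 <= L.
  have [|_] := AL (x + 0 *: (y - x)); first by apply: Asegm; rewrite lexx ler01.
  exact: le_trans.
have := @rderiv_mean_value R E F (fun s => L * `|y - x| * s) 0 1 ler01 cF.
have -> : F 1 = f t y z by rewrite /F clamp_id ?lexx ?ler01// scale1r addrC subrK.
have -> : F 0 = f t x z by rewrite /F clamp_id ?lexx ?ler01// scale0r addr0.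
rewrite mulr1 mulr0 subr0.
apply; first exact: mulrl_continuous.
move=> s /andP[s0 s1].
have s01 : 0 <= s <= 1 by rewrite s0 ltW.
have [Os Ls] := AL _ (Asegm _ s01).
have /(@xgetPex _ 0) := f_gateaux t z Os; rewrite -/(DG (fun y => f t y z) _).
move=> /(_ (y - x)) Gs.
exists (DG (fun y => f t y z) (x + s *: (y - x)) (y - x)), (L * `|y - x|); split.
- move=> e e0; move/cvgr_distC_le: (Gs) => /(_ _ e0)/near_rightP[d d0 dP].
  near=> r.
  have rs : s < r by [].
  have r1 : r < 1 by near: r; exact: nbhs_right_lt.
  have rd : r < s + d by near: r; apply: nbhs_right_lt; rewrite ltrDl.
  have r01 : 0 <= r <= 1 by rewrite (le_trans s0 (ltW rs)) ltW.
  rewrite /F (clamp_id s01) (clamp_id r01).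
  have rs0 : 0 < r - s by rewrite subr_gt0.
  have := dP (r - s); rewrite rs0 add0r ltrBlDl => /(_ rd).
  rewrite -addrA -scalerDl [s + _]addrC subrK.
  set a := f t _ z; set b := f t _ z; set v := DG _ _ _ => H.
  have -> : a - b - (r - s) *: v = (r - s) *: ((r - s)^-1 *: (a - b) - v).
    by rewrite scalerBr scalerA divff ?gt_eqF// scale1r.
  by rewrite normrZ gtr0_norm// mulrC ler_wpM2r// ltW.
- exact: rderiv_mulr.
- by rewrite (le_trans (blin_norm_le _ _))// ler_wpM2r.
Unshelve. all: by end_near. Qed.

Lemma tube_lipschitz (K : set E) (M : set U) : K `<=` Omega -> compact K -> compact M ->
  exists r : R, exists L : R, [/\ 0 < r, 0 <= L &
   forall x, K x -> (forall y, `|x - y| < r -> Omega y) /\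
    forall t y y' z, M z -> `|x - y| < r -> `|x - y'| < r ->
      `|f t y z - f t y' z| <= L * `|y - y'|].
Proof.
move=> KO cK cM.
pose P (r : R) x := forall t y z, M z -> `|x - y| < r ->
    Omega y /\ `|DG (fun y => f t y z) y| <= r^-1.
pose P' (r : R) x := (forall y, `|x - y| < r -> Omega y) /\ P r x.
have Px x : K x -> \forall x' \near x & r \near 0^'+, P' r x'.
  move=> Kx; have [r r0 rP] := DG_locally_bounded (KO _ Kx) cM.
  have /nbhs_ballP[r' /= r'0 r'O] := open_nbhs_nbhs (conj openOmega (KO _ Kx)).
  pose d := Num.min r r'; have d0 : 0 < d by rewrite lt_min r0.
  exists (ball x (d / 2), [set s : R | 0 < s < d / 2]).
    split => /=; first by apply: nbhsx_ballx; rewrite divr_gt0.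
    near=> s; apply/andP; split => //.
    by near: s; apply: nbhs_right_lt; rewrite divr_gt0.
  move=> [x' s] /=; rewrite -ball_normE/= => -[xx' /andP[s0 sr]].
  have xy y : `|x' - y| < s -> `|x - y| < d.
    by move=> x'y; rewrite -(subrKA x') (le_lt_trans (ler_normD _ _))//; lra.
  split=> [y /xy xyd|t y z Mz /xy xyd].
    by apply: r'O; rewrite -ball_normE/= (lt_le_trans xyd)// ge_min lexx orbT.
  have [|Oy DGy] := rP t y z Mz; first by rewrite (lt_le_trans xyd)// ge_min lexx.
  split=> //; rewrite (le_trans DGy)// lef_pV2 ?posrE// ltW//.
  have : d <= r by rewrite ge_min lexx.
  lra.
have /compact_near_coveringP/(_ _ (0 : R)^'+ P' _ Px) := cK.
move=> /near_rightP[d d0 dP].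
have dd : 0 < d / 2 < 0 + d by lra.
exists (d / 2), (d / 2)^-1; split; [lra|by rewrite invr_ge0; lra|].
move=> x Kx; have [xO xP] := dP _ dd _ Kx; split=> // t y y' z Mz xy xy'.
apply: (@segment_lipschitz t z _ [set w | `|x - w| < d / 2]) => [s /andP[s0 s1]|w]; last exact: xP.
rewrite /= (_ : x - _ = (1 - s) *: (x - y') + s *: (x - y)).
  rewrite (le_lt_trans (ler_normD _ _))// !normrZ !ger0_norm ?subr_ge0//.
  pose m := Num.max `|x - y'| `|x - y|.
  have h1 : (1 - s) * `|x - y'| <= (1 - s) * m.
    by rewrite ler_wpM2l ?subr_ge0// le_max lexx.
  have h2 : s * `|x - y| <= s * m by rewrite ler_wpM2l// le_max lexx orbT.
  have m2 : m < d / 2 by rewrite gt_max xy xy'.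
  lra.
rewrite scalerBl scale1r -addrA [- _ + _]addrC -scalerBr opprB [x - y + _]addrC subrKA.
by rewrite opprD addrA -scalerN opprB.
Unshelve. all: by end_near. Qed.

End Tube.

(** * Piecewise continuous controls and piecewise C1 trajectories *)

Section Subdivisions.
Context {R : realType}.
Implicit Types (s D : seq R) (t T : R).

Lemma partition_locate_right a T s t : itv_partition a T s -> a <= t < T ->
  exists2 i, (i < size s)%N & nth T (a :: s) i <= t < nth T (a :: s) i.+1.
Proof.
move=> [+ /eqP]; elim: s a => [|b s IHs] a /=; first by move=> _ -> /andP[/le_lt_trans h /h]; rewrite ltxx.
move=> /andP[ab bs] lastT /andP[at_ tT]; have [tb|bt] := ltP t b.
  by exists 0%N => //=; rewrite at_.
have [|i si it] := IHs b bs lastT; first by rewrite bt.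
by exists i.+1.
Qed.

Lemma partition_locate_left a T s t : itv_partition a T s -> a < t <= T ->
  exists2 i, (i < size s)%N & nth T (a :: s) i < t <= nth T (a :: s) i.+1.
Proof.
move=> [+ /eqP]; elim: s a => [|b s IHs] a /=; first by move=> _ -> /andP[/lt_le_trans h /h]; rewrite ltxx.
move=> /andP[ab bs] lastT /andP[at_ tT]; have [tb|bt] := leP t b.
  by exists 0%N => //=; rewrite at_.
have [|i si it] := IHs b bs lastT; first by rewrite bt.
by exists i.+1.
Qed.

Lemma partition_avoiding T D : 0 < T -> exists2 s, itv_partition 0 T s &
  forall i, (i < size s)%N -> let a := nth T (0 :: s) i in let b := nth T (0 :: s) i.+1 in
    [/\ 0 <= a, a < b, b <= T & forall t, a < t < b -> t \notin D].
Proof.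
move=> T0; pose r := sort <=%R (undup [seq t <- D | 0 < t < T]).
have rP t : (t \in r) = (0 < t < T) && (t \in D).
  by rewrite mem_sort mem_undup mem_filter.
have rsort : sorted <%R r by rewrite sort_lt_sorted undup_uniq.
have sP : path <%R 0 (rcons r T).
  rewrite rcons_path path_min_sorted ?rsort//=; last first.
    by apply/allP => t; rewrite rP => /andP[/andP[]].
  have := mem_last 0 r; rewrite inE => /predU1P[->//|].
  by rewrite rP => /andP[/andP[]].
have sT : itv_partition 0 T (rcons r T) by split => //; rewrite last_rcons.
exists (rcons r T) => // i si a b.
have szr := size_rcons r T.
have a0 : 0 <= a.
  by apply: itv_partition_nth_ge sT; rewrite ltnW.
have bT : b <= T.
  by apply: itv_partition_nth_le sT.
have mono := @lt_sorted_ltn_nth _ _ T (0 :: rcons r T) sP.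
have ab : a < b by rewrite /a /b mono ?inE//= ltnW.
split => // t /andP[at_ tb]; apply/negP => tD.
have ts : t \in 0 :: rcons r T.
  by rewrite inE mem_rcons inE rP tD (le_lt_trans a0 at_) (lt_le_trans tb bT) !orbT.
have [j js tE] : exists2 j, (j < (size (rcons r T)).+1)%N & nth T (0 :: rcons r T) j = t.
  by exists (index t (0 :: rcons r T)); [rewrite index_mem|rewrite nth_index].
move: at_ tb; rewrite -tE /a /b !mono ?inE//= ?ltnS; last by rewrite ltnW.
by move=> ij ji; have := leq_trans ij ji; rewrite ltnn.
Qed.

Lemma near_notin D t : \forall s \near t^', s \notin D.
Proof.
elim: D => [|d D IHD]; first exact: nearW.
have dP : \forall s \near t^', s != d.
  have [->|dt] := eqVneq d t; first by rewrite near_withinE; exact: nearW.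
  apply: nbhs_dnbhs; apply: (@open_nbhs_nbhs _ t [set s | s != d]).
  by split; [exact: open_neq|rewrite /= eq_sym].
by near=> s; rewrite inE negb_or; apply/andP; split; near: s.
Unshelve. all: by end_near. Qed.

Lemma near_right_notin D t : \forall s \near t^'+, s \notin D.
Proof.
have := near_notin D t; rewrite !near_withinE; apply: filterS => s sD ts.
by apply: sD; rewrite gt_eqF.
Qed.

Lemma near_left_notin D t : \forall s \near t^'-, s \notin D.
Proof.
have := near_notin D t; rewrite !near_withinE; apply: filterS => s sD ts.
by apply: sD; rewrite lt_eqF.
Qed.

End Subdivisions.

Section NormalizedPiecewiseContinuous.
Context {R : realType} {Y : topologicalType}.
Implicit Types (u v : R -> Y) (D : seq R) (t T : R).

Definition finite_disc v := exists D, forall t, t \notin D -> {for t, continuous v}.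

Lemma NPC0_intro T v : 0 < T -> cadlag v -> finite_disc v -> v @ T^'- --> v T -> NPC0 T v.
Proof.
move=> T0 cv [D vD] vT; split => //; last by move=> t _; case: (cv t).
have [s sT sP] := partition_avoiding D T0.
exists s; split => // i si a b; have [_ ab _ abD] := sP _ si; split.
- by move=> t; rewrite inE/= in_itv/= => /abD; exact: vD.
- by exists (v a); case: (cv a).
- by case: (cv b).
Qed.

Lemma NPC0_clamp T u : 0 < T -> NPC0 T u -> let v := u \o clamp 0 T in
  [/\ cadlag v, finite_disc v & v @ T^'- --> v T].
Proof.
move=> T0 [[s [sT sP]] ur uT] v.
have vu t : 0 <= t <= T -> v t = u t by move=> tT; rewrite /v/= clamp_id.
have vlt t : t <= 0 -> v t = u 0 by move=> t0; rewrite /v/= clamp_le// ltW.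
have vgt t : T <= t -> v t = u T by move=> tT; rewrite /v/= clamp_ge// ltW.
have itvP i : (i < size s)%N -> 0 <= nth T (0 :: s) i /\ nth T (0 :: s) i.+1 <= T.
  move=> si; split; first by apply: itv_partition_nth_ge sT; rewrite ltnW.
  by apply: itv_partition_nth_le sT.
have near_in t : 0 < t < T -> \forall r \near t, u r = v r.
  move=> /andP[t0 tT]; near=> r; rewrite vu//; apply/andP; split.
    by apply/ltW; near: r; exact: lt_nbhsr.
  by apply/ltW; near: r; exact: lt_nbhsl.
have vT : v @ T^'- --> v T.
  rewrite vu ?lexx ?ltW//; apply: cvg_trans uT; apply: near_eq_cvg; near=> r.
  rewrite vu//; apply/andP; split => //.
  by near: r; exact: nbhs_left_ge.
have vfor t : 0 < t < T -> {for t, continuous u} -> {for t, continuous v}.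
  move=> t0T; have /andP[t0 tT] := t0T.
  move=> cu; rewrite /continuous_at/prop_for vu ?(ltW t0) ?(ltW tT)//.
  by apply: cvg_trans cu; apply: near_eq_cvg; exact: near_in.
split=> // [t|].
  split.
    have [Tt|tT] := leP T t.
      apply: cvg_near_cst; near=> r; rewrite !vgt//.
      by rewrite (le_trans Tt)//; near: r; exact: nbhs_right_ge.
    have [t0|t0] := ltP t 0.
      apply: cvg_near_cst; near=> r; rewrite !vlt//; first exact: ltW.
      by near: r; exact: nbhs_right_le.
    rewrite vu ?t0 ?ltW//.
    have : u @ t^'+ --> u t by apply: ur; rewrite t0.
    apply: cvg_trans; apply: near_eq_cvg; near=> r; rewrite vu//; apply/andP; split.
      by rewrite (le_trans t0)//; near: r; exact: nbhs_right_ge.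
    by near: r; exact: nbhs_right_le.
  have [t0|t0] := leP t 0.
    exists (u 0); apply: cvg_near_cst; near=> r; rewrite !vlt//.
    by rewrite (le_trans _ t0)//; near: r; exact: nbhs_left_le.
  have [Tt|tT] := ltP T t.
    exists (u T); apply: cvg_near_cst; near=> r; rewrite !vgt//.
    by near: r; exact: nbhs_left_ge.
  have [|i si /andP[it ti]] := partition_locate_left sT (t := t); first by rewrite t0.
  have [cu _ [y uy]] := sP _ si.
  have [y' uy'] : exists y : Y, u @ t^'- --> y.
    move: ti; rewrite le_eqVlt => /predU1P[->|ti]; first by exists y.
    by exists (u t); apply: cvg_at_left_filter; apply: cu; rewrite inE/= in_itv/= it.
  exists y'; apply: cvg_trans uy'; apply: near_eq_cvg; near=> r; rewrite vu//.
  apply/andP; split; first by near: r; exact: nbhs_left_ge.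
  by rewrite (le_trans _ tT)//; near: r; exact: nbhs_left_le.
exists (0 :: T :: s) => t; rewrite !inE !negb_or => /and3P[tn0 tnT ts].
have [t0|t0] := ltP t 0.
  rewrite /prop_for/continuous_at vlt; last exact: ltW.
  by apply: cvg_near_cst; near=> r; rewrite vlt//; apply/ltW; near: r; exact: lt_nbhsl.
have [Tt|tT] := ltP T t.
  rewrite /prop_for/continuous_at vgt; last exact: ltW.
  by apply: cvg_near_cst; near=> r; rewrite vgt//; apply/ltW; near: r; exact: lt_nbhsr.
have {}t0 : 0 < t by rewrite lt_neqAle eq_sym tn0.
have {}tT : t < T by rewrite lt_neqAle tnT.
apply: vfor; first by rewrite t0.
apply: (@pc_subdivision_continuous _ _ T s) => //; first by rewrite ltW.
by rewrite inE negb_or tn0.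
Unshelve. all: by end_near. Qed.

(** This supplies the compact set of controls on which the differentials of [f] are bounded. Each
    arc between jumps, closed up by its left limit, is a continuous image of a segment. *)
Lemma cadlag_compact_range v a b : cadlag v -> finite_disc v -> a <= b ->
  exists2 M, compact M & forall t, a <= t <= b -> M (v t).
Proof.
move=> cv [D vD] ab.
suff : forall c, a <= c <= b -> exists2 M, compact M & forall t, a <= t <= c -> M (v t).
  by apply; rewrite ab lexx.
apply: real_induction => //.
- by exists [set v a]; [exact: compact_set1|move=> t /le_anti ->].
- move=> c /andP[ac cb] /(_ c); rewrite ac lexx => /(_ isT)[M cM MP].
  have /near_rightP[d d0 dP] := near_right_notin D c.
  apply/near_rightP; exists d => // x /andP[cx xd].
  exists (M `|` v @` `[c, x]).
    apply: compactU => //; apply: continuous_compact; last exact: segment_compact.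
    apply/subspace_continuousP => t; rewrite /= in_itv/= => /andP[ct tx].
    move: ct; rewrite le_eqVlt => /predU1P[<-|ct].
      have [vc _] := cv c; have := cvg_at_right_within vc.
      apply: cvg_trans; apply: cvg_app; apply: within_subset => r /=; rewrite in_itv/=.
      by case/andP.
    apply: cvg_within_filter; apply: vD; apply: dP; rewrite ct (le_lt_trans tx)//.
  move=> t /andP[at_ tx]; have [tc|ct] := leP t c; first by left; apply: MP; rewrite at_.
  by right; exists t => //=; rewrite in_itv/= tx ltW.
- move=> c /andP[ac cb] Pc; have [_ [y vy]] := cv c.
  have /near_leftP[d d0 dP] := near_left_notin D c.
  pose x := Num.max a (c - d / 2).
  have xc : x < c by rewrite /x gt_max ac/=; lra.
  have ax : a <= x by rewrite /x le_max lexx.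
  have dx : c - d < x by rewrite /x lt_max; apply/orP; right; lra.
  have [|M cM MP] := Pc x; first by rewrite ax.
  (* Replacing the value at [c] by the left limit makes the arc continuous up to [c]; the true value
     [v c] is added to the compact set as a singleton. *)
  pose w t := if t < c then v t else y.
  exists (M `|` w @` `[x, c] `|` [set v c]).
    apply: compactU; last exact: compact_set1.
    apply: compactU => //; apply: continuous_compact; last exact: segment_compact.
    apply/subspace_continuousP => t; rewrite /= in_itv/= => /andP[xt tc].
    move: tc; rewrite le_eqVlt => /predU1P[->|tc].
      have : w @ c^'- --> w c.
        rewrite {2}/w ltxx; apply: cvg_trans vy; apply: near_eq_cvg.
        by near=> r; rewrite /w ifT//; near: r; exact: nbhs_left_lt.
      move=> /cvg_at_left_within; apply: cvg_trans; apply: cvg_app.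
      by apply: within_subset => r /=; rewrite in_itv/= => /andP[].
    apply: cvg_within_filter; rewrite /from_subspace; have -> : w t = v t by rewrite /w tc.
    have : {for t, continuous v} by apply: vD; apply: dP; rewrite tc (lt_le_trans dx).
    apply: cvg_trans; apply: near_eq_cvg; near=> r; rewrite /w ifT//.
    by near: r; exact: lt_nbhsl.
  move=> t /andP[at_ tc]; have [tx|xt] := ltP t x; first by left; left; apply: MP; rewrite at_ ltW.
  move: tc; rewrite le_eqVlt => /predU1P[->|tc]; first by right.
  by left; right; exists t => /=; [rewrite in_itv/= xt ltW|rewrite /w tc].
Unshelve. all: by end_near. Qed.

End NormalizedPiecewiseContinuous.

Section PiecewiseC1.
Context {R : realType} {X : normedModType R}.
Implicit Types (x y phi : R -> X) (t T : R).

Lemma rderiv_lipschitz y phi a b e v : a <= b -> continuous y ->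
  (forall t, a <= t < b -> rderiv y t (phi t) /\ `|phi t - v| <= e) ->
  `|y b - y a - (b - a) *: v| <= e * (b - a).
Proof.
move=> ab cy yP; have clin : continuous (fun r : R => (r - 0) *: v).
  by move=> z; apply: cvgZr_tmp; apply: cvgB; [exact: cvg_id|exact: cvg_cst].
have := @rderiv_dist R X y (fun r => (r - 0) *: v) a b e a b cy clin.
rewrite -scalerBl !subr0; apply => // r arb; have [yr re] := yP _ arb.
by exists (phi r), v; split => //; exact: rderiv_line.
Qed.

(** Near a continuity point of the right derivative, the mean value inequality compares [y] with the
    line of slope [phi t] on both sides of [t]. *)
Lemma rderiv_derivable y phi t d : continuous y -> 0 < d ->
  (forall s, t - d < s < t + d -> rderiv y s (phi s)) -> {for t, continuous phi} ->
  derivable y t 1 /\ y^`() t = phi t.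
Proof.
move=> cy d0 yP cphi.
have H : h^-1 *: (y (h *: 1 + t) - y t) @[h --> 0^'] --> phi t.
  apply/cvgrPdistC_le => e e0; have := cphi; move=> /cvgr_distC_le/(_ _ e0)/nbhs_ballP[r /= r0 rP].
  rewrite near_withinE; apply/nbhs_ballP; exists (Num.min d r); first by rewrite /= lt_min d0.
  move=> h; rewrite -ball_normE/= sub0r normrN lt_min => /andP[hd hr] h0.
  rewrite [_ *: 1]mulr1.
  have K s : `|s - t| < Num.min d r -> rderiv y s (phi s) /\ `|phi s - phi t| <= e.
    rewrite lt_min => /andP[sd sr]; split.
      by apply: yP; move: sd; rewrite ltr_norml => /andP[]; lra.
    by apply: rP; rewrite -ball_normE/= distrC.
  have K' s : `|s - t| <= `|h| -> rderiv y s (phi s) /\ `|phi s - phi t| <= e.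
    by move=> sh; apply: K; rewrite (le_lt_trans sh)// lt_min hd.
  suff E : `|y (h + t) - y t - h *: phi t| <= e * `|h|.
    have -> : h^-1 *: (y (h + t) - y t) - phi t = h^-1 *: (y (h + t) - y t - h *: phi t).
      by rewrite [RHS]scalerBr scalerA mulVf// scale1r.
    by rewrite normrZ normfV mulrC ler_pdivrMr ?normr_gt0.
  have [hpos|hneg] := leP 0 h.
    rewrite (ger0_norm hpos).
    have := @rderiv_lipschitz y phi t (h + t) e (phi t); rewrite addrK; apply => //.
    - by rewrite lerDr.
    - move=> s /andP[ts sh]; apply: K'; rewrite !ger0_norm ?subr_ge0//; lra.
  have := @rderiv_lipschitz y phi (h + t) t e (phi t).
  rewrite opprD [t + _]addrC addrNK scaleNr opprK (ltr0_norm hneg) => E.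
  rewrite -normrN !opprD !opprK [- y _ + _]addrC E//; first by lra.
  move=> s /andP[ts sh]; apply: K'; rewrite !ler0_norm ?subr_le0 ?(ltW sh) ?(ltW hneg)//; lra.
have H' : derivable y t 1 by apply/cvg_ex; exists (phi t); exact: H.
by split => //; rewrite derive1E; apply: cvg_lim.
Qed.

(** The way back from right derivatives to the notions of the statement; the subdivision is cut at
    the exceptional points of [phi]. It serves for trajectories and for the adjoint arc. *)
Lemma PC1_intro T y phi : 0 < T -> continuous y -> cadlag phi -> finite_disc phi ->
  phi @ T^'- --> phi T -> (forall t, 0 <= t < T -> rderiv y t (phi t)) ->
  PC1 T y /\ forall t, 0 <= t <= T -> ext_derive T y t = phi t.
Proof.
move=> T0 cy cphi [D phiD] phiT yP.
have dy t : 0 < t < T -> t \notin D -> derivable y t 1 /\ y^`() t = phi t.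
  move=> /andP[t0 tT] /phiD ct; apply: (@rderiv_derivable _ _ _ (Num.min t (T - t))) => //.
    by rewrite lt_min t0 subr_gt0.
  have h1 : Num.min t (T - t) <= t by rewrite ge_min lexx.
  have h2 : Num.min t (T - t) <= T - t by rewrite ge_min lexx orbT.
  move=> s /andP[s1 s2]; apply: yP; apply/andP; split; lra.
have eqr t : 0 <= t < T -> \forall s \near t^'+, phi s = y^`() s.
  move=> /andP[t0 tT]; near=> s; apply/esym; apply: (proj2 (dy _ _ _)).
    apply/andP; split; first by rewrite (le_lt_trans t0).
    by near: s; exact: nbhs_right_lt.
  by near: s; exact: near_right_notin.
have eql t : 0 < t <= T -> \forall s \near t^'-, phi s = y^`() s.
  move=> /andP[t0 tT]; near=> s; apply/esym; apply: (proj2 (dy _ _ _)).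
    apply/andP; split; first by near: s; exact: nbhs_left_gt.
    by rewrite (lt_le_trans _ tT).
  by near: s; exact: near_left_notin.
have rlim t : 0 <= t < T -> y^`() @ t^'+ --> phi t.
  by move=> tT; have [+ _] := cphi t; apply: cvg_trans; apply: near_eq_cvg; exact: eqr.
have [s sT sP] := partition_avoiding D T0.
have C1 : C1_subdivision T s y.
  split=> [i si t|].
    have [a0 ab bT abD] := sP _ si; rewrite inE/= in_itv/= => tab.
    apply: (proj1 (dy _ _ (abD _ tab))).
    by move: tab => /andP[at_ tb]; rewrite (le_lt_trans a0)// (lt_le_trans tb).
  split=> // i si a b; have [a0 ab bT abD] := sP _ si; split.
  - move=> t; rewrite inE/= in_itv/= => tab; have /andP[at_ tb] := tab.
    have tT : 0 < t < T by rewrite (le_lt_trans a0)// (lt_le_trans tb).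
    have [_ yt] := dy t tT (abD _ tab); rewrite /continuous_at yt.
    apply: cvg_trans (phiD _ (abD _ tab)); apply: near_eq_cvg; near=> r.
    have rab : a < r < b.
      apply/andP; split; first by near: r; exact: lt_nbhsr.
      by near: r; exact: lt_nbhsl.
    have rT : 0 < r < T.
      by move: rab => /andP[ar rb]; rewrite (le_lt_trans a0)// (lt_le_trans rb).
    by have [_ ->] := dy r rT (abD _ rab).
  - by exists (phi a); apply: rlim; rewrite a0 (lt_le_trans ab).
  - have [_ [z phiz]] := cphi b; exists z; apply: cvg_trans phiz; apply: near_eq_cvg.
    by apply: eql; rewrite (le_lt_trans a0).
split; first by split; [exact: continuous_subspaceT|exists s].
move=> t tT; rewrite (ext_derive_onE C1)// (ext_derive_on_lim C1)//.
case: eqP => [->|/eqP tneT]; apply: cvg_lim => //.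
  by apply: cvg_trans phiT; apply: near_eq_cvg; apply: eql; rewrite T0 lexx.
by apply: rlim; move: tT => /andP[-> tT]; rewrite lt_neqAle tneT.
Unshelve. all: by end_near. Qed.

Lemma cvg_within_comp (I : Type) (Y Z : topologicalType) (F : set_system I) {FF : Filter F}
    (B : set Y) (G : Y -> Z) (a : I -> Y) (b : Y) : B b -> {within B, continuous G} ->
  (\forall i \near F, B (a i)) -> a @ F --> b -> G (a i) @[i --> F] --> G b.
Proof.
move=> Bb /subspace_continuousP cG Ba ab P /(cG b Bb) H.
have H' : \forall w \near b, B w -> P (G w) by exact: H.
suff : \forall i \near F, P (G (a i)) by [].
have : \forall i \near F, B (a i) -> P (G (a i)) by exact: ab H'.
by apply: filterS2 Ba => i Bi; apply.
Qed.

Lemma continuous_clampP (Y : topologicalType) (x : R -> Y) a b : a <= b ->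
  {within `[a, b], continuous x} -> continuous (x \o clamp a b).
Proof.
move=> ab cx t; have cl s : `[a, b]%classic (clamp a b s) by rewrite /= in_itv/=; exact: clamp_itv.
by apply: (cvg_within_comp _ cx) => //; [exact: nearW|exact: continuous_clamp].
Qed.

Lemma PC1_clamp T x : 0 < T -> PC1 T x -> continuous (x \o clamp 0 T) /\
  forall t, 0 <= t < T -> rderiv (x \o clamp 0 T) t (ext_derive T x t).
Proof.
move=> T0 [wx [s C1]]; have cx := continuous_clampP (ltW T0) wx; split => //.
move=> t tT; have /andP[t0 ltT] := tT.
have tT' : 0 <= t <= T by rewrite t0 ltW.
have [dx [sT sP]] := C1.
have [i si /andP[it ti]] := partition_locate_right sT tT.
have [cdx [d' xd'] _] := sP _ si.
have [d xd] : exists d : X, x^`() @ t^'+ --> d.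
  move: it; rewrite le_eqVlt => /predU1P[<-|it]; first by exists d'.
  by exists (x^`() t); apply: cvg_at_right_filter; apply: cdx; rewrite inE/= in_itv/= it.
have -> : ext_derive T x t = d.
  rewrite (ext_derive_onE C1)// (ext_derive_on_lim C1)// lt_eqF//.
  exact: cvg_lim.
set y := x \o clamp 0 T; set b := nth T (0 :: s) i.+1.
have bT : b <= T by apply: itv_partition_nth_le sT.
have yd r : t < r < b -> rderiv y r (x^`() r).
  move=> /andP[tr rb]; have dxr : derivable x r 1.
    by apply: (dx _ si); rewrite inE/= in_itv/= (le_lt_trans it tr).
  have r0T : 0 <= r <= T by rewrite (le_trans t0 (ltW tr)) (le_trans (ltW rb)).
  apply: rderiv_eq (derivable_rderiv dxr); first by rewrite /y/= clamp_id.
  near=> z; rewrite /y/= clamp_id//; apply/andP; split.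
    by rewrite (le_trans (proj1 (andP r0T)))//; near: z; exact: nbhs_right_ge.
  by rewrite (le_trans _ bT)//; near: z; exact: nbhs_right_le.
move=> e e0; move: xd => /cvgr_distC_le/(_ _ e0)/near_rightP[r r0 rP].
near=> z; have tz : t < z by [].
have zb : z < b by near: z; exact: nbhs_right_lt.
have zr : z < t + r by near: z; apply: nbhs_right_lt; rewrite ltrDl.
(* The estimate is first proved on [[w, z]] with [t < w], where the derivative exists, and passes to
   the limit as [w] decreases to [t]. *)
pose Q r := e * (z - r) - `|y z - y r - (z - r) *: d|.
have Qt : Q r @[r --> t^'+] --> Q t.
  apply: cvg_at_right_filter; apply: cvgB.
    by apply: cvgMr; apply: cvgB; [exact: cvg_cst|exact: cvg_id].
  apply: cvg_norm; apply: cvgB; first by apply: cvgB; [exact: cvg_cst|exact: cx].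
  by apply: cvgZr_tmp; apply: cvgB; [exact: cvg_cst|exact: cvg_id].
rewrite -subr_ge0; apply: (cvgr_to_ge Qt); near=> w; rewrite /Q subr_ge0.
have tw : t < w by [].
have wz : w <= z by near: w; exact: nbhs_right_le.
apply: (rderiv_lipschitz wz cx) => v /andP[wv vz]; split.
  by apply: yd; rewrite (lt_le_trans tw)// (lt_trans vz).
by apply: rP; rewrite (lt_le_trans tw)// (lt_trans vz).
Unshelve. all: by end_near. Qed.

End PiecewiseC1.

(** * Bounded convergence for primitives of cadlag functions *)

Section CadlagIntegral.
Context {R : realType}.
Implicit Types (r B : R -> R) (T t s : R).
Notation mu := (@lebesgue_measure R).

(** The function is the pointwise limit of difference quotients of a continuous primitive, taken up
    to [T + 1] so that quotients also make sense at [T]. *)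
Lemma cadlag_measurable r T : cadlag r -> 0 <= T -> measurable_fun `[0, T] r.
Proof.
move=> cr T0; have T10 : 0 <= T + 1 by lra.
have [B [cB _ BP]] := @cadlag_primitive R R^o r 0 (T + 1) cr T10.
apply: (@measurable_fun_cvg _ _ _ _ (fun n t => n.+1%:R * (B (t + n.+1%:R^-1) - B t))).
  move=> n; apply: measurable_funTS; apply: continuous_measurable_fun => t.
  apply: cvgMr; apply: cvgB; last exact: cB.
  apply: (@continuous_comp _ _ _ (fun t => t + n.+1%:R^-1) B); last exact: cB.
  by apply: cvgD; [exact: cvg_id|exact: cvg_cst].
move=> t; rewrite /= in_itv/= => /andP[t0 tT].
apply/cvgrPdistC_le => e e0.
have tT1 : 0 <= t < T + 1 by lra.
have /near_rightP[d d0 dP] := BP t tT1 e e0.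
have /cvgr_lt/(_ _ d0)[N _ NP] := @cvg_harmonic R.
exists N => // n /NP /= nd.
have n0 : 0 < n.+1%:R^-1 :> R by rewrite invr_gt0.
have := dP (t + n.+1%:R^-1); rewrite ltrDl n0 ltrD2l => /(_ nd).
rewrite [t + _ - t]addrC addKr => H.
have -> : n.+1%:R * (B (t + n.+1%:R^-1) - B t) - r t =
    n.+1%:R * (B (t + n.+1%:R^-1) - B t - n.+1%:R^-1 * r t).
  by rewrite [RHS]mulrBr mulrA divff ?mul1r.
rewrite normrM ger0_norm// mulrC.
by rewrite -ler_pdivlMr ?ltr0n.
Qed.

Lemma cadlag_integrable r T : cadlag r -> 0 <= T -> mu.-integrable `[0, T] (EFin \o r).
Proof.
move=> cr T0; have [M MP] := @cadlag_bounded R R^o r 0 T cr T0.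
apply: measurable_bounded_integrable => //.
- by rewrite /= lebesgue_measure_itv/=; case: ifP => // _; rewrite -EFinB ltry.
- exact: cadlag_measurable.
- exists M; split; first by rewrite num_real.
  move=> x Mx t; rewrite /= in_itv/= => tT; exact: le_trans (MP t tT) (ltW Mx).
Qed.

Lemma cadlag_primitive_Rintegral r B T : cadlag r -> 0 <= T -> continuous B ->
  (forall t, 0 <= t < T -> rderiv (B : R -> R^o) t (r t)) ->
  B T - B 0 = \int[mu]_(t in `[0, T]) r t.
Proof.
move=> cr T0 cB BP.
(* Both [B] and this integral have right derivative [r], so their difference is constant. *)
pose G t := \int[mu]_(s in `[0, clamp 0 T t]) r s.
have ir t : t <= T -> mu.-integrable `[0, t] (EFin \o r).
  move=> tT; apply: integrableS (cadlag_integrable cr T0) => //.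
  by apply: subset_itvl; rewrite bnd_simp.
have Gbnd t s m M : 0 <= t -> t <= s -> s <= T -> (forall z, t < z <= s -> m <= r z <= M) ->
    m * (s - t) <= G s - G t <= M * (s - t).
  move=> t0 ts sT rm.
  have -> : G s - G t = \int[mu]_(z in `]t, s]) r z.
    rewrite /G !clamp_id ?t0 ?(le_trans t0 ts)//; last by rewrite (le_trans ts).
    by rewrite (@Rintegral_itvB _ r (BLeft 0) (BRight s) t) ?bnd_simp//; exact: ir.
  have mst : fine (mu `]t, s]) = s - t.
    rewrite lebesgue_measure_itv/= lte_fin; case: ltP => //= st.
    by apply/esym/eqP; rewrite subr_eq0 eq_le ts st.
  have mI : measurable (`]t, s]%classic : set R) by [].
  have its : mu.-integrable `]t, s] (EFin \o r).
    apply: integrableS (ir s sT) => // z; rewrite /= !in_itv/= => /andP[tz ->].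
    by rewrite andbT (le_trans t0)// ltW.
  have icst c : mu.-integrable `]t, s] (EFin \o (fun=> c : R)).
    apply: measurable_bounded_integrable => //.
      by rewrite /= lebesgue_measure_itv/=; case: ifP => // _; rewrite -EFinB ltry.
    by exists `|c|; split; [rewrite num_real|move=> x cx z _; exact: ltW].
  apply/andP; split.
    rewrite -mst -Rintegral_cst//; apply: le_Rintegral => // z; rewrite /= in_itv/=.
    by move=> /rm /andP[].
  rewrite -mst -Rintegral_cst//; apply: le_Rintegral => // z; rewrite /= in_itv/=.
  by move=> /rm /andP[].
have [C CP] := @cadlag_bounded R R^o r 0 T cr T0.
have GL t s : 0 <= t -> t <= s -> s <= T -> `|G s - G t| <= C * (s - t).
  move=> t0 ts sT.
  have [z|h1 h2] := andP (Gbnd t s (- C) C t0 ts sT _).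
    move=> /andP[tz zs]; rewrite -ler_norml CP// (le_trans t0 (ltW tz)).
    by rewrite (le_trans zs).
  by rewrite ler_norml h2 -mulNr h1.
have GL' t s : `|G s - G t| <= C * `|clamp 0 T s - clamp 0 T t|.
  have Gc u : G u = G (clamp 0 T u) by rewrite /G (clamp_id (clamp_itv u T0)).
  rewrite (Gc s) (Gc t); have /andP[a1 a2] := clamp_itv s T0; have /andP[b1 b2] := clamp_itv t T0.
  have [h|h] := leP (clamp 0 T t) (clamp 0 T s).
    by rewrite [X in C * X]ger0_norm ?subr_ge0// GL.
  have := GL _ _ a1 (ltW h) b2.
  by rewrite distrC [X in _ -> _ <= C * X]distrC [X in _ -> _ <= C * X]gtr0_norm ?subr_gt0.
have cG : continuous G.
  move=> t; apply/cvgrPdistC_lt => e e0.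
  have C0 : 0 < C + 1.
    by rewrite ltr_wpDl//; apply: le_trans (CP 0 _); rewrite ?lexx.
  have /cvgrPdistC_lt/(_ (e / (C + 1))) := @continuous_clamp R 0 T t.
  rewrite divr_gt0// => /(_ isT); apply: filterS => s H.
  apply: le_lt_trans (GL' _ _) _; apply: (@le_lt_trans _ _ ((C + 1) * `|clamp 0 T s - clamp 0 T t|)).
    by rewrite ler_wpM2r// lerDl.
  by rewrite mulrC -ltr_pdivlMr.
have GD t : 0 <= t < T -> rderiv (G : R -> R^o) t (r t).
  move=> /andP[t0 tT] e e0; have [/cvgr_distC_le/(_ _ e0)/near_rightP[d d0 dP] _] := cr t.
  near=> s; have ts : t < s by [].
  have sT : s <= T by near: s; exact: nbhs_right_le.
  have sd : s < t + d by near: s; apply: nbhs_right_lt; rewrite ltrDl.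
  have [z|h1 h2] := andP (Gbnd t s (r t - e) (r t + e) t0 (ltW ts) sT _).
    move=> /andP[tz zs]; have := dP z; rewrite tz (le_lt_trans zs sd) => /(_ isT).
    by rewrite ler_norml => /andP[]; lra.
  rewrite ler_norml; move: h1 h2; rewrite /GRing.scale/=; lra.
have := @rderiv_eq0_cst R R^o (fun t => B t - G t) 0 T T0.
have -> : G 0 = 0 by rewrite /G clamp_id ?lexx// set_itv1 Rintegral_set1.
rewrite subr0 => <-.
- by rewrite /G (@clamp_id R 0 T T) ?T0 ?lexx// opprB addrC subrK.
- by move=> t; apply: cvgB; [exact: cB|exact: cG].
- by move=> t tT; rewrite -(subrr (r t)); apply: rderivB; [exact: BP|exact: GD].
Unshelve. all: by end_near. Qed.

Lemma cadlag_bounded_convergence (r_ : nat -> R -> R) (B_ : nat -> R -> R) T C : 0 <= T ->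
  (forall n, cadlag (r_ n)) -> (forall n t, 0 <= t <= T -> `|r_ n t| <= C) ->
  (forall t, 0 <= t <= T -> r_ n t @[n --> \oo] --> (0 : R)) ->
  (forall n, continuous (B_ n)) -> (forall n, B_ n 0 = 0) ->
  (forall n t, 0 <= t < T -> rderiv (B_ n : R -> R^o) t (r_ n t)) ->
  B_ n T @[n --> \oo] --> (0 : R).
Proof.
move=> T0 cr rC r0 cB B0 BP.
have mT : measurable (`[0, T]%classic : set R) by [].
have [|||||_ _] := @dominated_convergence _ _ R mu `[0, T]%classic mT
    (fun n => EFin \o r_ n) (cst 0%E) (fun=> C%:E).
- by move=> n; apply/measurable_EFinP; exact: cadlag_measurable.
- exact: measurable_cst.
- by apply: aeW => t; rewrite /= in_itv/= => tT; apply: cvg_EFin; [exact: nearW|exact: r0].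
- have : mu.-integrable `[0, T] (EFin \o (fun=> C)); last exact.
  apply: measurable_bounded_integrable => //.
    by rewrite /= lebesgue_measure_itv/=; case: ifP => // _; rewrite -EFinB ltry.
  by exists `|C|; split; [rewrite num_real|move=> x cx z _; exact: ltW].
- by apply: aeW => t n; rewrite /= in_itv/= => tT; rewrite lee_fin rC.
rewrite integral_cst// mul0e => /fine_cvgP[_] /=.
apply: cvg_trans; apply: near_eq_cvg; apply: nearW => n.
have := cadlag_primitive_Rintegral (cr n) T0 (cB n) (BP n).
by rewrite B0 subr0 => ->.
Qed.

End CadlagIntegral.

(** * Needle variations *)

Section RadialRetraction.
Context {R : realType} {X : normedModType R}.
Variable (r : R).
Hypothesis r0 : 0 < r.

Definition retract (h : X) : X := (r / Num.max r `|h|) *: h.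

Let maxr_gt0 (h : X) : 0 < Num.max r `|h|. Proof. by rewrite lt_max r0. Qed.

Lemma retract_id h : `|h| <= r -> retract h = h.
Proof. by move=> hr; rewrite /retract max_l// divff ?gt_eqF// scale1r. Qed.

Lemma retract_norm h : `|retract h| <= r.
Proof.
rewrite /retract normrZ ger0_norm ?divr_ge0 ?(ltW r0) ?(ltW (maxr_gt0 h))//.
rewrite mulrAC ler_pdivrMr//; apply: ler_wpM2l; first exact: ltW.
by rewrite le_max lexx orbT.
Qed.

(** One unit of the constant comes from moving the vector, the other from the change of the scaling
    factor, itself controlled by the difference of the norms. *)
Lemma retract_lipschitz h k : `|retract h - retract k| <= 2 * `|h - k|.
Proof.
rewrite /retract; set a := Num.max r `|h|; set b := Num.max r `|k|.
have a0 : 0 < a by exact: maxr_gt0.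
have b0 : 0 < b by exact: maxr_gt0.
have ar : r <= a by rewrite le_max lexx.
have bk : `|k| <= b by rewrite le_max lexx orbT.
have -> : (r / a) *: h - (r / b) *: k = (r / a) *: (h - k) + (r / a - r / b) *: k.
  by rewrite scalerBr scalerBl addrA subrK.
rewrite (le_trans (ler_normD _ _))// !normrZ mulr2n mulrDl mul1r lerD//.
  rewrite ler_piMl// normfV (gtr0_norm r0) (gtr0_norm a0).
  by rewrite ler_pdivrMr// mul1r.
have ab : `|a - b| <= `|h - k|.
  have hk : `|h| <= `|k| + `|h - k| by rewrite -{1}[h](subrK k) addrC ler_normD.
  have kh : `|k| <= `|h| + `|h - k| by rewrite -{1}[k](subrK h) distrC addrC ler_normD.
  have := normr_ge0 (h - k) => hk0.
  by rewrite /a /b ler_norml; apply/andP; split; rewrite /Num.max;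
    case: ltP => h1; case: ltP => h2; lra.
have -> : r / a - r / b = (r / a) * ((b - a) / b).
  by field; rewrite !gt_eqF.
rewrite !normrM !normfV (gtr0_norm b0) (gtr0_norm a0) (gtr0_norm r0) (distrC b).
have -> : r / a * (`|a - b| / b) * `|k| = (r / a) * (`|k| / b) * `|a - b| by ring.
apply: le_trans ab; rewrite ler_piMl//.
have h1 : r / a <= 1 by rewrite ler_pdivrMr// mul1r.
have h2 : `|k| / b <= 1 by rewrite ler_pdivrMr// mul1r.
have h3 : 0 <= `|k| / b by rewrite divr_ge0// ltW.
have h4 : 0 <= r / a by rewrite divr_ge0// ltW.
by rewrite -[leRHS](mulr1 1) ler_pM.
Qed.

Lemma continuous_retract : continuous retract.
Proof.
move=> h; apply/cvgrPdist_lt => e e0.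
have : \forall k \near h, `|h - k| < e / 2.
  by apply: cvgr_dist_lt; [exact: cvg_id|rewrite divr_gt0].
apply: filterS => k hk; apply: le_lt_trans (retract_lipschitz _ _) _.
by rewrite mulrC -ltr_pdivlMr.
Qed.

End RadialRetraction.

Section ReferenceProcess.
Context {R : realType} {E : completeNormedModType R} {U : topologicalType}.
Variables (T : R) (Omega : set E) (f : R -> E -> U -> E) (x0 : R -> E) (u0 : R -> U).

(* All the data are extended to the whole time line by clamping time to [0, T]. *)
Record reference_process : Prop := {
  rp_T : 0 < T;
  rp_open : open Omega;
  rp_continuous : forall t x z, Omega x ->
    {for ((t, x), z), continuous (fun w : R * E * U => f w.1.1 w.1.2 w.2)};
  rp_gateaux : forall t x z, Omega x -> gateaux_differentiable (fun y => f t y z) x;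
  rp_DG : forall (K : set E) (M : set U), K `<=` Omega -> compact K -> compact M ->
    exists B, forall t x z, K x -> M z -> `|DG (fun y => f t y z) x| <= B;
  rp_frechet : forall t z, differentiable (fun y => f t y z) (x0 t);
  rp_DF : forall t z, {for (t, z), continuous (fun w : R * U => DF (fun y => f w.1 y w.2) (x0 w.1))};
  rp_f_clamp : forall t, f (clamp 0 T t) = f t;
  rp_x0 : continuous x0;
  rp_x0_clamp : forall t, x0 (clamp 0 T t) = x0 t;
  rp_Omega : forall t, Omega (x0 t);
  rp_u0 : cadlag u0;
  rp_u0_disc : finite_disc u0;
  rp_u0_clamp : forall t, u0 (clamp 0 T t) = u0 t;
  rp_u0T : u0 @ T^'- --> u0 T;
  rp_ode : forall t, 0 <= t < T -> rderiv x0 t (f t (x0 t) (u0 t)) }.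

Definition tube (M : set U) r L := [/\ 0 < r, 0 <= L,
  forall t y, `|x0 t - y| < r -> Omega y &
  forall t y y' z, M z -> `|x0 t - y| < r -> `|x0 t - y'| < r ->
    `|f t y z - f t y' z| <= L * `|y - y'|].

Hypothesis rp : reference_process.

Lemma rp_f_cvg (I : Type) (F : set_system I) {FF : Filter F} (a : I -> R) (b : I -> E)
    (c : I -> U) t x z : Omega x ->
  a @ F --> t -> b @ F --> x -> c @ F --> z -> f (a i) (b i) (c i) @[i --> F] --> f t x z.
Proof. by move=> *; apply: (f_cvg (Omega := Omega)) => //; exact: (rp_continuous rp). Qed.

Lemma x0_range_compact : compact (x0 @` `[0, T]).
Proof.
apply: continuous_compact; last exact: segment_compact.
by apply: continuous_subspaceT; exact: (rp_x0 rp).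
Qed.

Lemma x0_range t : (x0 @` `[0, T]) (x0 t).
Proof.
exists (clamp 0 T t); last exact: (rp_x0_clamp rp).
by rewrite /= in_itv/=; apply: clamp_itv; exact: ltW (rp_T rp).
Qed.

Lemma exists_tube M : compact M -> exists r : R, exists L : R, tube M r L.
Proof.
move=> cM; have KO : x0 @` `[0, T] `<=` Omega by move=> _ [t _ <-]; exact: (rp_Omega rp).
have [r [L [r0 L0 H]]] := tube_lipschitz (rp_open rp) (rp_continuous rp)
  (rp_gateaux rp) (rp_DG rp) KO x0_range_compact cM.
exists r, L; split => //.
  by move=> t y; have [+ _] := H _ (x0_range t); exact.
by move=> t y y' z; have [_ +] := H _ (x0_range t); exact.
Qed.

Lemma f_x0_bounded M : compact M -> exists2 c : R, 0 <= c &
  forall t z, M z -> `|f t (x0 t) z| <= c.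
Proof.
move=> cM.
have cTM : compact (`[0, T]%classic `*` M) by apply: compact_setX => //; exact: segment_compact.
have : compact ((fun w : R * U => f w.1 (x0 w.1) w.2) @` (`[0, T]%classic `*` M)).
  apply: continuous_compact cTM; apply: continuous_subspaceT => w.
  apply: rp_f_cvg; [exact: (rp_Omega rp)|exact: cvg_fst| |exact: cvg_snd].
  by apply: cvg_comp; [exact: cvg_fst|exact: (rp_x0 rp)].
move=> /compact_bounded[B [Breal BP]].
have B1 : B < `|B| + 1 by rewrite (le_lt_trans (ler_norm B))// ltrDl.
exists (`|B| + 1); first by rewrite addr_ge0.
move=> t z Mz; apply: (BP _ B1).
exists (clamp 0 T t, z); last by rewrite /= (rp_f_clamp rp) (rp_x0_clamp rp).
by split => //=; rewrite in_itv/=; apply: clamp_itv; exact: ltW (rp_T rp).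
Qed.

Lemma cadlag_f x v : continuous x -> (forall t, Omega (x t)) -> cadlag v ->
  cadlag (fun t => f t (x t) (v t)).
Proof.
move=> cx Ox cv.
apply: (@cadlag_comp _ (R * E)%type U E (fun p z => f p.1 p.2 z) (fun t => (t, x t)) v) => //.
  move=> t; have idt : id @ t --> t by exact: cvg_id.
  exact: (cvg_pair idt (cx t)).
by move=> t z; exact: (rp_continuous rp).
Qed.

Lemma cadlag_DF v : cadlag v -> cadlag (fun t => DF (fun y => f t y (v t)) (x0 t)).
Proof.
move=> cv; apply: (@cadlag_comp _ R U _ (fun t z => DF (fun y => f t y z) (x0 t)) id v) => //.
  by move=> t; exact: cvg_id.
by move=> t z; exact: (rp_DF rp).
Qed.

(** The deviation from [x0] is retracted to radius [r / 2] inside the vector field, so that the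
    Picard theorem applies globally with constant [2 * L]. Gronwall's bound then keeps the solution
    where the retraction is the identity. *)
Lemma perturbed_trajectory M r L v (b B : R -> R) :
  tube M r L -> cadlag v -> (forall t, M (v t)) ->
  continuous B -> B 0 = 0 -> (forall t, 0 <= t < T -> [/\ rderiv (B : R -> R^o) t (b t), 0 <= b t &
    `|f t (x0 t) (v t) - f t (x0 t) (u0 t)| <= b t]) ->
  expR (2 * L * T) * B T <= r / 2 ->
  exists x, [/\ continuous x, x 0 = x0 0, forall t, x (clamp 0 T t) = x t,
    forall t, `|x t - x0 t| <= expR (2 * L * T) * B T &
    forall t, 0 <= t < T -> rderiv x t (f t (x t) (v t))].
Proof.
move=> [r0 L0 rO fL] cv Mv cB B0 BP Br.
have T0 := rp_T rp; have r20 : 0 < r / 2 by rewrite divr_gt0.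
pose rho := @retract R E (r / 2).
have rho_in t h : `|x0 t - (x0 t + rho h)| < r.
  rewrite opprD addrA subrr add0r normrN (le_lt_trans (retract_norm r20 h))//; lra.
pose G t h := f t (x0 t + rho h) (v t) - f t (x0 t) (u0 t).
have GL t y z : `|G t y - G t z| <= 2 * L * `|y - z|.
  rewrite /G opprB addrA subrK.
  apply: le_trans (fL t _ _ _ (Mv t) (rho_in t y) (rho_in t z)) _.
  rewrite opprD addrACA subrr add0r -mulrA mulrCA ler_wpM2l//.
  exact: retract_lipschitz.
have Gc y : continuous y -> cadlag (fun t => G t (y t)).
  move=> cy; apply: cadlagB; last by apply: cadlag_f; [exact: (rp_x0 rp)|exact: (rp_Omega rp)|exact: (rp_u0 rp)].
  apply: cadlag_f => // t; last exact: rO (rho_in _ _).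
  apply: cvgD; first exact: (rp_x0 rp).
  by apply: continuous_comp; [exact: cy|exact: continuous_retract].
have L20 : 0 <= 2 * L by rewrite mulr_ge0.
have [y [cy y0 yP]] := picard 0 L20 (ltW T0) GL Gc.
have yB : forall t, 0 <= t <= T -> `|y t| <= expR (2 * L * t) * B t.
  apply: (gronwall L20 (ltW T0) cy y0 cB B0) => t tT.
  have [Bd b0 fb] := BP t tT; exists (G t (y t)), (b t); split => //; first exact: yP.
  have -> : G t (y t) = (G t (y t) - G t 0) + (f t (x0 t) (v t) - f t (x0 t) (u0 t)).
    rewrite {3}/G /rho retract_id ?normr0 ?(ltW r20)// addr0.
    by rewrite subrK.
  rewrite (le_trans (ler_normD _ _))// lerD//.
  by have := GL t (y t) 0; rewrite subr0.
have Bmono t : 0 <= t <= T -> 0 <= B t <= B T.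
  move=> /andP[t0 tT].
  have mono p q : 0 <= p -> p <= q -> q <= T -> B p <= B q.
    move=> p0 pq qT; rewrite -subr_ge0.
    have := @rderiv_mean_value R R^o (fun=> 0) B p q pq (fun=> cvg_cst _) cB.
    rewrite subrr normr0; apply => s /andP[ps sq].
    have [|Bd b0 _] := BP s; first by rewrite (le_trans p0)// (lt_le_trans sq).
    by exists 0, (b s); split; [exact: rderiv_cst|by []|rewrite normr0].
  by rewrite -{1}B0 !mono.
have yr t : 0 <= t <= T -> `|y t| <= expR (2 * L * T) * B T.
  move=> tT; apply: le_trans (yB t tT) _; have /andP[h1 h2] := Bmono t tT.
  apply: ler_pM; [exact: expR_ge0|exact: h1| |exact: h2].
  by rewrite ler_expR ler_wpM2l//; case/andP: tT.
exists (fun t => x0 t + y (clamp 0 T t)); split.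
- move=> t; apply: cvgD; first exact: (rp_x0 rp).
  by apply: continuous_comp; [exact: continuous_clamp|exact: cy].
- by rewrite clamp_id ?lexx ?ltW// y0 addr0.
- by move=> t; rewrite (clamp_id (clamp_itv t (ltW T0))) (rp_x0_clamp rp).
- by move=> t; rewrite addrAC subrr add0r yr// clamp_itv// ltW.
move=> t tT; have /andP[t0 tT'] := tT.
have ct : clamp 0 T t = t by rewrite clamp_id// t0 ltW.
have H := rderivD (rp_ode rp tT) (yP t tT).
have E1 : rho (y t) = y t by apply: retract_id => //; rewrite (le_trans (yr t _))// t0 ltW.
rewrite /G E1 addrC subrK in H; rewrite ct.
apply: rderiv_eq H; first by rewrite ct.
near=> s; rewrite clamp_id//; apply/andP; split.
  by rewrite (le_trans t0)//; near: s; exact: nbhs_right_ge.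
by near: s; exact: nbhs_right_le.
Unshelve. all: by end_near. Qed.

End ReferenceProcess.

Lemma cvg_finsum {R : realType} (V : normedModType R) (T : Type) (F : set_system T)
    {FF : Filter F} (I : Type) (r : seq I) (P : pred I) (f : I -> T -> V) (l : I -> V) :
  (forall i, P i -> f i @ F --> l i) ->
  \sum_(i <- r | P i) f i t @[t --> F] --> \sum_(i <- r | P i) l i.
Proof.
move=> fl; elim: r => [|i r IHr].
  by rewrite big_nil; under eq_fun do rewrite big_nil; exact: cvg_cst.
rewrite big_cons; under eq_fun do rewrite big_cons.
by case: ifPn => // Pi; apply: cvgD => //; exact: fl.
Qed.

Section Ramp.
Context {R : realType}.
Implicit Types (s a t : R).

Lemma near_right_itv s s' t : \forall r \near t^'+, (s <= r < s') = (s <= t < s').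
Proof.
have [ss|ss] := leP s t; last first.
  near=> r; rewrite leNgt (_ : r < s)//; by near: r; exact: nbhs_right_lt.
have [st|st] := ltP t s'; last first.
  near=> r; have tr : t < r by [].
  by rewrite (ltNge r) (le_trans st (ltW tr)) !andbF.
near=> r; have tr : t < r by [].
rewrite (le_trans ss (ltW tr))/=; near: r; exact: nbhs_right_lt.
Unshelve. all: by end_near. Qed.

Lemma near_left_itv s s' t : exists b : bool, \forall r \near t^'-, (s <= r < s') = b.
Proof.
have [st|st] := ltP s t; last first.
  exists false; near=> r; have rt : r < t by [].
  by rewrite leNgt (lt_le_trans rt st).
have [ts|ts] := leP t s'; last first.
  exists false; near=> r; have sr : s' <= r by near: r; exact: nbhs_left_ge.
  by rewrite [r < s']ltNge sr andbF.
exists true; near=> r; have rt : r < t by [].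
have sr : s <= r by near: r; exact: nbhs_left_ge.
by rewrite sr (lt_le_trans rt ts).
Unshelve. all: by end_near. Qed.

Lemma near_itv s s' t : t != s -> t != s' -> \forall r \near t, (s <= r < s') = (s <= t < s').
Proof.
move=> ts ts'.
have H c : t != c -> \forall r \near t, (c <= r) = (c <= t).
  rewrite neq_lt => /orP[tc|ct].
    by near=> r; rewrite !leNgt tc (_ : r < c)//; near: r; exact: lt_nbhsl.
  by near=> r; rewrite !ltW//; near: r; exact: lt_nbhsr.
by apply: filterS2 (H _ ts) (H _ ts') => r h1 h2; rewrite !ltNge h1 h2.
Unshelve. all: by end_near. Qed.

(** The time spent before [t] in the needle [[s, s + a)], that is, the primitive of its
    indicator. *)
Definition ramp s a t := clamp 0 a (t - s).

Lemma continuous_ramp s a : continuous (ramp s a).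
Proof.
move=> t; apply: (@continuous_comp _ _ _ (fun t => t - s) (clamp 0 a)).
  by apply: cvgB; [exact: cvg_id|exact: cvg_cst].
exact: continuous_clamp.
Qed.

Lemma ramp0 s a t : 0 <= a -> t <= s -> ramp s a t = 0.
Proof. by move=> a0 ts; rewrite /ramp clamp_le// subr_le0. Qed.

Lemma ramp_end s a t : 0 <= a -> s + a <= t -> ramp s a t = a.
Proof. by move=> a0 st; rewrite /ramp clamp_ge//; lra. Qed.

Lemma rderiv_ramp s a t : 0 <= a ->
  rderiv (ramp s a : R -> R^o) t ((s <= t < s + a)%R%:R).
Proof.
move=> a0; have [st|ts] := leP s t; last first.
  apply: rderiv_eq (@rderiv_cst _ R^o 0 t); first by rewrite ramp0// ltW.
  by near=> r; rewrite ramp0//; near: r; exact: nbhs_right_le.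
have [tsa|sat] := ltP t (s + a); last first.
  apply: rderiv_eq (@rderiv_cst _ R^o a t); first by rewrite ramp_end.
  by near=> r; rewrite ramp_end// (le_trans sat)//; near: r; exact: nbhs_right_ge.
have := rderiv_line (1 : R^o) s t; apply: rderiv_eq.
  by rewrite [_ *: _]mulr1 /ramp clamp_id//; lra.
near=> r; have tr : t < r by [].
have rs : r < s + a by near: r; exact: nbhs_right_lt.
by rewrite [_ *: _]mulr1 /ramp clamp_id//; lra.
Unshelve. all: by end_near. Qed.

End Ramp.

Section NeedleControl.
Context {R : realType} {U : topologicalType} {N : nat}.
Implicit Types (s a : 'I_N -> R) (v : 'I_N -> U) (u : R -> U) (t T : R).

Definition needle s a v u t := if [pick k | s k <= t < s k + a k] is Some k then v k else u t.

Lemma needle_eq s a v u t : (forall k, ~~ (s k <= t < s k + a k)) -> needle s a v u t = u t.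
Proof.
by move=> H; rewrite /needle; case: pickP => // k sk; have := H k; rewrite sk.
Qed.

Lemma needle_near (F : set_system R) {FF : Filter F} s a v u (b : 'I_N -> bool) :
  (forall k, \forall r \near F, (s k <= r < s k + a k) = b k) ->
  \forall r \near F, needle s a v u r = if [pick k | b k] is Some k then v k else u r.
Proof.
move=> H; have : \forall r \near F, forall k, (s k <= r < s k + a k) = b k.
  exact: filter_forall.
by apply: filterS => r br; rewrite /needle (eq_pick br).
Qed.

Lemma needle_cadlag s a v u : cadlag u -> cadlag (needle s a v u).
Proof.
move=> cu t; have [ur [y ul]] := cu t; split.
  have H := needle_near v u (fun k => near_right_itv (s k) (s k + a k) t).
  have -> : needle s a v u t = if [pick k | s k <= t < s k + a k] is Some k then v k else u t.
    by [].
  case: pickP H => [k _|_] H; first by apply: cvg_near_cst; exact: H.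
  by apply: cvg_trans ur; apply: near_eq_cvg; near=> r; apply/esym; near: r; exact: H.
have /choice[b bP] := fun k => near_left_itv (s k) (s k + a k) t.
have := needle_near v u bP; case: pickP => [k _|_] H.
  by exists (v k); apply: cvg_near_cst; exact: H.
by exists y; apply: cvg_trans ul; apply: near_eq_cvg; near=> r; apply/esym; near: r; exact: H.
Unshelve. all: by end_near. Qed.

Lemma needle_disc s a v u : finite_disc u -> finite_disc (needle s a v u).
Proof.
move=> [D uD]; exists (D ++ [seq s k | k <- enum 'I_N] ++ [seq s k + a k | k <- enum 'I_N]) => t.
rewrite !mem_cat !negb_or => /and3P[tD ts tsa].
have H k : \forall r \near t, (s k <= r < s k + a k) = (s k <= t < s k + a k).
  apply: near_itv.
    by apply: contra ts => /eqP ->; rewrite map_f ?mem_enum.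
  by apply: contra tsa => /eqP ->; apply: map_f; rewrite mem_enum.
have := needle_near v u H.
rewrite /prop_for /continuous_at.
have -> : needle s a v u t = if [pick k | s k <= t < s k + a k] is Some k then v k else u t.
  by [].
case: pickP => [k _|_] {}H.
  by apply: cvg_near_cst; exact: H.
by apply: cvg_trans (uD _ tD); apply: near_eq_cvg; near=> r; apply/esym; near: r; exact: H.
Unshelve. all: by end_near. Qed.

Lemma needle_end s a v u T : (forall k, s k + a k < T) -> u @ T^'- --> u T ->
  needle s a v u @ T^'- --> needle s a v u T.
Proof.
move=> saT uT; have H t : (forall k, s k + a k <= t) -> needle s a v u t = u t.
  by move=> sat; apply: needle_eq => k; rewrite [t < _]ltNge sat andbF.
rewrite H; last by move=> k; exact: ltW.
apply: cvg_trans uT; apply: near_eq_cvg.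
have : \forall r \near T^'-, forall k, s k + a k <= r.
  by apply: filter_forall => k; exact: nbhs_left_ge.
by apply: filterS => r rP; rewrite H.
Qed.

Lemma needle_in (M : set U) s a v u : (forall k, M (v k)) -> (forall t, M (u t)) ->
  forall t, M (needle s a v u t).
Proof. by move=> Mv Mu t; rewrite /needle; case: pickP. Qed.

End NeedleControl.

Section NeedleTrajectories.
Context {R : realType} {E : completeNormedModType R} {U : topologicalType} {N : nat}.
Variables (T : R) (Omega : set E) (f : R -> E -> U -> E) (x0 : R -> E) (u0 : R -> U).
Hypothesis rp : reference_process T Omega f x0 u0.
Variables (M : set U) (r L c : R) (v : 'I_N -> U).
Hypothesis tubeP : tube Omega f x0 M r L.
Hypothesis c0 : 0 <= c.
Hypothesis f_c : forall t z, M z -> `|f t (x0 t) z| <= c.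
Hypothesis Mu0 : forall t, M (u0 t).
Hypothesis Mv : forall k, M (v k).

Definition trajectory u x := [/\ continuous x, x 0 = x0 0, forall t, x (clamp 0 T t) = x t &
  forall t, 0 <= t < T -> rderiv x t (f t (x t) (u t))].

Implicit Types (s a : 'I_N -> R).

Lemma rderiv_sum_ramp (I : finType) (s a : I -> R) K t : (forall k, 0 <= a k) ->
  rderiv (fun t => K * \sum_k ramp (s k) (a k) t : R^o) t
    (K * \sum_k (s k <= t < s k + a k)%R%:R).
Proof.
move=> a0; have := rderivM (@rderiv_cst R R^o K t)
  (@rderiv_sum R R^o _ (index_enum I) xpredT (fun k => ramp (s k) (a k)) t
    (fun k => (s k <= t < s k + a k)%R%:R) (fun k _ => rderiv_ramp (s k) t (a0 k))).
by rewrite mul0r add0r.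
Qed.

Lemma continuous_sum_ramp (I : finType) (s a : I -> R) K :
  continuous (fun t => K * \sum_k ramp (s k) (a k) t).
Proof.
move=> t; apply: cvgMr; apply: (@cvg_finsum R R^o) => k _.
exact: continuous_ramp.
Qed.

Lemma needle_trajectory s a : (forall k, 0 <= s k) -> (forall k, 0 <= a k) ->
  (forall k, s k + a k < T) -> expR (2 * L * T) * (2 * c * \sum_k a k) <= r / 2 ->
  exists2 x, trajectory (needle s a v u0) x &
    forall t, `|x t - x0 t| <= expR (2 * L * T) * (2 * c * \sum_k a k).
Proof.
move=> s0 a0 sT small.
pose B t := 2 * c * \sum_k ramp (s k) (a k) t.
have BT : B T = 2 * c * \sum_k a k.
  by congr (_ * _); apply: eq_bigr => k _; rewrite ramp_end// ltW.
have c20 : 0 <= 2 * c by rewrite mulr_ge0.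
have [||||||x [cx xx0 xc xr xP]] := @perturbed_trajectory R E U T Omega f x0 u0 rp M r L (needle s a v u0)
    (fun t => 2 * c * \sum_k (s k <= t < s k + a k)%R%:R) B tubeP.
- by apply: needle_cadlag; exact: (rp_u0 rp).
- exact: needle_in.
- exact: continuous_sum_ramp.
- by rewrite /B big1 ?mulr0// => k _; rewrite ramp0.
- move=> t tT; split; first exact: rderiv_sum_ramp.
    by rewrite mulr_ge0// sumr_ge0.
  rewrite /needle; case: pickP => [k sk|_]; last first.
    by rewrite subrr normr0 mulr_ge0// sumr_ge0.
  apply: (@le_trans _ _ (2 * c)).
    rewrite mulr2n mulrDl mul1r (le_trans (ler_normB _ _))// lerD//; exact: f_c.
  by rewrite ler_peMr// (bigD1 k)//= sk lerDl sumr_ge0.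
- by rewrite BT.
by exists x => //; move=> t; rewrite -BT.
Qed.

(** With common starting points, the two controls can differ only on the intervals between the two
    end points of each needle, of total length the sum of the [|a k - a' k|]. This gives continuity
    of the end point in the needle lengths. *)
Lemma needle_stability s a a' x x' : (forall k, 0 <= s k) ->
  (forall k, 0 <= a k) -> (forall k, 0 <= a' k) ->
  (forall k, s k + a k < T) -> (forall k, s k + a' k < T) ->
  trajectory (needle s a v u0) x -> trajectory (needle s a' v u0) x' ->
  (forall t, `|x t - x0 t| < r) -> (forall t, `|x' t - x0 t| < r) ->
  `|x T - x' T| <= expR (L * T) * (2 * (c + L * r) * \sum_k `|a k - a' k|).
Proof.
move=> s0 a0 a'0 sT s'T [cx xx0 xc xP] [cx' x'x0 x'c x'P] xr x'r.
have [r0 L0 rO fL] := tubeP.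
have T0 := rp_T rp.
(* Along [x'], which stays in the tube, [f] is at most [c + L * r], so changing the control changes
   the velocity by at most twice that. *)
pose K := 2 * (c + L * r).
have K0 : 0 <= K by rewrite !mulr_ge0// addr_ge0// mulr_ge0// ltW.
pose p k := s k + Num.min (a k) (a' k).
pose B t := K * \sum_k ramp (p k) `|a k - a' k| t.
have pE k : p k + `|a k - a' k| = s k + Num.max (a k) (a' k).
  rewrite /p -addrA; congr (_ + _); rewrite /Num.min /Num.max; case: ltP => h.
    by rewrite ltr0_norm ?subr_lt0//; ring.
  by rewrite ger0_norm ?subr_ge0//; ring.
have BT : B T = K * \sum_k `|a k - a' k|.
  congr (_ * _); apply: eq_bigr => k _; rewrite ramp_end// pE ltW//.
  by rewrite /Num.max; case: ifP.
have B0 : B 0 = 0.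
  rewrite /B big1 ?mulr0// => k _; rewrite ramp0// addr_ge0//.
  by rewrite le_min a0 a'0.
have T01 : 0 <= T <= T by rewrite lexx ltW.
rewrite -BT; apply: (@gronwall R E (fun t => x t - x' t) B L T L0 (ltW T0) _ _ _ B0 _ T T01).
- by move=> t; apply: cvgB; [exact: cx|exact: cx'].
- by rewrite xx0 x'x0 subrr.
- exact: continuous_sum_ramp.
move=> t tT; set w := needle s a v u0 t; set w' := needle s a' v u0 t.
exists (f t (x t) w - f t (x' t) w'), (K * \sum_k (p k <= t < p k + `|a k - a' k|)%R%:R).
split; first by apply: rderivB; [exact: xP|exact: x'P].
- exact: rderiv_sum_ramp.
- by rewrite mulr_ge0// sumr_ge0.
have Mw : M w by exact: needle_in.
have Mw' : M w' by exact: needle_in.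
have xr' t' : `|x0 t' - x t'| < r by rewrite distrC.
have x'r' t' : `|x0 t' - x' t'| < r by rewrite distrC.
have fx'c z : M z -> `|f t (x' t) z| <= c + L * r.
  move=> Mz; rewrite -[f t (x' t) z](subrK (f t (x0 t) z)) addrC.
  rewrite (le_trans (ler_normD _ _))// lerD ?f_c//.
  have h00 : `|x0 t - x0 t| < r by rewrite subrr normr0.
  rewrite (le_trans (fL t _ _ _ Mz (x'r' t) h00))// ler_wpM2l// ltW//.
rewrite -(subrKA (f t (x' t) w)) (le_trans (ler_normD _ _))// lerD//.
  exact: fL.
have [k sk|nosym] := pickP (fun k => p k <= t < p k + `|a k - a' k|).
  apply: (@le_trans _ _ K).
    rewrite /K mulr2n mulrDl mul1r (le_trans (ler_normB _ _))// lerD//; exact: fx'c.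
  by rewrite ler_peMr// (bigD1 k)//= sk lerDl sumr_ge0.
suff -> : w = w' by rewrite subrr normr0 mulr_ge0// sumr_ge0.
rewrite /w /w' /needle; congr (match _ with Some k => v k | None => u0 t end).
apply: eq_pick => k /=; have /negbT := nosym k; rewrite pE /p negb_and -ltNge -leNgt.
move=> /orP[h|h]; congr (_ && _).
  rewrite (lt_le_trans h) ?lerD2l ?ge_min ?lexx//.
  by rewrite (lt_le_trans h)// lerD2l ge_min lexx orbT.
rewrite !ltNge (le_trans _ h) ?lerD2l ?le_max ?lexx//.
by rewrite (le_trans _ h)// lerD2l le_max lexx orbT.
Qed.

End NeedleTrajectories.

Lemma frechet_bound {R : realType} {X Y : normedModType R} (g : X -> Y) x e :
  differentiable g x -> 0 < e -> exists2 d : R, 0 < d &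
    forall h, `|h| < d -> `|g (x + h) - g x - DF g x h| <= e * `|h|.
Proof.
move=> dg e0; have dl := diff_locallyx dg.
have : \forall h \near (0 : X), `|g (h + x) - g x - 'd g x h| <= e * `|h|.
  near=> h; rewrite dl -addrA -opprD addrAC subrr add0r; near: h.
  exact: littleoP.
move=> /nbhs_ballP[d /= d0 dP]; exists d => // h hd; rewrite DF_diff// [x + h]addrC.
by apply: dP; rewrite -ball_normE/= sub0r normrN.
Unshelve. all: by end_near. Qed.

Lemma bounded_bilinear_scale {R : realType} {X : normedModType R} :
  bounded_bilinear (fun (c : R^o) (y : X) => c *: y).
Proof.
split => [c d x y|y d c c'|c y]; last by rewrite normrZ.
  by rewrite scalerDr !scalerA [c * d]mulrC.
by rewrite scalerDl scalerA.
Qed.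

Lemma near0_mulr_lt {R : realType} (c d : R) : 0 < d -> \forall w \near 0^'+, c * w < d.
Proof.
move=> d0; have : c * w @[w --> 0^'+] --> c * 0.
  by apply: cvg_at_right_filter; apply: cvgMr; exact: cvg_id.
by rewrite mulr0 => /cvgr_lt; apply.
Qed.

(** * First-order expansion of the end point *)

Section NeedleDifferential.
Context {R : realType} {E : completeNormedModType R} {U : topologicalType} {N : nat}.
Variables (T : R) (Omega : set E) (f : R -> E -> U -> E) (x0 : R -> E) (u0 : R -> U).
Hypothesis rp : reference_process T Omega f x0 u0.
Variables (M : set U) (r L CA : R) (v : 'I_N -> U) (Y : 'I_N -> R -> E).
Hypothesis tubeP : tube Omega f x0 M r L.
Hypothesis Mu0 : forall t, M (u0 t).
Hypothesis Mv : forall k, M (v k).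
Let A t := DF (fun y => f t y (u0 t)) (x0 t).
Hypothesis A_le : forall t, 0 <= t <= T -> `|A t| <= CA.
Hypothesis cY : forall k, continuous (Y k).
Hypothesis YP : forall k t, 0 <= t < T -> rderiv (Y k) t (A t (Y k t)).

Implicit Types (s a : 'I_N -> R).

Let frechet_error x t := `|f t (x t) (u0 t) - f t (x0 t) (u0 t) - A t (x t - x0 t)|.

(** The deviation minus the ramped sum of the [Y k] solves the linearized equation with a forcing
    term: the Frechet error outside the needles, and at most [e + (L + CA) * kappa] more inside
    them, by the Lipschitz bound. Gronwall's inequality concludes. *)
Lemma needle_remainder s a x e kappa P :
  (forall k, 0 <= s k) -> (forall k, 0 <= a k) -> (forall k, s k + a k < T) ->
  (forall j k t, s j <= t < s j + a j -> s k <= t < s k + a k -> j = k) ->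
  trajectory T f x0 (needle s a v u0) x -> (forall t, `|x t - x0 t| <= kappa) -> kappa < r ->
  0 <= e -> (forall k t, s k <= t < s k + a k ->
    `|f t (x0 t) (v k) - f t (x0 t) (u0 t) - Y k t| <= e) ->
  continuous P -> P 0 = 0 ->
  (forall t, 0 <= t < T -> rderiv (P : R -> R^o) t (frechet_error x t)) ->
  `|x T - x0 T - \sum_k a k *: Y k T| <=
    expR (CA * T) * (P T + (e + (L + CA) * kappa) * \sum_k a k).
Proof.
move=> s0 a0 sT disj [cx xx0 xc xP] xk kr e0 ek cP P0 PP.
have [r0 L0 rO fL] := tubeP; have T0 := rp_T rp.
have T01 : 0 <= T <= T by rewrite lexx ltW.
have CA0 : 0 <= CA by apply: le_trans (A_le T01).
have k0 : 0 <= kappa by apply: le_trans (xk 0).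
pose K := e + (L + CA) * kappa.
have K0 : 0 <= K by rewrite addr_ge0// mulr_ge0// addr_ge0.
pose z t := x t - x0 t - \sum_k ramp (s k) (a k) t *: Y k t.
pose B t := P t + K * \sum_k ramp (s k) (a k) t.
have -> : x T - x0 T - \sum_k a k *: Y k T = z T.
  by congr (_ - _); apply: eq_bigr => k _; rewrite ramp_end// ltW.
have -> : P T + K * \sum_k a k = B T.
  by congr (_ + _ * _); apply: eq_bigr => k _; rewrite ramp_end// ltW.
apply: (@gronwall R E z B CA T CA0 (ltW T0) _ _ _ _ _ T T01).
- move=> t; apply: cvgB.
    by apply: cvgB; [exact: cx|exact: (rp_x0 rp)].
  apply: cvg_finsum => k _; apply: (bilin_cvg bounded_bilinear_scale).
    exact: continuous_ramp.
  exact: cY.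
- by rewrite /z xx0 subrr sub0r big1 ?oppr0// => k _; rewrite ramp0// scale0r.
- by move=> t; apply: cvgD; [exact: cP|exact: continuous_sum_ramp].
- by rewrite /B P0 add0r big1 ?mulr0// => k _; rewrite ramp0.
move=> t tT; pose ind k := (s k <= t < s k + a k)%R.
pose w := needle s a v u0 t.
exists (f t (x t) w - f t (x0 t) (u0 t) -
  \sum_k ((ind k)%:R *: Y k t + ramp (s k) (a k) t *: A t (Y k t))).
exists (frechet_error x t + K * \sum_k (ind k)%:R).
have tT' : 0 <= t <= T by move: tT => /andP[-> /ltW].
have ind0 : 0 <= \sum_k (ind k)%:R :> R by rewrite sumr_ge0.
split.
- apply: rderivB; first by apply: rderivB; [exact: xP|exact: (rp_ode rp)].
  apply: rderiv_sum => k _.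
  apply: (@rderiv_bilin R R^o E E _ bounded_bilinear_scale (ramp (s k) (a k)) (Y k)).
    exact: rderiv_ramp.
  exact: YP.
- by apply: rderivD; [exact: PP|exact: rderiv_sum_ramp].
- by rewrite addr_ge0 ?mulr_ge0//; exact: normr_ge0.
have -> : f t (x t) w - f t (x0 t) (u0 t) -
    \sum_k ((ind k)%:R *: Y k t + ramp (s k) (a k) t *: A t (Y k t)) =
  A t (z t) + (f t (x t) w - f t (x0 t) (u0 t) - A t (x t - x0 t) - \sum_k (ind k)%:R *: Y k t).
  have abel (p q s' t' : E) : q - s' + (p - q - t') = p - (t' + s').
    by rewrite addrC addrAC subrKA opprD [- t' - s']addrC addrA.
  rewrite /z blinB blin_sum big_split/= abel; congr (_ - (_ + _)).
  by apply: eq_bigr => k _; rewrite blinZ.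
rewrite (le_trans (ler_normD _ _))// lerD//.
  by rewrite (le_trans (blin_norm_le _ _))// ler_wpM2r// A_le.
have [/existsP[k sk]|nos] := boolP [exists k, ind k].
  have wk : w = v k.
    rewrite /w /needle; case: pickP => [j sj|/(_ k)]; last by rewrite -/(ind k) sk.
    by rewrite (disj _ _ _ sj sk).
  have -> : \sum_k (ind k)%:R *: Y k t = Y k t.
    rewrite (bigD1 k)//= sk scale1r big1 ?addr0// => j jk.
    suff /negbTE -> : ~~ ind j by rewrite scale0r.
    by apply: contra jk => /disj/(_ sk) ->.
  have sum1 : 1 <= \sum_k (ind k)%:R :> R by rewrite (bigD1 k)//= sk lerDl sumr_ge0.
  rewrite (@le_trans _ _ K)//; last first.
    apply: (@le_trans _ _ (K * \sum_k (ind k)%:R)); first by rewrite ler_peMr.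
    by rewrite lerDr; exact: normr_ge0.
  rewrite wk.
  have -> : f t (x t) (v k) - f t (x0 t) (u0 t) - A t (x t - x0 t) - Y k t =
     (f t (x0 t) (v k) - f t (x0 t) (u0 t) - Y k t) +
     ((f t (x t) (v k) - f t (x0 t) (v k)) - A t (x t - x0 t)).
    have abel (p q u' w' y : E) : p - u' - w' - y = q - u' - y + (p - q - w').
      by apply/esym; rewrite addrC (addrAC p (- q)) -(addrA q) subrKA addrA (addrAC p (- w')).
    exact: abel.
  rewrite (le_trans (ler_normD _ _))// /K lerD ?ek//.
  rewrite (le_trans (ler_normB _ _))// mulrDl lerD//.
    rewrite (le_trans (fL t _ _ _ (Mv k) _ _))//.
    - by rewrite distrC (le_lt_trans (xk t)).
    - by rewrite subrr normr0.
    - by rewrite ler_wpM2l.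
  by rewrite (le_trans (blin_norm_le _ _))// ler_pM// A_le.
have ind_0 k : ind k = false.
  by apply/negbTE; apply: contra nos => indk; apply/existsP; exists k.
rewrite /w needle_eq; last by move=> k; rewrite -/(ind k) ind_0.
rewrite [X in _ - X](_ : _ = 0); last by rewrite big1// => k _; rewrite ind_0 scale0r.
rewrite subr0 -[leLHS]addr0; apply: lerD; first by [].
by rewrite mulr_ge0.
Qed.

Variable tk : 'I_N -> R.
Hypothesis tkT : forall k, 0 <= tk k < T.
Hypothesis Y_tk : forall k, Y k (tk k) =
  f (tk k) (x0 (tk k)) (v k) - f (tk k) (x0 (tk k)) (u0 (tk k)).

(* The needles sharing a base point [tk k] are placed side by side, in slots of width [w]. *)
Definition slot w (k : 'I_N) := tk k + k%:R * w.

(** Needles with the same base point are separated by their index; those with distinct base points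
    by a gap that exceeds [N.+1%:R * w] for small [w]. *)
Lemma slots d : 0 < d -> \forall w \near 0^'+, forall a, (forall k, 0 <= a k <= w) ->
  [/\ forall k, 0 <= slot w k, forall k, slot w k + a k < T,
      forall k, slot w k + a k < tk k + d &
      forall j k t, slot w j <= t < slot w j + a j -> slot w k <= t < slot w k + a k -> j = k].
Proof.
move=> d0.
have H1 : \forall w \near 0^'+, forall k : 'I_N, N.+1%:R * w < T - tk k.
  apply: filter_forall => k; apply: near0_mulr_lt; rewrite subr_gt0.
  by case/andP: (tkT k).
have H2 : \forall w \near 0^'+, N.+1%:R * w < d by exact: near0_mulr_lt.
have H3 : \forall w \near 0^'+, forall jk : 'I_N * 'I_N, tk jk.1 < tk jk.2 ->
    N.+1%:R * w < tk jk.2 - tk jk.1.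
  apply: filter_forall => jk; have [h|h] := ltP (tk jk.1) (tk jk.2); last by near=> w.
  have := @near0_mulr_lt _ N.+1%:R (tk jk.2 - tk jk.1).
  by rewrite subr_gt0 => /(_ h); apply: filterS.
near=> w => a aw.
have w0 : 0 < w by [].
have h1 : forall k : 'I_N, N.+1%:R * w < T - tk k by near: w.
have h2 : N.+1%:R * w < d by near: w.
have h3 : forall jk : 'I_N * 'I_N, tk jk.1 < tk jk.2 -> N.+1%:R * w < tk jk.2 - tk jk.1.
  by near: w.
have sa k : slot w k + a k <= tk k + k.+1%:R * w.
  by rewrite /slot -natr1 mulrDl mul1r addrA lerD2l; case/andP: (aw k).
have kN (k : 'I_N) : k.+1%:R * w <= N.+1%:R * w.
  by rewrite ler_wpM2r ?(ltW w0)// ler_nat ltnS ltnW.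
have tks k : tk k <= slot w k by rewrite /slot lerDl mulr_ge0// ltW.
split.
- by move=> k; apply: le_trans (tks k); case/andP: (tkT k).
- by move=> k; have := sa k; have := kN k; have := h1 k; lra.
- by move=> k; have := sa k; have := kN k; lra.
have lt_jk j k t : tk j < tk k -> slot w j <= t < slot w j + a j ->
    slot w k <= t < slot w k + a k -> False.
  move=> jk /andP[_ tj] /andP[tk_ _]; have := sa j; have := kN j; have := h3 (j, k) jk.
  by move=> /= ? ?; have := tks k; lra.
have eq_jk (j k : 'I_N) t : (j < k)%N -> tk j = tk k -> slot w j <= t < slot w j + a j ->
    slot w k <= t < slot w k + a k -> False.
  move=> jk e /andP[_ tj] /andP[tk_ _]; have := sa j.
  have : j.+1%:R * w <= k%:R * w by rewrite ler_wpM2r ?(ltW w0)// ler_nat.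
  by move: tk_; rewrite {1}/slot -e; lra.
move=> j k t tj tk_; have [e|h] := eqVneq (tk j) (tk k).
  have [jk|kj|/val_inj//] := ltngtP j k; first by have := eq_jk j k t jk e tj tk_.
  by have := eq_jk k j t kj (esym e) tk_ tj.
move: h; rewrite neq_lt => /orP[h|h]; first by have := lt_jk j k t h tj tk_.
by have := lt_jk k j t h tk_ tj.
Unshelve. all: by end_near. Qed.

(** A failing sequence is considered. Divided by [w], the Frechet errors are bounded by
    [(L + CA) * C] through the Lipschitz bound and tend to 0 at each time by differentiability on
    the arc, so their primitives at [T] tend to 0 by bounded convergence. *)
Lemma needle_differential C e : 0 < e -> 0 <= C ->
  exists2 d : R, 0 < d & forall w a x, 0 < w < d -> (forall k, 0 <= a k <= w) ->
    trajectory T f x0 (needle (slot w) a v u0) x -> (forall t, `|x t - x0 t| <= C * w) ->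
    `|x T - x0 T - \sum_k a k *: Y k T| <= e * w.
Proof.
move=> e0 C0; apply: contrapT => H.
have T0 := rp_T rp; have [r0 L0 rO fL] := tubeP.
have T01 : 0 <= T <= T by rewrite lexx ltW.
have CA0 : 0 <= CA by apply: le_trans (A_le T01).
have /choice[p pP] : forall n : nat, exists p : R * ('I_N -> R) * (R -> E),
    [/\ 0 < p.1.1 < n.+1%:R^-1, forall k, 0 <= p.1.2 k <= p.1.1,
      trajectory T f x0 (needle (slot p.1.1) p.1.2 v u0) p.2,
      forall t, `|p.2 t - x0 t| <= C * p.1.1 &
      e * p.1.1 < `|p.2 T - x0 T - \sum_k p.1.2 k *: Y k T|].
  move=> n; apply: contrapT => Hn; apply: H; exists n.+1%:R^-1; first by rewrite invr_gt0.
  move=> w a x wn aw xt xw; rewrite leNgt; apply/negP => Hlt; apply: Hn.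
  by exists ((w, a), x); split.
pose w n := (p n).1.1; pose a n := (p n).1.2; pose x n := (p n).2.
have w0 n : 0 < w n by have [/andP[]] := pP n.
have wcvg : w n @[n --> \oo] --> (0 : R).
  apply: (squeeze_cvgr _ (cvg_cst 0) (@cvg_harmonic R)); apply: nearW => n.
  by have [/andP[/ltW h1 /ltW h2] _ _ _ _] := pP n; rewrite h1 h2.
have wright : w n @[n --> \oo] --> (0 : R)^'+.
  move=> S /= [d /= d0 dS]; have [N1 _ N1P] := cvgr0_norm_lt _ wcvg _ d0; exists N1 => // n /N1P /= wn.
  by apply: dS => //=; rewrite sub0r normrN.
have xw n t : `|x n t - x0 t| <= C * w n by have [_ _ _ + _] := pP n; exact.
have Cw : C * w n @[n --> \oo] --> (0 : R) by rewrite -(mulr0 C); apply: cvgMr.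
have Cwr : \forall n \near \oo, C * w n < r by have /cvgr_lt := Cw; apply.
have [n0 _ n0P] := Cwr.
(* The trajectories are only known to stay in the tube from the index [n0] on. *)
pose m n := (n0 + n)%N.
have xr n t : `|x0 t - x (m n) t| < r.
  by rewrite distrC (le_lt_trans (xw _ _))//; apply: n0P; rewrite /= leq_addr.
have mcvg (F : nat -> R) (l : R) : F n @[n --> \oo] --> l -> F (m n) @[n --> \oo] --> l.
  by move=> Fl; exact: cvg_comp (cvg_addnl n0) Fl.
pose rho n t := frechet_error (x (m n)) t.
pose rr n t := (w (m n))^-1 * rho n t.
have cvec n : cadlag (fun t => f t (x (m n) t) (u0 t) - f t (x0 t) (u0 t) - A t (x (m n) t - x0 t)).
  have [_ _ [cx _ _ _] _ _] := pP (m n).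
  apply: cadlagB.
    apply: cadlagB; apply: (cadlag_f rp); [exact: cx| |exact: (rp_u0 rp)|
      exact: (rp_x0 rp)|exact: (rp_Omega rp)|exact: (rp_u0 rp)].
    by move=> t; apply: (rO t); exact: xr.
  have cA : cadlag A := cadlag_DF rp (rp_u0 rp).
  apply: (@cadlag_comp _ E (blin E E) E (fun h B => B h) (fun t => x (m n) t - x0 t) A) => //.
    by move=> t; apply: cvgB; [exact: cx|exact: (rp_x0 rp)].
  by move=> t B; apply: (bilin_cvg bounded_bilinear_app); [exact: cvg_snd|exact: cvg_fst].
have crr n : @cadlag R R^o (rr n).
  move=> t; have [h1 [y h2]] := cvec n t; split; first by apply: cvgMr; exact: cvg_norm h1.
  by exists ((w (m n))^-1 * `|y|); apply: cvgMr; exact: cvg_norm h2.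
have /choice[P PP] : forall n, exists P : R -> R^o, [/\ continuous P, P 0 = 0 &
    forall t, 0 <= t < T -> rderiv P t (rr n t)].
  by move=> n; exact: cadlag_primitive (crr n) (ltW T0).
have PT : P n T @[n --> \oo] --> (0 : R).
  apply: (@cadlag_bounded_convergence R rr P T ((L + CA) * C) (ltW T0)) => //.
  - move=> n t tT; rewrite /rr normrM normfV (gtr0_norm (w0 _)) mulrC ler_pdivrMr//.
    rewrite /rho /frechet_error normr_id (le_trans (ler_normB _ _))// -mulrA mulrDl lerD//.
      have h00 : `|x0 t - x0 t| < r by rewrite subrr normr0.
      by rewrite (le_trans (fL t _ _ _ (Mu0 t) (xr n t) h00))// ler_wpM2l.
    by rewrite (le_trans (blin_norm_le _ _))// ler_pM// A_le.
  - move=> t tT; apply/cvgr0Pnorm_le => q q0.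
    have C1 : 0 < C + 1 by rewrite ltr_wpDl.
    have q1 : 0 < q / (C + 1) by rewrite divr_gt0.
    have [d d0 dP] := frechet_bound (rp_frechet rp t (u0 t)) q1.
    have /cvgr_lt/(_ _ d0)[n1 _ n1P] := mcvg _ _ Cw.
    exists n1 => // n /n1P /= nd; rewrite /rr normrM normfV (gtr0_norm (w0 _)) mulrC.
    rewrite ler_pdivrMr// /rho /frechet_error normr_id.
    have xd : `|x (m n) t - x0 t| < d by rewrite (le_lt_trans (xw _ _)).
    have := dP _ xd; rewrite [x0 t + _]addrC subrK => /le_trans; apply.
    apply: (@le_trans _ _ (q / (C + 1) * (C * w (m n)))).
      by rewrite ler_wpM2l// ltW.
    rewrite mulrA ler_wpM2r ?(ltW (w0 _))// mulrAC ler_pdivrMr// ler_wpM2l ?(ltW q0)//.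
    by rewrite lerDl.
  - by move=> n; have [] := PP n.
  - by move=> n; have [] := PP n.
  - by move=> n; have [_ _] := PP n.
pose X := expR (CA * T); have X0 : 0 < X by exact: expR_gt0.
(* The error has three parts of [e / 3] each: the integrated Frechet error, the drift of the needle
   effect away from its base point, and the second-order term inside the needles. *)
pose e1 := e / 3 / (X * N%:R + 1).
have XN0 : 0 < X * N%:R + 1 by rewrite ltr_wpDl// mulr_ge0// ltW.
have e10 : 0 < e1 by rewrite !divr_gt0.
have e30 : 0 < e / 3 by rewrite divr_gt0.
have [d d0 dP] : exists2 d : R, 0 < d & forall k t, tk k <= t < tk k + d ->
    `|f t (x0 t) (v k) - f t (x0 t) (u0 t) - Y k t| <= e1.
  have : \forall d \near 0^'+, forall k t, tk k <= t < tk k + d ->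
      `|f t (x0 t) (v k) - f t (x0 t) (u0 t) - Y k t| <= e1.
    apply: filter_forall => k.
    have ck : cadlag (fun t => f t (x0 t) (v k) - f t (x0 t) (u0 t) - Y k t).
      apply: cadlagB; last exact: continuous_cadlag.
      apply: cadlagB; apply: (cadlag_f rp); [exact: (rp_x0 rp)|exact: (rp_Omega rp)| |
        exact: (rp_x0 rp)|exact: (rp_Omega rp)|exact: (rp_u0 rp)].
      by apply: continuous_cadlag => t; exact: cvg_cst.
    have [+ _] := ck (tk k); rewrite Y_tk subrr => /cvgr0_norm_le/(_ _ e10).
    move=> /near_rightP[d d0 dP]; apply/near_rightP; exists d => // d'.
    rewrite add0r => /andP[d'0 d'd] t /andP[].
    rewrite le_eqVlt => /predU1P[<-|tkt] td; first by rewrite Y_tk subrr normr0 ltW.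
    by apply: dP; rewrite tkt (lt_trans td)// ltrD2l.
  move=> /near_rightP[d d0 dP]; exists (d / 2); first by rewrite divr_gt0.
  by apply: dP; rewrite add0r divr_gt0//=; lra.
have /near_rightP[d' d'0 d'P] := slots d0.
have X_cvg (F : nat -> R) q : F n @[n --> \oo] --> (0 : R) -> q * F (m n) @[n --> \oo] --> (0 : R).
  by move=> /mcvg F0; rewrite -(mulr0 q); apply: cvgMr.
have XP : X * P n T @[n --> \oo] --> (0 : R) by rewrite -(mulr0 X); apply: cvgMr.
have [n [wn Pn Kn]] : exists n, [/\ w (m n) < d', X * P n T <= e / 3 &
    X * ((L + CA) * C * N%:R) * w (m n) <= e / 3].
  near \oo => n; exists n; split.
  - by near: n; apply: (cvgr_lt _ (mcvg _ _ wcvg)).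
  - by near: n; apply: (cvgr_le _ XP).
  - by near: n; apply: (cvgr_le _ (X_cvg w _ wcvg)).
have [wpos aw xtraj _] := pP (m n); rewrite ltNge => /negP; apply.
rewrite -/(w (m n)) -/(a (m n)) -/(x (m n)) in xtraj aw *.
have wd : 0 < w (m n) < 0 + d' by rewrite add0r w0.
have [s0 sT sd disj] := d'P (w (m n)) wd (a (m n)) aw.
have [cP P0 PD] := PP n.
have ea k t : slot (w (m n)) k <= t < slot (w (m n)) k + a (m n) k ->
    `|f t (x0 t) (v k) - f t (x0 t) (u0 t) - Y k t| <= e1.
  move=> /andP[h1 h2]; apply: dP; rewrite (lt_trans h2)// andbT (le_trans _ h1)//.
  by rewrite /slot lerDl mulr_ge0// ltW.
have Cwm : C * w (m n) < r by apply: n0P; rewrite /= leq_addr.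
have a0 k : 0 <= a (m n) k by have /andP[] := aw k.
have := @needle_remainder (slot (w (m n))) (a (m n)) (x (m n)) e1 (C * w (m n))
  (fun t => w (m n) * P n t) s0 a0 sT disj xtraj (xw _) Cwm (ltW e10) ea.
move=> /(_ _ _ _)/le_trans; apply.
- by move=> t; apply: cvgMr; exact: cP.
- by rewrite P0 mulr0.
- move=> t /PD H1; have := rderivM (@rderiv_cst R R^o (w (m n)) t) H1.
  by rewrite mul0r add0r /rr mulrA divff ?gt_eqF// mul1r.
have asum : \sum_k a (m n) k <= N%:R * w (m n).
  apply: (@le_trans _ _ (\sum_(k < N) w (m n))); first by apply: ler_sum => k _; have /andP[] := aw k.
  by rewrite sumr_const card_ord mulr_natl.
rewrite -/X; have wm := w0 (m n).
have K0 : 0 <= e1 + (L + CA) * (C * w (m n)).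
  by rewrite addr_ge0 ?(ltW e10)// mulr_ge0 ?addr_ge0// mulr_ge0// ltW.
apply: (@le_trans _ _ (X * (w (m n) * P n T + (e1 + (L + CA) * (C * w (m n))) * (N%:R * w (m n))))).
  by rewrite ler_wpM2l ?(ltW X0)// lerD2l ler_wpM2l.
have -> : X * (w (m n) * P n T + (e1 + (L + CA) * (C * w (m n))) * (N%:R * w (m n))) =
   (X * P n T + (X * N%:R) * e1 + X * ((L + CA) * C * N%:R) * w (m n)) * w (m n) by ring.
rewrite ler_wpM2r ?(ltW wm)//.
have : X * N%:R * e1 <= e / 3.
  rewrite /e1 mulrCA ler_piMr ?(ltW e30)// ler_pdivrMr// mul1r lerDl//.
lra.
Unshelve. all: by end_near. Qed.

End NeedleDifferential.

(** * Resolvent of the linearized equation *)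

Section Resolvent.
Context {R : realType} {E : completeNormedModType R}.

Variables (A : R -> blin E E) (T C : R).
Hypothesis T0 : 0 <= T.
Hypothesis cA : cadlag A.
Hypothesis A_le : forall t, `|A t| <= C.

Lemma resolvents : exists X S : R -> blin E E, [/\ continuous X, continuous S,
  forall t, 0 <= t < T -> rderiv X t (blin_comp (A t) (X t)),
  forall t, 0 <= t < T -> rderiv S t (- blin_comp (S t) (A t)) &
  forall t, 0 <= t <= T -> blin_comp (X t) (S t) = blin_id].
Proof.
have C0 : 0 <= C by apply: le_trans (A_le 0).
have [cr cl cn] := @bounded_bilinear_comp R E E E.
have compBr (B B1 B2 : blin E E) : blin_comp B (B1 - B2) = blin_comp B B1 - blin_comp B B2.
  by apply: blin_ext => x; rewrite blin_compE blinB.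
have compBl (B B1 B2 : blin E E) : blin_comp (B1 - B2) B = blin_comp B1 B - blin_comp B2 B.
  exact: blin_ext.
have ccomp (Y : R -> blin E E) : continuous Y -> cadlag (fun t => blin_comp (A t) (Y t)).
  move=> cY; apply: (@cadlag_comp _ (blin E E) (blin E E) (blin E E)
    (fun Y A => blin_comp A Y) Y A) => // t B.
  by apply: (bilin_cvg bounded_bilinear_comp); [exact: cvg_snd|exact: cvg_fst].
have ccomp' (Y : R -> blin E E) : continuous Y -> cadlag (fun t => - blin_comp (Y t) (A t)).
  move=> cY; apply: (@cadlag_comp _ (blin E E) (blin E E) (blin E E)
    (fun Y A => - blin_comp Y A) Y A) => // t B.
  by apply: cvgN; apply: (bilin_cvg bounded_bilinear_comp); [exact: cvg_fst|exact: cvg_snd].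
have [X [cX X0 XP]] := @picard R (blin E E) (fun t Y => blin_comp (A t) Y) C T blin_id C0 T0
  (fun t Y Z => ltac:(by rewrite -compBr (le_trans (blin_comp_norm _ _))// ler_wpM2r)) ccomp.
have [S [cS S0 SP]] := @picard R (blin E E) (fun t Y => - blin_comp Y (A t)) C T blin_id C0 T0
  (fun t Y Z => ltac:(by rewrite -opprD -compBl normrN (le_trans (blin_comp_norm _ _))//
    mulrC ler_wpM2r)) ccomp'.
exists X, S; split => // t tT.
(* Since the identity commutes with [A], the difference [W] solves [W' = A W - W A] with [W 0 = 0],
   and Gronwall's inequality with constant [2 * C] makes it vanish. *)
pose W t := blin_comp (X t) (S t) - blin_id.
have C20 : 0 <= 2 * C by rewrite mulr_ge0.
have := @gronwall R (blin E E) W (fun=> 0) (2 * C) T C20 T0.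
move=> /(_ _ _ _ _ _ t tT) H.
apply/eqP; rewrite -subr_eq0 -normr_le0 -/(W t) (le_trans (H _ _ _ _ _)) ?mulr0//.
- move=> s; apply: cvgB; last exact: cvg_cst.
  by apply: (bilin_cvg bounded_bilinear_comp); [exact: cX|exact: cS].
- by rewrite /W X0 S0; apply: blin_ext => x; rewrite blin_addE blin_oppE blin_compE subrr.
- by move=> s; exact: cvg_cst.
move=> s sT; pose V := blin_comp (X s) (S s).
exists (blin_comp (A s) V - blin_comp V (A s)), 0; split => //.
- rewrite -[_ - _]subr0; apply: rderivB; last exact: rderiv_cst.
  have := rderiv_bilin bounded_bilinear_comp (XP s sT) (SP s sT).
  have -> // : blin_comp (blin_comp (A s) (X s)) (S s) +
    blin_comp (X s) (- blin_comp (S s) (A s)) = blin_comp (A s) V - blin_comp V (A s).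
  apply: blin_ext => x; rewrite !blin_addE !blin_oppE !blin_compE blin_oppE.
  by rewrite blinN.
- exact: rderiv_cst.
have -> : blin_comp (A s) V - blin_comp V (A s) =
    blin_comp (A s) (W s) - blin_comp (W s) (A s).
  apply: blin_ext => x; rewrite !blin_addE !blin_oppE !blin_compE /W.
  rewrite !blin_addE !blin_oppE !blinB /= opprB.
  by rewrite subrKA.
rewrite addr0 (le_trans (ler_normB _ _))// mulr2n mulrDl mul1r mulrDl lerD//.
  by rewrite (le_trans (blin_comp_norm _ _))// ler_wpM2r.
by rewrite (le_trans (blin_comp_norm _ _))// mulrC ler_wpM2r.
Qed.

End Resolvent.

(** * The multiplier rule *)

Section MultiplierRule.
Context {R : realType} {E : completeNormedModType R} {U : topologicalType}.
Context {J : finType} {q : nat}.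
Variables (T : R) (Omega : set E) (f : R -> E -> U -> E) (x0 : R -> E) (u0 : R -> U).
Hypothesis rp : reference_process T Omega f x0 u0.
Variables (phi : J -> E -> R) (Dphi : J -> blin E R) (inact : pred J).
Variables (h : 'I_q -> E -> R) (Dh : 'I_q -> blin E R).
Hypothesis phiD : forall j, is_hadamard (phi j) (x0 T) (Dphi j).
Hypothesis phi_inact : forall j, inact j -> 0 < phi j (x0 T).
Hypothesis hD : forall b, is_hadamard (h b) (x0 T) (Dh b).
Hypothesis h0 : forall b, h b (x0 T) = 0.
Hypothesis h_cont : forall b, \forall y \near x0 T, {for y, continuous (h b)}.
Hypothesis optimal : forall v x, cadlag v -> finite_disc v -> v @ T^'- --> v T ->
  trajectory T f x0 v x -> (forall t, Omega (x t)) -> (forall b, h b (x T) = 0) ->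
  ~ forall j, if inact j then 0 < phi j (x T) else phi j (x0 T) < phi j (x T).

Let A t := DF (fun y => f t y (u0 t)) (x0 t).
Variables X S : R -> blin E E.
Hypothesis cX : continuous X.
Hypothesis XP : forall t, 0 <= t < T -> rderiv X t (blin_comp (A t) (X t)).
Hypothesis XS : forall t, 0 <= t <= T -> blin_comp (X t) (S t) = blin_id.

Local Notation I := (J + 'I_q)%type.
Let D (i : I) := match i with inl j => Dphi j | inr b => Dh b end.
Let delta t z := f t (x0 t) z - f t (x0 t) (u0 t).

(* First-order effect at time [T] of a unit needle at [t] with value [z]. *)
Definition sensitivity t z : E := X T (S t (delta t z)).

Let needle_ok (p : R * R * U) := (0 <= p.1.1) && (0 <= p.1.2 < T).
Let comb (s : seq (R * R * U)) : E := \sum_(p <- s) p.1.1 *: sensitivity p.1.2 p.2.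

(** The slack is nonnegative for objectives and active inequalities, of any sign for inactive ones,
    and zero for equalities. *)
Definition needle_cone (u : {ffun I -> R}) := exists s (sl : I -> R),
  [/\ all needle_ok s, forall j, ~~ inact j -> 0 <= sl (inl j), forall b, sl (inr b) = 0 &
      forall i, u i = D i (comb s) - sl i].

Lemma needle_cone_convex : convex_cone needle_cone.
Proof.
split.
- exists [::], (fun=> 0); split => // i.
  by rewrite /comb big_nil blin0 subr0 ffunE.
- move=> u u' [s [sl [s1 s2 s3 s4]]] [s' [sl' [s1' s2' s3' s4']]].
  exists (s ++ s'), (fun i => sl i + sl' i); split.
  + by rewrite all_cat s1.
  + by move=> j jn; rewrite addr_ge0 ?s2 ?s2'.
  + by move=> b; rewrite s3 s3' addr0.
  + by move=> i; rewrite ffunE s4 s4' /comb big_cat/= blinD opprD addrACA.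
- move=> c u c0 [s [sl [s1 s2 s3 s4]]].
  exists [seq (c * p.1.1, p.1.2, p.2) | p <- s], (fun i => c * sl i); split.
  + by rewrite all_map; apply: sub_all s1 => p /andP[p1 p2]; rewrite /needle_ok/= mulr_ge0.
  + by move=> j jn; rewrite mulr_ge0 ?s2.
  + by move=> b; rewrite s3 mulr0.
  + move=> i; rewrite ffunE s4 /comb big_map scalerBr; congr (_ - _).
    rewrite -blinZ scaler_sumr; congr (D i _); apply: eq_bigr => p _.
    by rewrite scalerA.
Qed.

Section NeedleFamily.
Hypothesis cone_full : forall u, needle_cone u.

Local Notation Tau := (option ('I_q * bool)).

(** All targets raise the objectives and inequalities by 1; [None] leaves the equalities fixed, and
    [Some (b, s)] moves the equality [b] by plus or minus 1. *)
Let target (tau : Tau) : {ffun I -> R} := [ffun i => match i with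
  | inl _ => 1
  | inr b => if tau is Some (b', s) then if b == b' then (if s then 1 else -1) else 0 else 0
  end].

(* [z] is decomposed on the vectors [+- e_b] with the coefficients [max(0, +- z_b)], so as to
   stay in the cone. *)
Let lam (tau : Tau) (z : 'rV[R]_q) : R := match tau with
  | None => 1
  | Some (b, true) => Num.max 0 (z 0 b)
  | Some (b, false) => Num.max 0 (- z 0 b)
  end.

Let lam_ge0 tau z : 0 <= lam tau z.
Proof. by case: tau => [[b []]|] /=; rewrite ?le_max ?lexx. Qed.

Let lam_le1 tau z : cube z -> lam tau z <= 1.
Proof.
move=> cz; case: tau => [[b s]|//]; have /andP[z1 z2] := cz b.
by case: s => /=; rewrite ge_max ler01//= lerNl.
Qed.

Let continuous_lam tau : continuous (lam tau).
Proof.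
move=> z; case: tau => [[b []]|]; last exact: (@cst_continuous _ _ (1 : R)).
  apply: (@continuous_max R _ (fun=> 0) (fun z : 'rV[R]_q => z 0 b) z); first exact: cst_continuous.
  exact: coord_continuous.
apply: (@continuous_max R _ (fun=> 0) (fun z : 'rV[R]_q => - z 0 b) z); first exact: cst_continuous.
by apply: continuousN => //; exact: coord_continuous.
Qed.

(** The needles realizing all targets are pooled, and only their weights depend on [z]. The target
    [None], of constant weight 1, guarantees the unit gain; the others add nonnegative gains and
    move the equalities by [z]. *)
Lemma needle_family : exists N (t : 'I_N -> R) (v : 'I_N -> U) (c : 'rV[R]_q -> 'I_N -> R) (C : R),
  [/\ forall k, 0 <= t k < T, 0 < C /\ (forall z k, cube z -> 0 <= c z k <= C),
      forall k, continuous (fun z => c z k) &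
      forall z, (forall j, ~~ inact j -> 1 <= Dphi j (\sum_k c z k *: sensitivity (t k) (v k))) /\
        (forall b, Dh b (\sum_k c z k *: sensitivity (t k) (v k)) = z 0 b)].
Proof.
have /choice[s sP] : forall tau, exists s, [/\ all needle_ok s,
    forall j, ~~ inact j -> 1 <= Dphi j (comb s) &
    forall b, Dh b (comb s) = target tau (inr b)].
  move=> tau; have [s [sl [s1 s2 s3 s4]]] := cone_full (target tau).
  exists s; split => // [j jn|b].
    by have := s4 (inl j); rewrite ffunE /= => /esym/eqP; rewrite subr_eq => /eqP ->; rewrite lerDl s2.
  by rewrite s4 s3 subr0.
pose Q := flatten [seq [seq (tau, p) | p <- s tau] | tau <- enum {: Tau}].
pose e := tnth (in_tuple Q).
exists (size Q), (fun k => (e k).2.1.2), (fun k => (e k).2.2),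
  (fun z k => lam (e k).1 z * (e k).2.1.1), (1 + \sum_k (e k).2.1.1).
have Qok : all (fun p => needle_ok p.2) Q.
  apply/allP => p /flattenP[_ /mapP[tau _ ->] /mapP[p' ps ->]] /=.
  by have [/allP/(_ _ ps)] := sP tau.
have eok k : needle_ok (e k).2 by apply: (allP Qok); exact: mem_tnth.
have e0 k : 0 <= (e k).2.1.1 by have /andP[] := eok k.
have sumE z : \sum_k (lam (e k).1 z * (e k).2.1.1) *: sensitivity (e k).2.1.2 (e k).2.2 =
    \sum_(tau : Tau) lam tau z *: comb (s tau).
  rewrite -(big_tnth _ _ _ xpredT (fun p : Tau * (R * R * U) =>
    (lam p.1 z * p.2.1.1) *: sensitivity p.2.1.2 p.2.2)).
  rewrite /Q big_flatten big_map big_enum/=; apply: eq_bigr => tau _.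
  rewrite big_map /comb scaler_sumr; apply: eq_bigr => p _ /=.
  by rewrite scalerA.
split.
- by move=> k; have /andP[] := eok k.
- split; first by rewrite ltr_wpDr// sumr_ge0.
  move=> z k cz; rewrite mulr_ge0//=.
  apply: (@le_trans _ _ (e k).2.1.1); first by rewrite ler_piMl// lam_le1.
  by rewrite (bigD1 k)//= addrCA lerDl addr_ge0// sumr_ge0.
- by move=> k z; apply: continuousM; [exact: continuous_lam|exact: cst_continuous].
move=> z; split=> [j jn|b]; rewrite sumE blin_sum.
  rewrite (bigD1 None)//= scale1r; have [_ /(_ j jn) sj _] := sP None.
  rewrite -[1]addr0 lerD// sumr_ge0// => tau _; rewrite blinZ mulr_ge0//.
  by have [_ /(_ j jn) + _] := sP tau; apply: le_trans.
transitivity (\sum_(tau : Tau) lam tau z * target tau (inr b)).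
  by apply: eq_bigr => tau _; rewrite blinZ; case: (sP tau) => _ _ ->.
rewrite (bigD1 (Some (b, true)))//= (bigD1 (Some (b, false)))/=; last first.
  by apply/eqP => -[].
rewrite {1 2}/target !ffunE/= !eqxx.
rewrite big1 ?addr0; last first.
  move=> [[b' sg]|] /andP[n1 n2]; last by rewrite /target ffunE/= mulr0.
  rewrite /target ffunE/=; have [bb|] := eqVneq b b'; last by rewrite mulr0.
  by move: n1 n2; rewrite bb; case: sg; rewrite eqxx.
rewrite mulr1 mulrN1 /Num.max; case: ltP => h1; case: ltP => h2; lra.
Qed.

(** With needles of length [w * b z k], the end point is [x0 T + w *: Yb z] up to [o(w)], uniformly
    in [z]. For one small [w], every [z] improves the active components and keeps the inactive ones
    positive, and Poincare-Miranda picks a [z] at which the equalities hold. *)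
Lemma needle_cone_not_full : False.
Proof.
have [N [tk [vk [b [cm [tkT [cm0 bcm] cb bP]]]]]] := needle_family.
have T0 := rp_T rp; have T01 : 0 <= T <= T by rewrite lexx ltW.
have [M0 cM0 M0P] := cadlag_compact_range (rp_u0 rp) (rp_u0_disc rp) (ltW T0).
pose M := M0 `|` range vk.
have cM : compact M by apply: compactU => //; apply: finite_compact; exact: finite_image.
have Mu0 t : M (u0 t).
  by left; rewrite -(rp_u0_clamp rp); apply: M0P; apply: clamp_itv; exact: ltW.
have Mv k : M (vk k) by right; exists k.
have [r [L tubeP]] := exists_tube rp cM; have [r0 L0 rO fL] := tubeP.
have [c c0 f_c] := f_x0_bounded rp cM.
have [CA A_le] := cadlag_bounded (cadlag_DF rp (rp_u0 rp)) (ltW T0).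
pose Y k t := X t (S (tk k) (delta (tk k) (vk k))).
have cY k : continuous (Y k).
  by move=> t; apply: (bilin_cvg bounded_bilinear_app); [exact: cX|exact: cvg_cst].
have YP k t : 0 <= t < T -> rderiv (Y k) t (A t (Y k t)).
  move=> tT; have := rderiv_bilin bounded_bilinear_app (XP tT)
    (@rderiv_cst _ _ (S (tk k) (delta (tk k) (vk k))) t).
  by rewrite blin0 addr0.
have Ytk k : Y k (tk k) = delta (tk k) (vk k).
  have := XS (t := tk k); have /andP[t1 t2] := tkT k; rewrite t1 ltW// => /(_ isT).
  by move=> /(congr1 (fun B : blin E E => B (delta (tk k) (vk k)))).
pose Yb z := \sum_k b z k *: Y k T.
have YbE z : Yb z = \sum_k b z k *: sensitivity (tk k) (vk k) by [].
have cYb : continuous Yb.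
  move=> z; apply: (@cvg_finsum R E _ (nbhs z) _ _ _ _ (fun k z => b z k *: Y k T)) => k _.
  exact: (@continuousZr_tmp _ _ _ (fun z => b z k) (Y k T) z (cb k z)).
pose C := expR (2 * L * T) * (2 * c * N%:R).
have C0 : 0 <= C by rewrite !mulr_ge0// expR_ge0.
pose a (e : R) (z : 'rV[R]_q) k := e * b z k.
have slotsP : \forall e \near 0^'+, forall a, (forall k, 0 <= a k <= cm * e) ->
    [/\ forall k, 0 <= slot tk (cm * e) k, forall k, slot tk (cm * e) k + a k < T,
      forall k, slot tk (cm * e) k + a k < tk k + 1 &
      forall j k t, slot tk (cm * e) j <= t < slot tk (cm * e) j + a j ->
        slot tk (cm * e) k <= t < slot tk (cm * e) k + a k -> j = k].
  have /near_rightP[d d0 dP] := slots tkT ltr01.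
  apply/near_rightP; exists (d / cm); first by rewrite divr_gt0.
  move=> e; rewrite !add0r => /andP[e0 ed]; apply: dP.
  by rewrite mulr_gt0//= add0r mulrC -ltr_pdivlMr.
have small : \forall e \near 0^'+, C * cm * e < r / 2 by apply: near0_mulr_lt; rewrite divr_gt0.
have acm e z : 0 < e -> cube z -> forall k, 0 <= a e z k <= cm * e.
  move=> e0 cz k; have /andP[h1 h2] := bcm z k cz.
  by rewrite /a mulr_ge0 ?(ltW e0)//= mulrC ler_wpM2r// ltW.
have asum e z : 0 < e -> cube z -> \sum_k a e z k <= N%:R * (cm * e).
  move=> e0 cz; apply: (@le_trans _ _ (\sum_(k < N) cm * e)).
    by apply: ler_sum => k _; have /andP[] := acm e z e0 cz k.
  by rewrite sumr_const card_ord mulr_natl.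
have [d1 d10 d1P] : exists2 d : R, 0 < d & forall e, 0 < e < d -> C * cm * e < r / 2 /\
    forall z, cube z -> exists x, trajectory T f x0 (needle (slot tk (cm * e)) (a e z) vk u0) x /\
      forall t, `|x t - x0 t| <= C * (cm * e).
  have [d2 d20 d2P] := (near_rightP _ _).1 slotsP.
  have [d3 d30 d3P] := (near_rightP _ _).1 small.
  exists (Num.min d2 d3); first by rewrite lt_min d20.
  move=> e; rewrite lt_min => /and3P[e0' ed2 ed3].
  have ed : 0 < e by [].
  have slP := d2P e; rewrite add0r e0' ed2 in slP; have {}slP := slP isT.
  have sm := d3P e; rewrite add0r e0' ed3 in sm; have {}sm := sm isT.
  split => // z cz; have e0 := ed.
  have aP := acm e z e0 cz; have [s1 s2 _ _] := slP _ aP.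
  have Ca : expR (2 * L * T) * (2 * c * \sum_k a e z k) <= C * (cm * e).
    have -> : C * (cm * e) = expR (2 * L * T) * (2 * c * (N%:R * (cm * e))).
      by rewrite /C -!mulrA.
    by rewrite ler_wpM2l ?expR_ge0// ler_wpM2l ?mulr_ge0// asum.
  have [|x tx xP] := @needle_trajectory R E U N T Omega f x0 u0 rp M r L c vk tubeP c0 f_c
    Mu0 Mv (slot tk (cm * e)) (a e z) s1 (fun k => proj1 (andP (aP k))) s2.
    by rewrite (le_trans Ca)// mulrA ltW.
  by exists x; split => // t; rewrite (le_trans (xP t)).
have /choice[x' x'P] : forall ez : R * 'rV[R]_q, exists x, 0 < ez.1 < d1 -> cube ez.2 ->
    trajectory T f x0 (needle (slot tk (cm * ez.1)) (a ez.1 ez.2) vk u0) x /\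
      forall t, `|x t - x0 t| <= C * (cm * ez.1).
  move=> [e z]; have [ed|ned] := pselect (0 < e < d1); last by exists x0.
  have [cz|ncz] := pselect (cube z); last by exists x0.
  by have [_ /(_ z cz)[x xP]] := d1P e ed; exists x.
pose x e z := x' (e, z).
have xtraj e z : 0 < e < d1 -> cube z ->
    trajectory T f x0 (needle (slot tk (cm * e)) (a e z) vk u0) (x e z).
  by move=> ed cz; case: (x'P (e, z) ed cz).
have xC e z t : 0 < e < d1 -> cube z -> `|x e z t - x0 t| <= C * (cm * e).
  by move=> ed cz; case: (x'P (e, z) ed cz) => _; exact.
have xY e : 0 < e -> \forall w \near 0^'+, forall z, cube z ->
    `|x w z T - x0 T - w *: Yb z| <= e * w.
  move=> e0; have ecm : 0 < e / cm by rewrite divr_gt0.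
  have [d d0 dP] := @needle_differential R E U N T Omega f x0 u0 rp M r L CA vk Y tubeP
    Mu0 Mv A_le cY YP tk tkT Ytk C (e / cm) ecm C0.
  near=> w => z cz; have w0 : 0 < w by [].
  have wd1 : 0 < w < d1 by rewrite w0; near: w; exact: nbhs_right_lt.
  have wd : 0 < cm * w < d.
    rewrite mulr_gt0//= mulrC -ltr_pdivlMr//; near: w; apply: nbhs_right_lt.
    by rewrite divr_gt0.
  have := dP _ _ _ wd (acm w z w0 cz) (xtraj w z wd1 cz) (fun t => xC w z t wd1 cz).
  rewrite mulrA divfK ?gt_eqF//; congr (`|_ - _| <= _).
  by rewrite /Yb scaler_sumr; apply: eq_bigr => k _; rewrite scalerA.
have xD (g : E -> R) (Dg : blin E R) : is_hadamard g (x0 T) Dg -> forall e, 0 < e ->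
    \forall w \near 0^'+, forall z, cube z ->
      `|g (x w z T) - g (x0 T) - w * Dg (Yb z)| <= e * w.
  move=> gD e e0; have e20 : 0 < e / 2 by rewrite divr_gt0.
  pose P w z := cube z -> `|g (x w z T) - g (x0 T) - w * Dg (Yb z)| <= e * w.
  suff PP z : cube z -> \forall z' \near z & w \near 0^'+, P w z'.
    have /compact_near_coveringP/(_ _ (0 : R)^'+ P _ PP) := @compact_cube R q.
    by apply: filterS => w wP z cz; exact: wP.
  move=> cz; have [d d0 dP] := hadamard_joint (Yb z) gD e20.
  have D1 : 0 < `|Dg| + 1 by rewrite ltr_wpDl.
  pose d' := Num.min (d / 2) (e / 2 / (`|Dg| + 1)).
  have d'0 : 0 < d' by rewrite lt_min !divr_gt0.
  exists ([set z' | `|Yb z - Yb z'| < d'],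
    [set w : R | 0 < w < d /\ forall z', cube z' -> `|x w z' T - x0 T - w *: Yb z'| <= d / 4 * w]).
    split => /=; first by have /cvgr_dist_lt/(_ _ d'0) := cYb z.
    have d40 : 0 < d / 4 by rewrite divr_gt0.
    have w0 : \forall w \near (0 : R)^'+, 0 < w by exact: nbhs_right_gt.
    apply: filterS3 (xY _ d40) (nbhs_right_lt d0) w0 => w wP wd w0.
    by split; [rewrite w0 wd|exact: wP].
  move=> [z' w] /= [zz' [/andP[w0 wd] wP]] cz'.
  (* The rescaled displacement is the varying direction in the joint Hadamard limit; it is close to
     [Yb z] for small [w] and [z'] near [z]. *)
  have := dP w (w^-1 *: (x w z' T - x0 T)); rewrite w0 wd => /(_ isT).
  rewrite scalerA divff ?gt_eqF// scale1r [x0 T + _]addrC subrK => gP.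
  have zd : `|Yb z' - Yb z| < d / 2.
    by rewrite distrC (lt_le_trans zz')// ge_min lexx.
  have wh : `|w^-1 *: (x w z' T - x0 T) - Yb z| < d.
    have -> : w^-1 *: (x w z' T - x0 T) - Yb z =
        w^-1 *: (x w z' T - x0 T - w *: Yb z') + (Yb z' - Yb z).
      by rewrite [w^-1 *: (_ - w *: _)]scalerBr scalerA mulVf ?gt_eqF// scale1r addrA subrK.
    apply: le_lt_trans (ler_normD _ _) _; rewrite normrZ gtr0_norm ?invr_gt0//.
    have : w^-1 * `|x w z' T - x0 T - w *: Yb z'| <= d / 4.
      by rewrite mulrC ler_pdivrMr//; exact: wP.
    move: zd d0; lra.
  have Dz : `|Dg (Yb z) - Dg (Yb z')| <= e / 2.
    rewrite -blinB; apply: le_trans (blin_norm_le _ _) _.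
    have zz : `|Yb z - Yb z'| * (`|Dg| + 1) <= e / 2.
      by rewrite -ler_pdivlMr// (le_trans (ltW zz'))// ge_min lexx orbT.
    by apply: le_trans zz; rewrite mulrC ler_wpM2l// lerDl.
  have -> : g (x w z' T) - g (x0 T) - w * Dg (Yb z') =
      (g (x w z' T) - g (x0 T) - w *: Dg (Yb z)) + w * (Dg (Yb z) - Dg (Yb z')).
    by rewrite mulrBr addrA subrK.
  rewrite (le_trans (ler_normD _ _))//.
  have -> : e * w = e / 2 * w + w * (e / 2) by field.
  by rewrite lerD ?gP// normrM gtr0_norm// ler_wpM2l// ltW.
pose B := \sum_k cm * `|Y k T|.
have Yb_le z : cube z -> `|Yb z| <= B.
  move=> cz; rewrite (le_trans (ler_norm_sum _ _ _))//; apply: ler_sum => k _.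
  have /andP[b0 b1] := bcm z k cz.
  by rewrite normrZ ger0_norm// ler_wpM2r.
have half0 : 0 < 2^-1 :> R by rewrite invr_gt0.
have phi_inc : \forall w \near 0^'+, forall j z, cube z ->
    if inact j then 0 < phi j (x w z T) else phi j (x0 T) < phi j (x w z T).
  apply: filter_forall => j; have H := xD _ _ (phiD j) _ half0.
  have s0 : \forall w \near 0^'+, inact j -> (`|Dphi j| * B + 2^-1) * w < phi j (x0 T).
    have [ij|_] := boolP (inact j); last exact: nearW.
    by apply: filterS (near0_mulr_lt (`|Dphi j| * B + 2^-1) (phi_inact ij)) => w.
  near=> w => z cz; have w0 : 0 < w by [].
  have Hw : forall z, cube z ->
    `|phi j (x w z T) - phi j (x0 T) - w * Dphi j (Yb z)| <= 2^-1 * w by near: w.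
  have sw : inact j -> (`|Dphi j| * B + 2^-1) * w < phi j (x0 T) by near: w.
  have := Hw z cz; rewrite ler_norml => /andP[+ _].
  case: ifPn => ij; last by have [/(_ j ij)] := bP z; rewrite -YbE; nra.
  have /andP[+ _] : - (`|Dphi j| * B) <= Dphi j (Yb z) <= `|Dphi j| * B.
    rewrite -ler_norml; apply: le_trans (blin_norm_le _ _) _.
    by rewrite ler_wpM2l//; exact: Yb_le.
  by have := sw ij; nra.
(* An error of [w / 2] cannot overturn the sign of [w * z 0 j] on the faces [z 0 j = 1] and
   [z 0 j = -1], which is the boundary condition of Poincare-Miranda. *)
have h_diff : \forall w \near 0^'+, forall j z, cube z -> `|h j (x w z T) - w * z 0 j| <= 2^-1 * w.
  apply: filter_forall => j; have := xD _ _ (hD j) _ half0.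
  apply: filterS => w Hw z cz; have := Hw z cz.
  by have [_ /(_ j)] := bP z; rewrite -YbE => ->; rewrite h0 subr0.
have h_near : \forall w \near 0^'+, forall j z, cube z -> {for x w z T, continuous (h j)}.
  apply: filter_forall => j; have /nbhs_ballP[rho rho0 rhoP] := h_cont j.
  have s0 := near0_mulr_lt (C * cm) rho0.
  near=> w => z cz; apply: rhoP; rewrite -ball_normE/= distrC.
  have wd1 : 0 < w < d1 by apply/andP; split => //; near: w; exact: nbhs_right_lt.
  apply: le_lt_trans (xC w z T wd1 cz) _.
  by rewrite mulrA; near: w.
near (0 : R)^'+ => w.
have w0 : 0 < w by [].
have wd1 : 0 < w < d1 by rewrite w0; near: w; exact: nbhs_right_lt.
have slP : forall a, (forall k, 0 <= a k <= cm * w) ->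
    [/\ forall k, 0 <= slot tk (cm * w) k, forall k, slot tk (cm * w) k + a k < T,
      forall k, slot tk (cm * w) k + a k < tk k + 1 &
      forall j k t, slot tk (cm * w) j <= t < slot tk (cm * w) j + a j ->
        slot tk (cm * w) k <= t < slot tk (cm * w) k + a k -> j = k] by near: w.
have phi_w : forall j z, cube z ->
    if inact j then 0 < phi j (x w z T) else phi j (x0 T) < phi j (x w z T) by near: w.
have h_w : forall j z, cube z -> `|h j (x w z T) - w * z 0 j| <= 2^-1 * w by near: w.
have ch_w : forall j z, cube z -> {for x w z T, continuous (h j)} by near: w.
have xr z t : cube z -> `|x w z t - x0 t| < r.
  move=> cz; apply: le_lt_trans (xC w z t wd1 cz) _.
  by have [+ _] := d1P w wd1; rewrite mulrA; move: r0; lra.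
(* For fixed [w] the starting points of the needles do not depend on [z]; only the lengths vary,
   continuously, so the stability estimate applies. *)
have x_cont (z : 'rV[R]_q) : cube z -> x w z' T @[z' --> within (@cube R q) (nbhs z)] --> x w z T.
  move=> cz; apply/cvgrPdist_lt => e e0.
  pose G z' := expR (L * T) * (2 * (c + L * r) * \sum_k `|a w z k - a w z' k|).
  have Gz : G z = 0 by rewrite /G big1 ?mulr0// => k _; rewrite subrr normr0.
  have cG : {for z, continuous G}.
    apply: continuousM; first exact: cst_continuous.
    apply: continuousM; first exact: cst_continuous.
    apply: (@cvg_finsum R R _ (nbhs z) _ _ _ _ (fun k z' => `|a w z k - a w z' k|)) => k _.
    apply: (@continuous_comp _ _ _ (fun z' => a w z k - a w z' k) (fun y : R => `|y|));
      last exact: norm_continuous.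
    apply: continuousB; first exact: cst_continuous.
    by apply: continuousM; [exact: cst_continuous|exact: cb].
  have Ge : \forall z' \near z, G z' < e.
    by move/cvgr_lt: (cG : G @ z --> G z) => /(_ e); rewrite Gz; apply.
  rewrite near_withinE; apply: filterS Ge => z' Ge cz'; apply: le_lt_trans Ge.
  have aP := acm w z w0 cz; have aP' := acm w z' w0 cz'.
  have [s1 s2 _ _] := slP _ aP; have [_ s2' _ _] := slP _ aP'.
  apply: (needle_stability rp tubeP c0 f_c Mu0 Mv s1 _ _ s2 s2' (xtraj w z wd1 cz) (xtraj w z' wd1 cz')).
  - by move=> k; case/andP: (aP k).
  - by move=> k; case/andP: (aP' k).
  - by move=> t; exact: xr.
  - by move=> t; exact: xr.
have [|j z cz z1|j z cz z1|z cz hz] := @poincare_miranda R q (fun j z => h j (x w z T)).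
- move=> j; apply/subspace_continuousP => z cz.
  by apply: cvg_comp (x_cont z cz) _; exact: ch_w.
- by have := h_w j z cz; rewrite z1 ler_norml => /andP[+ _]; move: w0; lra.
- by have := h_w j z cz; rewrite z1 ler_norml => /andP[_ +]; move: w0; lra.
have aP := acm w z w0 cz; have [s1 s2 _ _] := slP _ aP.
apply: (optimal _ _ _ (xtraj w z wd1 cz) _ hz) => //.
- exact: needle_cadlag (rp_u0 rp).
- exact: needle_disc (rp_u0_disc rp).
- by apply: needle_end => //; exact: rp_u0T rp.
- by move=> t; apply: (rO t); rewrite distrC; exact: xr.
- by move=> j; exact: phi_w.
Unshelve. all: by end_near.
Qed.

End NeedleFamily.

Lemma multiplier_rule : exists2 nu : I -> R, (exists i, nu i != 0) &
  [/\ forall j, 0 <= nu (inl j), forall j, inact j -> nu (inl j) = 0 &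
    forall t z, 0 <= t < T -> \sum_i nu i * D i (sensitivity t z) <= 0].
Proof.
have [u nu] : exists u, ~ needle_cone u.
  by apply: contrapT => H; apply: needle_cone_not_full => u; apply: contrapT => Hu; apply: H; exists u.
have [a an0 aC] := cone_separation needle_cone_convex nu.
have sumE (w : {ffun I -> R}) j c : (forall i, w i = c * (i == inl j)%:R) ->
    \sum_i a i * w i = a (inl j) * c.
  move=> wE; rewrite (bigD1 (inl j))//= wE eqxx mulr1 big1 ?addr0// => i ij.
  by rewrite wE (negbTE ij) !mulr0.
(* With no needle at all, the cone contains [- c] times the unit vector of [j]. Both signs of [c]
   are allowed when [j] is inactive, which makes its multiplier zero. *)
have slack j c : (0 <= c \/ inact j) -> a (inl j) * - c <= 0.
  move=> cj; pose w : {ffun I -> R} := [ffun i => - c * (i == inl j)%:R].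
  rewrite -(sumE w); last by move=> i; rewrite ffunE.
  apply: aC; exists [::], (fun i => c * (i == inl j)%:R); split => //.
  - move=> j' j'n; have [[jj]|_] := eqVneq (inl j' : I) (inl j); last by rewrite mulr0.
    by case: cj => [c0|jn]; [rewrite mulr1|move: j'n; rewrite jj jn].
  - by move=> b; rewrite mulr0.
  - by move=> i; rewrite ffunE /comb big_nil blin0 sub0r mulNr.
exists a => //; split.
- by move=> j; have := slack j 1 (or_introl ler01); rewrite mulrN1 oppr_le0.
- move=> j jn; have := slack j 1 (or_intror jn); have := slack j (-1) (or_intror jn).
  lra.
- move=> t z tT; pose w : {ffun I -> R} := [ffun i => D i (sensitivity t z)].
  under eq_bigr do rewrite -(ffunE (fun i => D i (sensitivity t z))).
  apply: aC; exists [:: (1, t, z)], (fun=> 0); split => //.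
  + by rewrite /= /needle_ok/= ler01 tT.
  + by move=> i; rewrite ffunE /comb big_seq1 scale1r subr0.
Qed.

End MultiplierRule.

(** * The adjoint arc *)

HB.instance Definition _ {R : realType} {X Y : normedModType R} (A : blin X Y) :=
  GRing.isLinear.Build R X Y *:%R A (blin_linear A).

Lemma continuous_blin {R : realType} {X Y : normedModType R} (A : blin X Y) : continuous A.
Proof.
move=> x; apply: (bilin_cvg (b := fun (B : blin X Y) y => B y) bounded_bilinear_app); first exact: cvg_cst.
exact: cvg_id.
Qed.

Lemma DF_comp_blin {R : realType} {X Y Z : normedModType R} (B : blin Y Z) (g : X -> Y) x :
  differentiable g x -> DF (fun y => B (g y)) x = blin_comp B (DF g x).
Proof.
move=> dg; have cB := @continuous_blin _ _ _ B.
have dB : differentiable B (g x) by exact: linear_differentiable.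
have dBg : differentiable (B \o g) x by exact: differentiable_comp.
apply: blin_ext => k; rewrite blin_compE (DF_diff dg) (DF_diff dBg).
by rewrite diff_comp//= (@diff_lin _ _ _ B (g x) cB).
Qed.

Section AdjointArc.
Context {R : realType} {E : completeNormedModType R} {U : topologicalType}.
Variables (T : R) (Omega : set E) (f : R -> E -> U -> E) (x0 : R -> E) (u0 : R -> U).
Hypothesis rp : reference_process T Omega f x0 u0.
Let A t := DF (fun y => f t y (u0 t)) (x0 t).
Variables (X S : R -> blin E E) (p1 : blin E R).
Hypothesis cS : continuous S.
Hypothesis SP : forall t, 0 <= t < T -> rderiv S t (- blin_comp (S t) (A t)).
Hypothesis XS : blin_comp (X T) (S T) = blin_id.
Hypothesis sens_le0 : forall t z, 0 <= t < T -> p1 (sensitivity T f x0 u0 X S t z) <= 0.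

(** The solution of the adjoint equation with terminal value [p1], since [S' = - S A] and [X T]
    inverts [S T]. *)
Definition adjoint t := blin_comp (blin_comp p1 (X T)) (S t).
Local Notation p := adjoint.

Lemma continuous_adjoint : continuous p.
Proof.
by move=> t; apply: (bilin_cvg bounded_bilinear_comp); [exact: cvg_cst|exact: cS].
Qed.

Lemma adjointT : p T = p1.
Proof.
apply: blin_ext => x; rewrite /p -blin_compA blin_compE.
by rewrite XS.
Qed.

Let phi t := - blin_comp (p t) (A t).

Let cvg_phi (F : set_system R) {FF : Filter F} t z : id @ F --> t -> u0 @ F --> z ->
  phi @ F --> - blin_comp (p t) (DF (fun y => f t y z) (x0 t)).
Proof.
move=> Ft u0z; apply: cvgN; apply: (bilin_cvg bounded_bilinear_comp).
  by exact: (cvg_comp _ _ Ft (@continuous_adjoint t)).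
exact: (cvg_comp _ _ (cvg_pair Ft u0z) (@rp_DF _ _ _ _ _ _ _ _ rp t z)).
Qed.

Lemma adjoint_equation : PC1 T p /\
  forall t, 0 <= t <= T -> ext_derive T p t = - blin_comp (p t) (A t).
Proof.
have [D uD] := rp_u0_disc rp.
apply: PC1_intro (rp_T rp) continuous_adjoint _ _ _ _.
- move=> t; have [ur [z ul]] := rp_u0 rp t; split.
    by apply: cvg_phi => //; exact: cvg_at_right_filter.
  exists (- blin_comp (p t) (DF (fun y => f t y z) (x0 t))).
  by apply: cvg_phi => //; exact: cvg_at_left_filter.
- by exists D => t /uD ut; apply: cvg_phi => //; exact: cvg_id.
- by apply: cvg_phi; [exact: cvg_at_left_filter|exact: rp_u0T rp].
- move=> t tT; have := rderiv_bilin bounded_bilinear_comp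
    (@rderiv_cst _ _ (blin_comp p1 (X T)) t) (SP tT).
  congr (rderiv _ _ _); apply: blin_ext => x.
  by rewrite blin_addE !blin_compE blin_zeroE add0r !blin_oppE blinN !blin_compE blinN.
Qed.

Let H t z := p t (f t (x0 t) z).

Let cvg_H (F : set_system R) {FF : Filter F} (v : R -> U) t z : id @ F --> t -> v @ F --> z ->
  H r (v r) @[r --> F] --> H t z.
Proof.
move=> Ft vz; apply: (bilin_cvg bounded_bilinear_app).
  by exact: (cvg_comp _ _ Ft (@continuous_adjoint t)).
apply: (rp_f_cvg rp) => //; first exact: (rp_Omega rp).
exact: (cvg_comp _ _ Ft (@rp_x0 _ _ _ _ _ _ _ _ rp t)).
Qed.

(** For [t < T] the difference of the two sides is [p1] applied to the effect of a single needle. At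
    [T] the inequality is a limit from the left, as [u0] is left continuous there. *)
Lemma maximum_principle t z : 0 <= t <= T -> H t z <= H t (u0 t).
Proof.
have lt_case s : 0 <= s < T -> H s z <= H s (u0 s).
  by move=> sT; rewrite /H -subr_le0 -blinB; exact: sens_le0.
move=> /andP[t0]; rewrite le_eqVlt => /predU1P[->|tT]; last by rewrite lt_case ?t0.
rewrite -subr_le0.
have T0 := rp_T rp.
have Tl : id @ T^'- --> T by exact: cvg_at_left_filter.
apply: (@cvgr_to_le _ T^'- _ _ (fun s => H s z - H s (u0 s))).
  by apply: cvgB; apply: cvg_H => //; [exact: cvg_cst|exact: rp_u0T rp].
near=> s; rewrite subr_le0 lt_case//; apply/andP; split; last by [].
by near: s; exact: nbhs_left_ge.
Unshelve. all: by end_near. Qed.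

(** At a jump, the maximum principle at [t] bounds the value at the left limit [y] by that at
    [u0 t]. The maximum principle at times [s < t], tested with the control [u0 t], gives the
    reverse inequality in the limit. *)
Lemma continuous_hamiltonian : {within `[0, T], continuous (fun t => H t (u0 t))}.
Proof.
have T0 := rp_T rp.
have Hr t : H s (u0 s) @[s --> t^'+] --> H t (u0 t).
  have tr : id @ t^'+ --> t by exact: cvg_at_right_filter.
  by have [ur _] := rp_u0 rp t; exact: cvg_H tr ur.
have Hl t : 0 < t <= T -> H s (u0 s) @[s --> t^'-] --> H t (u0 t).
  move=> /andP[t0 tT]; have [_ [y ul]] := rp_u0 rp t.
  have tl : id @ t^'- --> t by exact: cvg_at_left_filter.
  have Hy := cvg_H tl ul; suff -> : H t (u0 t) = H t y by exact: Hy.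
  apply/eqP; rewrite eq_le [X in _ && X]maximum_principle ?(ltW t0)// andbT.
  rewrite -subr_le0; apply: (@cvgr_to_le _ t^'- _ _ (fun s => H s (u0 t) - H s (u0 s))).
    by apply: cvgB => //; apply: cvg_H => //; exact: cvg_cst.
  near=> s; rewrite subr_le0 maximum_principle//; apply/andP; split.
    by near: s; exact: nbhs_left_ge.
  by rewrite (le_trans _ tT)//; near: s; exact: nbhs_left_le.
apply/continuous_within_itvP => //; split => //; last by apply: Hl; rewrite T0 lexx.
move=> t; rewrite in_itv/= => /andP[t0 tT].
apply/left_right_continuousP; split => //; apply: Hl.
by rewrite t0 ltW.
Unshelve. all: by end_near. Qed.

End AdjointArc.

Lemma clamp_idem {R : realType} (T t : R) : 0 < T -> clamp 0 T (clamp 0 T t) = clamp 0 T t.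
Proof. by move=> T0; rewrite clamp_id// clamp_itv// ltW. Qed.

Lemma clamp_reference_process (R : realType) (E : completeNormedModType R)
  (U : topologicalType) (T : R) (Omega : set E) (f : R -> E -> U -> E)
  (x0 : R -> E) (u0 : R -> U) : 0 < T -> open Omega ->
  PC1_in T Omega x0 -> NPC0 T u0 ->
  (forall t, 0 <= t <= T -> ext_derive T x0 t = f t (x0 t) (u0 t)) ->
  {within `[0, T] `*` Omega `*` [set: U],
     continuous (fun z : R * E * U => f z.1.1 z.1.2 z.2)} ->
  (forall t xi zeta, 0 <= t <= T -> Omega xi ->
     gateaux_differentiable (fun y => f t y zeta) xi) ->
  (forall t zeta, 0 <= t <= T -> differentiable (fun y => f t y zeta) (x0 t)) ->
  {within `[0, T] `*` [set: U],
     continuous (fun z : R * U => DF (fun y => f z.1 y z.2) (x0 z.1))} ->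
  (forall (K : set E) (M : set U),
     K `<=` Omega -> K !=set0 -> compact K -> M !=set0 -> compact M ->
     (ereal_sup [set (`|DG (fun y => f z.1.1 y z.2) z.1.2|)%:E
                | z in `[0%R, T] `*` K `*` M] < +oo)%E) ->
  reference_process T Omega (f \o clamp 0 T) (x0 \o clamp 0 T) (u0 \o clamp 0 T).
Proof.
move=> T0 oO [x0C x0O] u0N ode f_cont f_gat f_fre Df_cont DGf_bd.
have cT t : 0 <= clamp 0 T t <= T by apply: clamp_itv; exact: ltW.
have cT' t : `[0, T]%classic (clamp 0 T t) by rewrite /= in_itv/=; exact: cT.
have [cx0 x0P] := PC1_clamp T0 x0C.
have [cu0 du0 u0T] := NPC0_clamp T0 u0N.
have Ox0 t : Omega (x0 (clamp 0 T t)) by apply: x0O; exists (clamp 0 T t).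
split => //.
- move=> t x z Ox.
  have wt : w.1.1 @[w --> ((t, x), z)] --> t by exact: cvg_comp cvg_fst cvg_fst.
  have wx : w.1.2 @[w --> ((t, x), z)] --> x by exact: cvg_comp cvg_fst cvg_snd.
  apply: (@cvg_within_comp _ _ _ _ _ _ (fun z : R * E * U => f z.1.1 z.1.2 z.2)
    (fun w : R * E * U => ((clamp 0 T w.1.1, w.1.2), w.2)) ((clamp 0 T t, x), z) _ f_cont).
  + by split; [split; [exact: cT'|]|].
  + have Ow : \forall w \near ((t, x), z), Omega w.1.2.
      by apply: wx; exact: open_nbhs_nbhs.
    by apply: filterS Ow => w Ow; split; [split; [exact: cT'|]|].
  + have wc : clamp 0 T w.1.1 @[w --> ((t, x), z)] --> clamp 0 T t.
      exact: (cvg_comp _ _ wt (@continuous_clamp R 0 T t)).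
    exact: (cvg_pair (cvg_pair wc wx) cvg_snd).
- by move=> t x z Ox; exact: f_gat.
- move=> K M KO cK cM.
  have [->|/set0P K0] := eqVneq K set0; first by exists 0.
  have [->|/set0P M0] := eqVneq M set0; first by exists 0.
  have := DGf_bd K M KO K0 cK M0 cM.
  set s := ereal_sup _ => soo.
  have sub t x z : K x -> M z -> ((`|DG (fun y => f (clamp 0 T t) y z) x|)%:E <= s)%E.
    move=> Kx Mz; apply: ereal_sup_ubound.
    exists ((clamp 0 T t, x), z) => //.
    by split; [split; [exact: cT'|]|].
  case: s soo sub => [B|//|] _ sub; last by exists 0 => t x z Kx Mz; have := sub t x z Kx Mz.
  by exists B => t x z Kx Mz; have := sub t x z Kx Mz; rewrite lee_fin.
- by move=> t z; exact: f_fre.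
- move=> t z.
  apply: (@cvg_within_comp _ _ _ _ _ _ (fun z : R * U => DF (fun y => f z.1 y z.2) (x0 z.1))
    (fun w : R * U => (clamp 0 T w.1, w.2)) (clamp 0 T t, z) _ Df_cont).
  + by split; [exact: cT'|].
  + by apply: nearW => w; split; [exact: cT'|].
  + have wc : clamp 0 T w.1 @[w --> (t, z)] --> clamp 0 T t.
      have wt : w.1 @[w --> (t, z)] --> t by exact: cvg_fst.
      exact: (cvg_comp _ _ wt (@continuous_clamp R 0 T t)).
    exact: (cvg_pair wc cvg_snd).
- by move=> t /=; rewrite clamp_idem.
- by move=> t /=; rewrite clamp_idem.
- by move=> t /=; rewrite clamp_idem.
- move=> t tT; have := x0P t tT; have /andP[t0 tT'] := tT.
  by rewrite /= clamp_id ?t0 ?ltW//; rewrite ode ?t0 ?ltW.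
Unshelve. all: by end_near. Qed.

Lemma DH_hadamard {R : realType} {X Y : normedModType R} (f : X -> Y) x :
  hadamard_differentiable f x -> is_hadamard f x (DH f x).
Proof. by move=> fx; exact: (@xgetPex _ 0 [set D | is_hadamard f x D] fx). Qed.

Theorem theorem4p2 (R : realType) (E : completeNormedModType R)
  (U : topologicalType) (T : R) (Omega : set E) (xi0 : E) (l m q : nat)
  (f : R -> E -> U -> E)
  (g0 : 'I_l -> E -> R) (g : 'I_m -> E -> R) (h : 'I_q -> E -> R)
  (T_gt0 : 0 < T) (hausdorffU : hausdorff_space U)
  (openOmega : open Omega) (Omega_xi0 : Omega xi0)
  (l_gt0 : (0 < l)%N) (m_gt0 : (0 < m)%N) (q_gt0 : (0 < q)%N)
  (x0 : R -> E) (u0 : R -> U)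
  (pareto : mayer_pareto T Omega xi0 f g0 g h x0 u0)
  (f_continuous : {within `[0, T] `*` Omega `*` [set: U],
     continuous (fun z : R * E * U => f z.1.1 z.1.2 z.2)})
  (f_gateaux : forall t xi zeta, 0 <= t <= T -> Omega xi ->
     gateaux_differentiable (fun y => f t y zeta) xi)
  (f_frechet : forall t zeta, 0 <= t <= T ->
     differentiable (fun y => f t y zeta) (x0 t))
  (Df_continuous : {within `[0, T] `*` [set: U],
     continuous (fun z : R * U => DF (fun y => f z.1 y z.2) (x0 z.1))})
  (DGf_bounded : forall (K : set E) (M : set U),
     K `<=` Omega -> K !=set0 -> compact K -> M !=set0 -> compact M ->
     (ereal_sup [set (`|DG (fun y => f z.1.1 y z.2) z.1.2|)%:E
                | z in `[0%R, T] `*` K `*` M] < +oo)%E)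
  (g0_hadamard : forall i, hadamard_differentiable (g0 i) (x0 T))
  (g_hadamard : forall a, hadamard_differentiable (g a) (x0 T))
  (h_continuous : forall b, exists V : set E,
     [/\ nbhs (x0 T) V, V `<=` Omega & {within V, continuous (h b)}])
  (h_hadamard : forall b, hadamard_differentiable (h b) (x0 T)) :
  exists (theta : 'I_l -> R) (lambda : 'I_m -> R) (mu : 'I_q -> R)
         (p : R -> blin E R),
    PC1 T p /\
    [/\ (* NN *) ~ [/\ forall i, theta i = 0, forall a, lambda a = 0 &
                      forall b, mu b = 0],
        (* Si *) (forall i, 0 <= theta i) /\ (forall a, 0 <= lambda a),
        (* Sl *) forall a, lambda a * g a (x0 T) = 0 &
        (* TC *) \sum_(i < l) theta i *: DH (g0 i) (x0 T)
                 + \sum_(a < m) lambda a *: DH (g a) (x0 T)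
                 + \sum_(b < q) mu b *: DH (h b) (x0 T) = p T] /\
    [/\ (* AE *) forall t, 0 <= t <= T ->
          ext_derive T p t =
          - DF (fun y => hamiltonian f t y (u0 t) (p t)) (x0 t),
        (* MP *) forall t zeta, 0 <= t <= T ->
          hamiltonian f t (x0 t) (u0 t) (p t) >=
          hamiltonian f t (x0 t) zeta (p t) &
        (* CH *) {within `[0, T],
          continuous (fun t => hamiltonian f t (x0 t) (u0 t) (p t))}].
Proof.
have [[[x0C u0N] ode x00 g_ge0 h_eq0] popt] := pareto.
have rp := clamp_reference_process T_gt0 openOmega x0C u0N ode f_continuous f_gateaux
  f_frechet Df_continuous DGf_bounded.
set f' := f \o _ in rp; set x0' := x0 \o _ in rp; set u0' := u0 \o _ in rp.
have T0 := ltW T_gt0.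
have cid t : 0 <= t <= T -> clamp 0 T t = t by exact: clamp_id.
have x0'E t : 0 <= t <= T -> x0' t = x0 t by move=> tT; rewrite /x0'/= cid.
have u0'E t : 0 <= t <= T -> u0' t = u0 t by move=> tT; rewrite /u0'/= cid.
have f'E t : 0 <= t <= T -> f' t = f t by move=> tT; rewrite /f'/= cid.
have T0T : 0 <= T <= T by rewrite T0 lexx.
have x0T : x0' T = x0 T by exact: x0'E.
pose A t := DF (fun y => f' t y (u0' t)) (x0' t).
have cA : cadlag A := cadlag_DF rp (rp_u0 rp).
have [C A_le] : exists C, forall t, `|A t| <= C.
  have [C CP] := cadlag_bounded cA T0; exists C => t.
  have -> : A t = A (clamp 0 T t).
    by rewrite /A (rp_u0_clamp rp) (rp_x0_clamp rp) (rp_f_clamp rp).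
  by apply: CP; exact: clamp_itv.
have [X [S [cX cS XP SP XS]]] := resolvents T0 cA A_le.
(* Objectives and inequality constraints are treated alike; only constraints positive at the end
   point count as inactive. *)
pose phi (j : 'I_l + 'I_m) := match j with inl i => g0 i | inr a => g a end.
pose inact (j : 'I_l + 'I_m) := if j is inr a then 0 < g a (x0' T) else false.
pose Dphi j := DH (phi j) (x0' T).
pose Dh b := DH (h b) (x0' T).
have phiD j : is_hadamard (phi j) (x0' T) (Dphi j).
  by apply: DH_hadamard; rewrite x0T; case: j.
have phi_inact j : inact j -> 0 < phi j (x0' T) by case: j.
have hD b : is_hadamard (h b) (x0' T) (Dh b) by apply: DH_hadamard; rewrite x0T.
have h0 b : h b (x0' T) = 0 by rewrite x0T.
have h_cont b : \forall y \near x0' T, {for y, continuous (h b)}.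
  rewrite x0T; have [V [Vx _ hV]] := h_continuous b.
  apply: filterS (nbhs_interior Vx) => y Vy.
  have := (subspace_continuousP V (h b)).1 hV y (interior_subset Vy).
  by rewrite within_interior.
(* Such a pair would be admissible and improve every objective strictly; the first one, which exists
   by [l_gt0], is the witness against Pareto optimality. *)
have optimal v x : cadlag v -> finite_disc v -> v @ T^'- --> v T ->
    trajectory T f' x0' v x -> (forall t, Omega (x t)) -> (forall b, h b (x T) = 0) ->
    ~ forall j, if inact j then 0 < phi j (x T) else phi j (x0' T) < phi j (x T).
  move=> cv [D vD] vT [cx xx0 xc xP] Ox hx phix; apply: popt; exists x, v.
  have [xPC xode] : PC1 T x /\ forall t, 0 <= t <= T -> ext_derive T x t = f' t (x t) (v t).
    apply: PC1_intro => //.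
    - exact: (cadlag_f rp cx Ox cv).
    - by exists D => t /vD vt; apply: (rp_f_cvg rp) => //; exact: cx.
    - apply: (rp_f_cvg rp) => //; first exact: cvg_at_left_filter.
      exact: cvg_at_left_filter (cx T).
  split.
  - split.
    + split; first by split => // _ [t _ <-].
      by apply: NPC0_intro => //; exists D.
    + by move=> t tT; rewrite xode// f'E.
    + by rewrite xx0 x0'E ?lexx.
    + move=> a; have := phix (inr a) => /=; case: ifP => _; first exact: ltW.
      by rewrite x0T => /ltW; apply: le_trans.
    + exact: hx.
  - by move=> i; have := phix (inl i); rewrite /= x0T => /ltW.
  - by exists (Ordinal l_gt0); have := phix (inl (Ordinal l_gt0)); rewrite /= x0T.
have [nu [i0 nu0] [nu_ge0 nu_inact nu_sens]] := multiplier_rule rp phiD phi_inact hD h0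
  h_cont optimal cX XP XS.
pose pg0 := \sum_(i < l) nu (inl (inl i)) *: DH (g0 i) (x0 T).
pose pg := \sum_(a < m) nu (inl (inr a)) *: DH (g a) (x0 T).
pose ph := \sum_(b < q) nu (inr b) *: DH (h b) (x0 T).
pose p1 : blin E R := pg0 + pg + ph.
have p1E y : p1 y = pg0 y + pg y + ph y by [].
have sens_le0 t z : 0 <= t < T -> p1 (sensitivity T f' x0' u0' X S t z) <= 0.
  move=> tT; apply: le_trans (nu_sens t z tT); rewrite p1E !big_sumType/=.
  by rewrite /Dphi /Dh/= x0T /pg0 /pg /ph !blin_sumE.
have XST := XS T T0T.
have [pC pode] := adjoint_equation rp X p1 cS SP.
pose p := adjoint T X S p1.
have pmax t z : 0 <= t <= T -> p t (f' t (x0' t) z) <= p t (f' t (x0' t) (u0' t)).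
  exact: (maximum_principle rp cS sens_le0).
have pcont := continuous_hamiltonian rp cS sens_le0.
exists (fun i => nu (inl (inl i))), (fun a => nu (inl (inr a))), (fun b => nu (inr b)), p.
split; [exact: pC|split; split].
- move=> [n1 n2 n3]; move: nu0; suff -> : nu i0 = 0 by rewrite eqxx.
  by case: i0 => [[i|a]|b].
- by split => [i|a]; exact: nu_ge0.
- move=> a; have := g_ge0 a; rewrite le_eqVlt => /predU1P[<-|ga]; first by rewrite mulr0.
  by rewrite nu_inact ?mul0r//= x0T.
- by rewrite /p adjointT.
(* With the costate frozen, the Hamiltonian is a bounded linear form composed with [f], so its
   differential is [p t] composed with that of [f]. *)
- move=> t tT; rewrite pode// -x0'E// -u0'E// /hamiltonian -f'E//; congr (- _).
  by rewrite (@DF_comp_blin _ _ _ _ (p t) (fun y => f' t y (u0' t)))//; exact: (rp_frechet rp).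
- by move=> t z tT; have := pmax t z tT; rewrite f'E// x0'E// u0'E.
- apply: subspace_eq_continuous pcont => t tT.
  have {}tT : 0 <= t <= T by move: tT; rewrite inE/= in_itv.
  by rewrite /from_subspace /hamiltonian f'E// x0'E// u0'E.
Qed.
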